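(* Let $1<\alpha\le 2$, $\theta\in\mathbb{R}$ with $|\theta|\le\min\{\alpha,2-\alpha\}$, $\nu\in\mathbb{R}$ and $d>0$ be constants, and let $f,g_0\in L^2(\mathbb{R})$ be real-valued. Then the Cauchy problem $$\frac{\partial u(x,t)}{\partial t}=-\nu\frac{\partial u(x,t)}{\partial x}+d\,D^\alpha_\theta u(x,t)+f(x),\quad x\in\mathbb{R},\ t>0,\qquad u(x,0)=g_0(x),$$ has a solution, which is given for $t>0$ by $$u(x,t)=\int_{-\infty}^{+\infty}\left\{\int_0^t G^\theta_\alpha(x-y,t-\tau)\,d\tau\right\}f(y)\,dy+\int_{-\infty}^{+\infty}G^\theta_\alpha(x-y,t)\,g_0(y)\,dy,$$ where, for $t>0$ and $x\in\mathbb{R}$, $$G^\theta_\alpha(x,t)=\frac1{2\pi}\int_{-\infty}^{+\infty}e^{-ikx}\,\hat G^\theta_\alpha(k,t)\,dk,\qquad \hat G^\theta_\alpha(k,t)=e^{(i\nu k-d\,\psi^\alpha_\theta(k))t}.$$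
   Context: The Fourier transform in $x$ is $\hat h(k)=\int_{-\infty}^{+\infty}h(y)e^{iky}\,dy$ (extended to $L^2(\mathbb{R})$ as usual), with inverse $h(x)=\frac1{2\pi}\int_{-\infty}^{+\infty}\hat h(k)e^{-ikx}\,dk$. The symbol $\psi^\alpha_\theta(k)=|k|^\alpha e^{i\,\mathrm{sign}(k)\,\theta\pi/2}$ is used, with $\psi^\alpha_\theta(0)=0$. The Riesz-Feller fractional derivative $D^\alpha_\theta$ of order $\alpha$ and skewness $\theta$ in the variable $x$ is the operator with Fourier symbol $-\psi^\alpha_\theta$: the Fourier transform of $D^\alpha_\theta c(\cdot,t)$ is $-\psi^\alpha_\theta(k)\hat c(k,t)$. With this convention the Fourier transform of $\partial_x c$ is $-ik\,\hat c$. Solutions are understood in the Fourier sense: $u(\cdot,t)\in L^2(\mathbb{R})$ for every $t\ge 0$ with $u(\cdot,0)=g_0$, and there is a measurable function $\hat u(k,t)$ on $\mathbb{R}\times[0,\infty)$ which for every $t\ge0$ coincides for almost every $k$ with the Fourier transform of $u(\cdot,t)$, and such that for almost every $k$ the map $t\mapsto\hat u(k,t)$ is continuous on $[0,\infty)$, differentiable on $(0,\infty)$, and satisfies $\partial_t\hat u(k,t)=(i\nu k-d\,\psi^\alpha_\theta(k))\hat u(k,t)+\hat f(k)$ for $t>0$, with $\hat u(k,0)=\hat g_0(k)$. *)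

(* Defs.v *)
From HB Require Import structures.
From mathcomp Require Import all_boot all_order all_algebra.
From mathcomp Require Import all_classical all_reals all_analysis.
From mathcomp Require Import complex.
Set Implicit Arguments.
Unset Strict Implicit.
Unset Printing Implicit Defensive.
Import Order.TTheory GRing.Theory Num.Theory.
Import numFieldNormedType.Exports.
Local Open Scope classical_set_scope.
Local Open Scope ring_scope.
Local Open Scope complex_scope.

(* Measure theory and calculus for functions with values in [R[i]] are
   componentwise: the library has no measurable or normed R-module structure
   on [R[i]].  [Normc.normc] is the modulus as a real number. *)
Section ComplexValued.
Context {R : realType}.

Definition cexp (z : R[i]) : R[i] :=
  (expR (complex.Re z))%:C * (cos (complex.Im z) +i* sin (complex.Im z)).

Definition cmeasurable_fun d (T : measurableType d) (D : set T)
    (h : T -> R[i]) : Prop :=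
  measurable_fun D (fun x => complex.Re (h x)) /\
  measurable_fun D (fun x => complex.Im (h x)).

Definition cintegrable (D : set R) (h : R -> R[i]) : Prop :=
  (@lebesgue_measure R).-integrable D (fun x => (complex.Re (h x))%:E) /\
  (@lebesgue_measure R).-integrable D (fun x => (complex.Im (h x))%:E).

Definition cintegral (D : set R) (h : R -> R[i]) : R[i] :=
  (\int[@lebesgue_measure R]_(x in D) complex.Re (h x))%R +i*
  (\int[@lebesgue_measure R]_(x in D) complex.Im (h x))%R.

Definition L2norm (h : R -> R[i]) : \bar R :=
  'N[@lebesgue_measure R]_2%:E[(fun x => (Normc.normc (h x))%:E)]%E.

Definition inL2 (h : R -> R[i]) : Prop :=
  cmeasurable_fun [set: R] h /\ (L2norm h < +oo)%E.

Definition ccontinuous_within (D : set R) (h : R -> R[i]) : Prop :=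
  {within D, continuous (fun t => complex.Re (h t))} /\
  {within D, continuous (fun t => complex.Im (h t))}.

Definition is_cderive (h : R -> R[i]) (t : R) (l : R[i]) : Prop :=
  is_derive t 1 (fun s => complex.Re (h s)) (complex.Re l) /\
  is_derive t 1 (fun s => complex.Im (h s)) (complex.Im l).

End ComplexValued.

Section Fourier.
Context {R : realType}.

Definition fourierL1 (h : R -> R[i]) (k : R) : R[i] :=
  cintegral [set: R] (fun y => h y * cexp (0 +i* (k * y))).

(* [H] is (a representative of) the Fourier transform of [h] in L^2: the
   extension of [fourierL1] from the dense subspace L^1 /\ L^2 by L^2
   limits. *)
Definition is_fourierL2 (h H : R -> R[i]) : Prop :=
  [/\ inL2 h, inL2 H &
    exists hn : nat -> R -> R[i],
      [/\ forall n, cintegrable [set: R] (hn n) /\ inL2 (hn n),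
          L2norm (fun x => hn n x - h x) @[n --> \oo] --> 0%E &
          L2norm (fun k => fourierL1 (hn n) k - H k) @[n --> \oo] --> 0%E]].

End Fourier.

Section RieszFeller.
Context {R : realType}.
Variables (alpha theta nu d : R).

Definition psi (k : R) : R[i] :=
  (`|k| `^ alpha)%:C * cexp (0 +i* (Num.sg k * theta * pi / 2)).

Definition symbol (k : R) : R[i] := 0 +i* (nu * k) - d%:C * psi k.

Definition Ghat (k t : R) : R[i] := cexp (symbol k * t%:C).

Definition G_integrand (x t k : R) : R[i] :=
  cexp (0 -i* (k * x)) * Ghat k t.

Definition G (x t : R) : R[i] :=
  ((2 * pi)^-1)%:C * cintegral [set: R] (G_integrand x t).

(* [G] is only meaningful at positive times, hence the open interval. *)
Definition G_time_integral (z t : R) : R[i] :=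
  cintegral `]0, t[ (fun tau => G z (t - tau)).

(* Solution in the Fourier sense of
     u_t = - nu u_x + d D^alpha_theta u + f,   u(., 0) = g0;
   the right-hand side has Fourier symbol [symbol], since the transform of
   u_x is - i k times that of u and D^alpha_theta has symbol [- psi]. *)
Definition fourier_solution (f g0 : R -> R[i]) (u : R -> R -> R[i]) :
    Prop :=
  [/\ forall t, 0 <= t -> inL2 (u^~ t),
      forall x, u x 0 = g0 x &
      exists fhat ghat : R -> R[i], exists uhat : R -> R -> R[i],
        [/\ is_fourierL2 f fhat,
            is_fourierL2 g0 ghat,
            cmeasurable_fun
              ([set: measurableTypeR R] `*`
               (`[0, +oo[ : set (measurableTypeR R)))
              (fun p => uhat p.1 p.2),
            forall t, 0 <= t -> is_fourierL2 (u^~ t) (uhat^~ t) &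
            {ae @lebesgue_measure R, forall k,
              [/\ ccontinuous_within `[0, +oo[ (uhat k),
                  forall t, 0 < t ->
                    is_cderive (uhat k) t (symbol k * uhat k t + fhat k) &
                  uhat k 0 = ghat k]}]].

End RieszFeller.

(* Main.v *)
(* On the Fourier side the equation is a linear ODE for each frequency k, whose
   solution is the Duhamel formula
     uhat(k, t) = Ghat(k, t) ghat(k) + (int_0^t Ghat(k, s) ds) fhat(k).
   The constraint on theta gives |theta| < 1, so the symbol has real part
   - d cos(theta pi / 2) |k|^alpha, negative for k <> 0; hence Ghat(., t) and its
   time integral are bounded and O(|k|^(- alpha)), thus in L^1 /\ L^2.  Both
   convolutions are then inverse transforms of products by the multiplication
   formula, int (P^) h = int P (h^), for P in L^1 /\ L^2 and h in L^2.
   The L^2 theory behind this rests on the Poisson kernel, the transform of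
   exp(- e |k|): averaging against it gives Plancherel's identity and Fourier
   inversion on L^1 /\ L^2, and completeness of L^2 then yields the transform of
   an arbitrary L^2 function. *)

Require Import Defs.
From HB Require Import structures.
From mathcomp Require Import all_boot all_order all_algebra.
From mathcomp Require Import all_classical all_reals all_analysis.
From mathcomp Require Import measurable_realfun complex ring lra.
Import Order.TTheory GRing.Theory Num.Theory.
Import numFieldNormedType.Exports.
Local Open Scope classical_set_scope.
Local Open Scope ring_scope.
Local Open Scope complex_scope.
Set Implicit Arguments.
Unset Strict Implicit.
Unset Printing Implicit Defensive.

(** * Continuity of translations in L^2 *)

Section translation.
Context {R : realType}.
Notation mu := (@lebesgue_measure R).

(** The transform of an L^2 function is known only through approximating sequences, and this decides
    how the solution is built. For [t > 0] it is taken to be the inverse transform of the Duhamel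
    formula, so that membership in L^2 and the identity of its transform come from one inversion
    theorem on L^1 /\ L^2; the convolution formula is derived from it afterwards, at every [x]. At
    [t = 0] the transform of [g0] need not be integrable, and the initial value is prescribed
    directly. The delicate exchange is that of the frequency and time integrals in the term with
    [f]: the pointwise bound on [Ghat(., s)] grows like [1 / s] as [s] tends to 0. Integrating the
    modulus over time first gives at most the minimum of [t] and [1 / (kap |k|^alpha)], with
    [kap = d cos(theta pi / 2)], and this is integrable in [k] because [alpha > 1]. The damping
    exp(- e |k|) is convenient because its transform has an elementary antiderivative, is positive
    and has mass one up to the factor [2 pi]. Averages against such a kernel converge in L^2 as soon
    as translations are continuous in L^2. *)

Lemma lebesgue_measure_shift (c : R) (A : set R) : measurable A ->
  pushforward mu ((fun x => x + c) : _ -> measurableTypeR R) A = mu A.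
Proof.
move=> mA; apply/esym.
have mphi : measurable_fun [set: measurableTypeR R]
  ((fun x => x + c) : measurableTypeR R -> measurableTypeR R).
  exact: measurable_funD.
pose phi : {mfun measurableTypeR R >-> measurableTypeR R} :=
  HB.pack (fun x : measurableTypeR R => x + c : measurableTypeR R) (isMeasurableFun.Build _ _ _ _ _ mphi).
apply: (@lebesgue_measure_unique R (pushforward mu phi)) => //= _ [[a b]] _ <-.
rewrite /pushforward.
rewrite [X in _ = mu X](_ : _ = `](a - c), (b - c)]%classic); last first.
  by apply/seteqP; split => x /=; rewrite !in_itv/= ltrBlDr lerBrDr.
rewrite !lebesgue_measure_itv/= !lte_fin ltrD2r.
by case: ifPn => // _; rewrite -EFinB; congr (_%:E); ring.
Qed.

Lemma ge0_integral_shift (c : R) (f : R -> \bar R) :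
  measurable_fun [set: R] f -> (forall x, 0 <= f x)%E ->
  (\int[mu]_x f (x + c)%R = \int[mu]_x f x)%E.
Proof.
move=> mf f0.
have mphi : measurable_fun [set: measurableTypeR R]
  ((fun x => x + c) : measurableTypeR R -> measurableTypeR R).
  exact: measurable_funD.
rewrite -[LHS](@ge0_integral_pushforward _ _ _ _ _ _ mphi mu setT f)//.
by apply: eq_measure_integral => //= A mA _; exact: lebesgue_measure_shift.
Qed.

(** Serves to kill the odd sine part of the transform of [dexp]. Change of variables is applied to
    the positive and negative parts separately. *)
Lemma integral_opp (f : R -> R) : mu.-integrable setT (EFin \o f) ->
  \int[mu]_x f (- x) = \int[mu]_x f x.
Proof.
move=> fi.
have mphi : measurable_fun [set: measurableTypeR R]
  (-%R : measurableTypeR R -> measurableTypeR R) by [].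
have mf := measurable_int _ fi.
rewrite /Rintegral; congr fine.
have H (g : R -> \bar R) : measurable_fun setT g -> (forall x, 0 <= g x)%E ->
    (\int[mu]_x g (- x)%R = \int[mu]_x g x)%E.
  move=> mg g0.
  rewrite -[LHS](@ge0_integral_pushforward _ _ _ _ _ _ mphi mu setT g)//.
  by apply: eq_measure_integral => //= A mA _; exact: lebesgue_measureN.
rewrite [LHS]integralE [RHS]integralE; congr (_ - _)%E.
- rewrite -[RHS]H; [|exact: measurable_funepos|by []].
  by apply: eq_integral => x _; rewrite !funeposE.
- rewrite -[RHS]H; [|exact: measurable_funeneg|by []].
  by apply: eq_integral => x _; rewrite !funenegE.
Qed.

End translation.

(** The working form of convergence for integrals that may be infinite: a real upper bound already
    forces finiteness of the later terms. *)
Lemma ge0_ecvg0P {R : realType} (u : nat -> \bar R) : (forall n, 0 <= u n)%E ->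
  (u n @[n --> \oo] --> 0%E) <->
  (forall e : R, 0 < e -> \forall n \near \oo, (u n <= e%:E)%E).
Proof.
move=> u0; split.
- move=> /fine_cvgP[ufin /cvgr0Pnorm_lt ucv] e e0.
  near=> n.
  have un : u n \is a fin_num by near: n.
  rewrite -(fineK un) lee_fin (le_trans (ler_norm _))// ltW//.
  by near: n; exact: ucv.
- move=> H; apply/fine_cvgP; split.
    have := H 1 ltr01; apply: filterS => n un1.
    by rewrite ge0_fin_numE// (le_lt_trans un1)// ltry.
  apply/cvgr0Pnorm_le => e e0; have := H e e0; apply: filterS => n une.
  rewrite ger0_norm ?fine_ge0// -lee_fin fineK//.
  by rewrite ge0_fin_numE// (le_lt_trans une)// ltry.
Unshelve. all: by end_near. Qed.

Section shift_L2.
Context {R : realType}.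
Notation mu := (@lebesgue_measure R).

(** Uniform continuity on a segment, obtained from compactness in its near-covering form; [x + s]
    may leave the segment, so [g] is continuous on the whole line. *)
Lemma near_shift_close (g : R -> R) (M e : R) : continuous g -> 0 < e ->
  \forall s \near (0 : R), forall x, - M <= x <= M -> `|g (x + s) - g x| < e.
Proof.
move=> cg e0.
have /compact_near_coveringP H := @segment_compact R (- M) M.
have {}H := H R (nbhs (0 : R)) (fun s x => `|g (x + s) - g x| < e) _.
suff /H : forall x, `[- M, M]%classic x ->
    \forall x' \near x & i \near (0 : R), `|g (x' + i) - g x'| < e.
  by apply: filterS => s hs x Mx; apply: hs; rewrite /= in_itv.
move=> x _.
have e20 : 0 < e / 2 by rewrite divr_gt0.
have /cvgrPdist_lt/(_ _ e20) gx := cg x.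
have : (fun p : R * R => p.1 + p.2) @ nbhs (x, (0:R)) --> nbhs x.
  rewrite -{2}(addr0 x); apply: cvgD; [exact: cvg_fst|exact: cvg_snd].
move=> /(_ _ gx) h1.
have : (fun p : R * R => p.1) @ nbhs (x, (0:R)) --> nbhs x by exact: cvg_fst.
move=> /(_ _ gx) h2.
near=> p.
have a1 : `|g x - g (p.1 + p.2)| < e / 2 by near: p.
have a2 : `|g x - g p.1| < e / 2 by near: p.
rewrite /= (_ : _ - _ = (g x - g p.1) - (g x - g (p.1 + p.2))); last by ring.
by rewrite (le_lt_trans (ler_normB _ _))// (splitr e) ltrD.
Unshelve. all: by end_near. Qed.

(** Continuous functions are dense in L^1 of a segment, and for a continuous function uniform
    continuity suffices. The same [N] bounds the values and the support of [b]. *)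
Lemma shift_L1_bounded (b : R -> R) (N e : R) : measurable_fun setT b ->
  0 <= N -> (forall x, `|b x| <= N) -> (forall x, N < `|x| -> b x = 0) -> 0 < e ->
  \forall s \near (0 : R), (\int[mu]_x `|b (x + s)%R - b x|%:E <= e%:E)%E.
Proof.
move=> mb N0 bN bout e0.
(* For [|s| < 1] and [|x| <= N + 1] both [x] and [x + s] lie in [E]; for larger [|x|] both values of
   [b] vanish. *)
pose M := N + 2.
pose E := `[- M, M]%classic : set R.
have M0 : 0 < M by rewrite ltr_wpDl.
have mE : measurable E by exact: measurable_itv.
have muE : mu E = (M + M)%:E.
  by rewrite lebesgue_measure_itv/= lte_fin gtrN// -EFinD opprK.
have ib : mu.-integrable E (EFin \o b).
  apply: measurable_bounded_integrable => //.
  - by rewrite [X in (X < _)%E]muE ltry.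
  - exact: measurable_funTS.
  - exists N; split; first exact: num_real.
    by move=> x Nx y _ /=; rewrite (le_trans (bN y))// ltW.
have [|g_ [cg ig]] := @approximation_continuous_integrable R E b mE _ ib.
  by rewrite [X in (X < _)%E]muE ltry.
have e30 : 0 < e / 3 by rewrite divr_gt0.
have hge0 k : (0 <= \int[mu]_(z in E) `|(b z - g_ k z)%:E|)%E by exact: integral_ge0.
move=> /(ge0_ecvg0P hge0) /(_ _ e30) [n _ /(_ n (leqnn _)) hn].
set g := g_ n in hn.
have mg : measurable_fun setT g by apply: continuous_measurable_fun; exact: cg.
pose k z := (`|b z - g z| * \1_E z)%:E.
have mk : measurable_fun setT k.
  apply/measurable_EFinP; apply: measurable_funM => //.
  by apply: measurableT_comp => //; exact: measurable_funB.
have k0 z : (0 <= k z)%E by rewrite lee_fin mulr_ge0.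
have intk : (\int[mu]_x k x <= (e / 3)%:E)%E.
  rewrite (le_trans _ hn)// [leRHS]integral_mkcond.
  rewrite le_eqVlt; apply/orP; left; apply/eqP.
  apply: eq_integral => z _; rewrite patchE /k indicE.
  by case: ifPn => _; rewrite ?mulr1 ?mulr0.
(* [E] has length [M + M], so the oscillation of [g] contributes [e / 3]; the errors [|b - g|] at
   [x] and at [x + s] are the other two thirds. *)
have eta0 : 0 < e / 3 / (M + M) by rewrite divr_gt0// addr_gt0.
near=> s.
have s1 : `|s| < 1 by near: s; exact: (nbhs0_lt (V := R) ltr01).
have hs : forall x, - M <= x <= M -> `|g (x + s) - g x| < e / 3 / (M + M).
  by near: s; exact: near_shift_close (cg n) eta0.
apply: (@le_trans _ _ (\int[mu]_x (k (x + s)%R + k x + (e / 3 / (M + M) * \1_E x)%:E))%E).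
  apply: ge0_le_integral => //.
  - apply/measurable_EFinP; apply: measurableT_comp => //.
    apply: measurable_funB => //.
    by apply: (measurableT_comp mb); exact: measurable_funD.
  - apply: emeasurable_funD; last by apply/measurable_EFinP; exact: measurable_funM.
    apply: emeasurable_funD => //.
    by apply: (measurableT_comp mk); exact: measurable_funD.
  - move=> x _.
    rewrite /k -!EFinD lee_fin !indicE.
    have [xM|xM] := leP `|x| (N + 1).
      have xE : x \in E.
        by rewrite inE /E /= in_itv /= -ler_norml (le_trans xM)// lerD2l; lra.
      have xsE : x + s \in E.
        rewrite inE /E /= in_itv /= -ler_norml (le_trans (ler_normD _ _))//.
        by rewrite (le_trans (lerD xM (ltW s1)))// /M; lra.
      rewrite xE xsE !mulr1.
      rewrite (_ : b (x + s) - b x = (b (x + s) - g (x + s)) - (b x - g x) + (g (x + s) - g x)); last by ring.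
      rewrite (le_trans (ler_normD _ _))// lerD ?ler_normB//.
      apply/ltW/hs; rewrite -ler_norml.
      by move: xE; rewrite inE /E /= in_itv /= -ler_norml.
    have -> : b x = 0 by rewrite bout// (le_lt_trans _ xM)// lerDl.
    have -> : b (x + s) = 0.
      rewrite bout//.
      have : `|x| <= `|x + s| + `|s| by rewrite (le_trans _ (ler_normB _ _))// addrK.
      lra.
    rewrite subrr normr0; apply: addr_ge0; first by apply: addr_ge0; apply: mulr_ge0.
    by apply: mulr_ge0 => //; exact: ltW.
rewrite ge0_integralD//=; last 4 first.
- by move=> x _; rewrite adde_ge0.
- apply: emeasurable_funD => //.
  by apply: (measurableT_comp mk); exact: measurable_funD.
- by move=> x _; rewrite lee_fin mulr_ge0// ltW.
- by apply/measurable_EFinP; exact: measurable_funM.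
rewrite ge0_integralD//=; last by apply: (measurableT_comp mk); exact: measurable_funD.
rewrite ge0_integral_shift//.
have -> : (\int[mu]_x (e / 3 / (M + M) * \1_E x)%:E = (e / 3)%:E)%E.
  under eq_integral do rewrite EFinM.
  rewrite ge0_integralZl//; [|by apply/measurable_EFinP|by rewrite lee_fin ltW].
  rewrite integral_indic// setIT [X in (_ * X)%E]muE -EFinM divfK// gt_eqF// addr_gt0//.
apply: (le_trans (leeD (leeD intk intk) (lexx _))).
rewrite -!EFinD lee_fin; lra.
Unshelve. all: by end_near. Qed.
End shift_L2.

Section L2_translation.
Context {R : realType}.
Notation mu := (@lebesgue_measure R).

(** Dominated convergence with majorant [a ^+ 2]: at each point the difference is eventually
    zero. *)
Lemma truncation_L2 (a : R -> R) (D : nat -> set R) : measurable_fun setT a ->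
  (\int[mu]_x (a x ^+ 2)%:E < +oo)%E -> (forall n, measurable (D n)) ->
  (forall x, \forall n \near \oo, D n x) ->
  (\int[mu]_x ((a x - a x * \1_(D n) x) ^+ 2)%:E)%E @[n --> \oo] --> 0%E.
Proof.
move=> ma ia mD Dx.
have m1 n : measurable_fun setT (fun x : R => ((a x - a x * \1_(D n) x) ^+ 2)%:E).
  apply/measurable_EFinP; apply: measurable_funX; apply: measurable_funB => //.
  exact: measurable_funM.
have ig : mu.-integrable setT (fun x => (a x ^+ 2)%:E).
  apply/integrableP; split; first by apply/measurable_EFinP; exact: measurable_funX.
  under eq_integral do rewrite gee0_abs ?lee_fin ?sqr_ge0//.
  exact: ia.
have [|||_ _] := @dominated_convergence _ _ _ mu setT measurableT
  (fun n x => ((a x - a x * \1_(D n) x) ^+ 2)%:E) (cst 0%E) (fun x => (a x ^+ 2)%:E) m1 _ _ ig.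
- exact: measurable_cst.
- apply: aeW => x _; apply: cvg_near_cst.
  apply: filterS (Dx x) => n Dnx; rewrite indicE mem_set//=.
  by rewrite mulr1 subrr expr0n.
- apply: aeW => x n _; rewrite gee0_abs ?lee_fin ?sqr_ge0// indicE.
  by case: (x \in D n); rewrite ?mulr1 ?subrr ?mulr0 ?subr0// expr0n/= sqr_ge0.
by rewrite integral0.
Qed.

Lemma shift_L2 (a : R -> R) (e : R) : measurable_fun setT a ->
  (\int[mu]_x (a x ^+ 2)%:E < +oo)%E -> 0 < e ->
  \forall s \near (0 : R), (\int[mu]_x ((a (x + s)%R - a x) ^+ 2)%:E <= e%:E)%E.
Proof.
move=> ma ia e0.
(* Cutting both the domain and the values at height [n] makes the truncation [b] fit
   [shift_L1_bounded] with [N = n]. *)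
pose D n := [set x : R | `|x| <= n%:R] `&` [set x | `|a x| <= n%:R].
have mD n : measurable (D n).
  have h (f : R -> R) : measurable_fun setT f ->
      measurable [set x | `|f x| <= n%:R].
    move=> mf; rewrite -[X in measurable X]setTI.
    have -> : [set x | `|f x| <= n%:R] = (fun x => `|f x|) @^-1` `]-oo, n%:R].
      by apply/seteqP; split => x /=; rewrite in_itv/=.
    have hm : measurable_fun setT (fun x : R => `|f x|) by exact: measurableT_comp.
    exact: hm measurableT _ (measurable_itv _).
  by apply: measurableI; apply: h.
have Dx x : \forall n \near \oo, D n x.
  near=> n; split => /=; near: n.
  - exact: nbhs_infty_ger.
  - exact: nbhs_infty_ger.
have hge n : (0 <= \int[mu]_x ((a x - a x * \1_(D n) x) ^+ 2)%:E)%E.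
  by apply: integral_ge0 => x _; rewrite lee_fin sqr_ge0.
have e9 : 0 < e / 9 by rewrite divr_gt0.
have /(ge0_ecvg0P hge)/(_ _ e9)[n _ /(_ n (leqnn _))] := truncation_L2 ma ia mD Dx.
set b := fun x => a x * \1_(D n) x => hn.
pose c x := a x - b x.
have mb : measurable_fun setT b by exact: measurable_funM.
have mc : measurable_fun setT c by exact: measurable_funB.
have bN x : `|b x| <= n%:R.
  rewrite /b indicE; case: (boolP (x \in D n)) => [|_]; last by rewrite mulr0 normr0.
  by rewrite inE mulr1 => -[].
have bout x : n%:R < `|x| -> b x = 0.
  move=> nx; rewrite /b indicE memNset ?mulr0// => -[/=].
  by rewrite leNgt nx.
(* The increment of [b] is at most [2 (n + 1)], so its square is at most that times its modulus; the
   factor 3 from squaring a sum of three terms gives [6 (n + 1)]. The total is then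
   [3 e / 9 + 3 e / 9 + e / 3 = e]. *)
have e2 : 0 < e / (3 * (6 * (n%:R + 1))) by rewrite divr_gt0// !mulr_gt0// ltr_wpDl.
have := shift_L1_bounded mb (ler0n _ n) bN bout e2.
apply: filterS => s hs.
have mshift (f : R -> R) : measurable_fun setT f -> measurable_fun setT (fun x : R => f (x + s)).
  by move=> mf; apply: (measurableT_comp mf); exact: measurable_funD.
apply: (@le_trans _ _ (\int[mu]_x (3%:E * (c (x + s)%R ^+ 2)%:E
    + (3%:E * (c x ^+ 2)%:E + (6 * (n%:R + 1))%:E * `|b (x + s)%R - b x|%:E)))%E).
  apply: ge0_le_integral => //.
  - by move=> x _; rewrite lee_fin sqr_ge0.
  - apply/measurable_EFinP; apply: measurable_funX; apply: measurable_funB => //.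
    exact: mshift.
  - apply: emeasurable_funD.
      apply: measurable_funeM; apply/measurable_EFinP; apply: measurable_funX.
      exact: mshift.
    apply: emeasurable_funD; apply: measurable_funeM; apply/measurable_EFinP.
      exact: measurable_funX.
    apply: measurableT_comp => //; apply: measurable_funB => //; exact: mshift.
  - move=> x _; rewrite -!EFinM -!EFinD lee_fin.
    have -> : a (x + s) - a x = c (x + s) - c x + (b (x + s) - b x) by rewrite /c; ring.
    have h1 : (b (x + s) - b x) ^+ 2 <= 2 * (n%:R + 1) * `|b (x + s) - b x|.
      rewrite -real_normK ?num_real// expr2 ler_wpM2r//.
      rewrite (le_trans (ler_normB _ _))// (le_trans (lerD (bN _) (bN _)))//; lra.
    move: (c (x + s)) (c x) (b (x + s) - b x) h1 => p q r h1.
    have : (p - q + r) ^+ 2 <= 3 * p ^+ 2 + 3 * q ^+ 2 + 3 * r ^+ 2.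
      rewrite -subr_ge0 [leRHS](_ : _ = (p + q) ^+ 2 + (p - r) ^+ 2 + (q + r) ^+ 2).
        by rewrite !addr_ge0// sqr_ge0.
      by ring.
    by lra.
have mI1 : measurable_fun setT (fun x : R => (c (x + s)%R ^+ 2)%:E).
  by apply/measurable_EFinP; apply: measurable_funX; exact: mshift.
have mI2 : measurable_fun setT (fun x : R => (c x ^+ 2)%:E).
  by apply/measurable_EFinP; apply: measurable_funX.
have mI3 : measurable_fun setT (fun x : R => `|b (x + s) - b x|%:E).
  apply/measurable_EFinP.
  by apply: measurableT_comp => //; apply: measurable_funB => //; exact: mshift.
have n6 : 0 <= 6 * (n%:R + 1) :> R by rewrite mulr_ge0// addr_ge0.
have c20 x : (0 <= (c x ^+ 2)%:E)%E by rewrite lee_fin sqr_ge0.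
have pos k (f : R -> \bar R) : 0 <= k -> (forall x, 0 <= f x)%E -> forall x, (0 <= k%:E * f x)%E.
  by move=> k0 f0 x; rewrite mule_ge0.
have pos3 := pos 3 _ _ c20; have pos3s := pos 3 _ _ (fun x => c20 (x + s)).
have pos6 := pos (6 * (n%:R + 1)) (fun x => `|b (x + s) - b x|%:E) n6 (fun x => normr_ge0 _).
rewrite ge0_integralD//=.
all: try by move=> x _; rewrite ?adde_ge0// ?pos3 ?pos3s ?pos6.
all: try exact: measurable_funeM.
all: try by apply: emeasurable_funD; exact: measurable_funeM.
rewrite ge0_integralD//=.
all: try by move=> x _; rewrite ?adde_ge0// ?pos3 ?pos3s ?pos6.
all: try exact: measurable_funeM.
rewrite !ge0_integralZl//.
rewrite (@ge0_integral_shift _ s (fun x => (c x ^+ 2)%:E))//.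
apply: (le_trans (leeD (lee_wpmul2l _ hn) (leeD (lee_wpmul2l _ hn) (lee_wpmul2l _ hs)))) => //.
rewrite -!EFinM -!EFinD lee_fin.
have : (6 * (n%:R + 1)) * (e / (3 * (6 * (n%:R + 1)))) = e / 3.
  field; rewrite gt_eqF// ltr_wpDl//.
move=> ->; lra.
Unshelve. all: by end_near. Qed.
End L2_translation.

(** * Real integrals: nonnegative, dominated and square integrable functions *)

Section integral_helpers.
Context d (T : measurableType d) (R : realType) (m : {measure set T -> \bar R}).
Implicit Types f g : T -> R.

Lemma ge0_le_integralE f g : measurable_fun setT f -> measurable_fun setT g ->
  (forall x, 0 <= f x <= g x) ->
  (\int[m]_x (f x)%:E <= \int[m]_x (g x)%:E)%E.
Proof.
move=> mf mg fg; apply: ge0_le_integral => //.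
- by move=> x _; rewrite lee_fin; case/andP: (fg x).
- exact/measurable_EFinP.
- exact/measurable_EFinP.
- by move=> x _; rewrite lee_fin; case/andP: (fg x).
Qed.

Lemma ge0_integralDE f g : measurable_fun setT f -> measurable_fun setT g ->
  (forall x, 0 <= f x) -> (forall x, 0 <= g x) ->
  (\int[m]_x (f x + g x)%:E = \int[m]_x (f x)%:E + \int[m]_x (g x)%:E)%E.
Proof.
move=> mf mg f0 g0; under eq_integral do rewrite EFinD.
rewrite ge0_integralD//.
- by move=> x _; rewrite lee_fin.
- exact/measurable_EFinP.
- by move=> x _; rewrite lee_fin.
- exact/measurable_EFinP.
Qed.

Lemma ge0_integralZE (k : R) f : measurable_fun setT f ->
  (forall x, 0 <= f x) -> 0 <= k ->
  (\int[m]_x (k * f x)%:E = k%:E * \int[m]_x (f x)%:E)%E.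
Proof.
move=> mf f0 k0; under eq_integral do rewrite EFinM.
rewrite ge0_integralZl//.
- exact/measurable_EFinP.
- by move=> x _; rewrite lee_fin.
Qed.

Lemma integral_ge0E f : (forall x, 0 <= f x) -> (0 <= \int[m]_x (f x)%:E)%E.
Proof. by move=> f0; apply: integral_ge0 => x _; rewrite lee_fin. Qed.

Lemma integrable_ge0P f : (forall x, 0 <= f x) -> measurable_fun setT f ->
  m.-integrable setT (EFin \o f) <-> (\int[m]_x (f x)%:E < +oo)%E.
Proof.
move=> f0 mf; have E : (\int[m]_x `|(EFin \o f) x| = \int[m]_x (f x)%:E)%E.
  by apply: eq_integral => x _; rewrite gee0_abs// lee_fin.
split=> [/integrableP[_]|foo]; first by rewrite E.
by apply/integrableP; split; [exact/measurable_EFinP|rewrite E].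
Qed.

Lemma integrable_le f g : measurable_fun setT f -> m.-integrable setT (EFin \o g) ->
  (forall x, `|f x| <= g x) -> m.-integrable setT (EFin \o f).
Proof.
move=> mf ig fg; apply: le_integrable ig => //; first exact/measurable_EFinP.
by move=> x _ /=; rewrite lee_fin (le_trans (fg x))// ler_norm.
Qed.

Lemma EFin_Rintegral f : m.-integrable setT (EFin \o f) ->
  (\int[m]_x f x)%:E = (\int[m]_x (f x)%:E)%E.
Proof. by move=> fi; rewrite /Rintegral fineK//; exact: integrable_fin_num. Qed.

Lemma integrableDE f g : m.-integrable setT (EFin \o f) ->
  m.-integrable setT (EFin \o g) -> m.-integrable setT (EFin \o (fun x => f x + g x)).
Proof.
move=> fi gi; rewrite (_ : _ \o _ = (EFin \o f) \+ (EFin \o g))%E; last exact/funext.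
exact: integrableD.
Qed.

Lemma integrableBE f g : m.-integrable setT (EFin \o f) ->
  m.-integrable setT (EFin \o g) -> m.-integrable setT (EFin \o (fun x => f x - g x)).
Proof.
move=> fi gi; rewrite (_ : _ \o _ = (EFin \o f) \- (EFin \o g))%E; last exact/funext.
exact: integrableB.
Qed.

Lemma integrableZE k f : m.-integrable setT (EFin \o f) ->
  m.-integrable setT (EFin \o (fun x => k * f x)).
Proof.
move=> fi; rewrite (_ : _ \o _ = (fun x => k%:E * (EFin \o f) x)%E); last exact/funext.
exact: integrableZl.
Qed.

Lemma integrable_measurable f : m.-integrable setT (EFin \o f) -> measurable_fun setT f.
Proof. by move/measurable_int/measurable_EFinP. Qed.

Lemma sqr_integrable_mul f g : measurable_fun setT f -> measurable_fun setT g ->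
  (\int[m]_x (f x ^+ 2)%:E < +oo)%E -> (\int[m]_x (g x ^+ 2)%:E < +oo)%E ->
  m.-integrable setT (EFin \o (fun x => f x * g x)).
Proof.
move=> mf mg fi gi.
have fi2 : m.-integrable setT (EFin \o (fun x => f x ^+ 2)).
  by apply/integrable_ge0P => //; [move=> ?; rewrite sqr_ge0|exact: measurable_funX].
have gi2 : m.-integrable setT (EFin \o (fun x => g x ^+ 2)).
  by apply/integrable_ge0P => //; [move=> ?; rewrite sqr_ge0|exact: measurable_funX].
apply: (@integrable_le _ (fun x => f x ^+ 2 + g x ^+ 2)).
- exact: measurable_funM.
- exact: integrableDE.
- move=> x; rewrite normrM -(real_normK (num_real (f x))) -(real_normK (num_real (g x))).
  move: (`|f x|) (`|g x|) (normr_ge0 (f x)) (normr_ge0 (g x)) => p q p0 q0; nra.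
Qed.

(* AM-GM in place of the Cauchy-Schwarz inequality. *)
Lemma sqr_integrable_cvg0 f (g : nat -> T -> R) : measurable_fun setT f ->
  (forall n, measurable_fun setT (g n)) -> (\int[m]_x (f x ^+ 2)%:E < +oo)%E ->
  (\int[m]_x (g n x ^+ 2)%:E)%E @[n --> \oo] --> 0%E ->
  (\int[m]_x (f x * g n x)) @[n --> \oo] --> (0 : R).
Proof.
move=> mf mg fi gcv.
have ge0 n : (0 <= \int[m]_x (g n x ^+ 2)%:E)%E by apply: integral_ge0E => x; exact: sqr_ge0.
have m2 (h : T -> R) : measurable_fun setT h -> measurable_fun setT (fun x => h x ^+ 2 : R).
  by move=> mh; exact: measurable_funX.
have fi2 : m.-integrable setT (EFin \o (fun x => f x ^+ 2)).
  by apply/integrable_ge0P => //; [move=> ?; rewrite sqr_ge0|exact: m2].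
pose A := (\int[m]_x (f x ^+ 2)).
have A0 : 0 <= A by apply: Rintegral_ge0 => x _; exact: sqr_ge0.
apply/cvgr0Pnorm_le => e e0.
(* The weight in [|f g| <= (k / 2) f^2 + (2 k)^-1 g^2]: the first term integrates to at most
   [e / 2], and the second does once the integral of [g^2] is below [e k]. The [+ 1] covers
   [A = 0]. *)
pose k := e / (A + 1).
have k0 : 0 < k by rewrite divr_gt0// ltr_wpDl.
have ek0 : 0 < e * k by rewrite mulr_gt0.
have /(ge0_ecvg0P ge0)/(_ _ ek0) := gcv.
apply: filterS => n gn.
have gn_lt : (\int[m]_x (g n x ^+ 2)%:E < +oo)%E by rewrite (le_lt_trans gn)// ltry.
have gi2 : m.-integrable setT (EFin \o (fun x => g n x ^+ 2)).
  by apply/integrable_ge0P => //; [move=> ?; rewrite sqr_ge0|exact: m2].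
have fgi := sqr_integrable_mul mf (mg n) fi gn_lt.
rewrite (le_trans (le_normr_Rintegral _ _))//.
rewrite (@le_trans _ _ (\int[m]_x (k / 2 * f x ^+ 2 + (2 * k)^-1 * g n x ^+ 2)))//.
  apply: le_Rintegral => //.
  - exact: integrable_norm.
  - by apply: integrableDE; exact: integrableZE.
  - move=> x _; rewrite normrM -(real_normK (num_real (f x))) -(real_normK (num_real (g n x))).
    move: (`|f x|) (`|g n x|) => p q.
    rewrite -subr_ge0 [leRHS](_ : _ = (2 * k)^-1 * (k * p - q) ^+ 2); last first.
      by field; rewrite gt_eqF.
    by rewrite mulr_ge0 ?sqr_ge0// invr_ge0 mulr_ge0// ltW.
rewrite RintegralD//; [|exact: integrableZE|exact: integrableZE].
rewrite !RintegralZl//.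
have : \int[m]_x (g n x ^+ 2) <= e * k by rewrite -lee_fin EFin_Rintegral.
rewrite -/A; move: (\int[m]_x (g n x ^+ 2)) => B Bk.
have h1 : k / 2 * A <= e / 2.
  rewrite mulrAC ler_pM2r// /k mulrAC ler_pdivrMr; last by rewrite ltr_wpDl.
  by rewrite ler_wpM2l// ?ltW// ltrDl.
have h2 : (2 * k)^-1 * B <= e / 2.
  rewrite (_ : e / 2 = (2 * k)^-1 * (e * k)); last by field; rewrite gt_eqF.
  by rewrite ler_wpM2l// invr_ge0 mulr_ge0// ltW.
lra.
Qed.

End integral_helpers.

(** * Measurability and integrability on products *)

Section fubini_helpers.
Context d1 d2 (T1 : measurableType d1) (T2 : measurableType d2) (R : realType).
Variables (m1 : {sigma_finite_measure set T1 -> \bar R}).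
Variables (m2 : {sigma_finite_measure set T2 -> \bar R}).

(** Stated without integrability: Tonelli makes the integrals of the positive and negative parts
    measurable, and so is the real part of their difference, default values included. *)
Lemma measurable_fun_integral2 (f : T1 * T2 -> R) : measurable_fun setT f ->
  measurable_fun setT (fun x => \int[m2]_y f (x, y)).
Proof.
move=> mf; rewrite /Rintegral.
apply: (measurableT_comp (@fine_measurable R setT measurableT)).
have mF : measurable_fun setT (EFin \o f) by exact/measurable_EFinP.
under eq_fun do rewrite integralE.
apply: emeasurable_funB.
- rewrite [X in measurable_fun _ X](_ : _ = fubini_F m2 ((EFin \o f)^\+)%E).
    by apply: measurable_fun_fubini_tonelli_F => //; exact: measurable_funepos.
  by apply/funext => x; apply: eq_integral => y _; rewrite !funeposE.
- rewrite [X in measurable_fun _ X](_ : _ = fubini_F m2 ((EFin \o f)^\-)%E).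
    by apply: measurable_fun_fubini_tonelli_F => //; exact: measurable_funeneg.
  by apply/funext => x; apply: eq_integral => y _; rewrite !funenegE.
Qed.

Lemma integrable_prod (p : T1 -> R) (q : T2 -> R) : m1.-integrable setT (EFin \o p) ->
  m2.-integrable setT (EFin \o q) ->
  (m1 \x m2)%E.-integrable setT (EFin \o (fun z : T1 * T2 => p z.1 * q z.2)).
Proof.
move=> ip iq.
have mp := integrable_measurable ip; have mq := integrable_measurable iq.
have mpq : measurable_fun setT (fun z : T1 * T2 => p z.1 * q z.2).
  by apply: measurable_funM; [exact: (measurableT_comp mp)|exact: (measurableT_comp mq)].
apply/integrable12ltyP; first exact/measurable_EFinP.
under eq_integral => x _.
  under eq_integral => y _ do rewrite /= normrM.
  rewrite (@ge0_integralZE _ _ _ m2 `|p x| (fun y => `|q y|))//; last first.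
    exact: measurableT_comp.
  over.
have /integrableP[_ qoo] := iq; have /integrableP[_ poo] := ip.
rewrite ge0_integralZr//.
- by rewrite lte_mul_pinfty//; [exact: integral_ge0|rewrite ge0_fin_numE//; exact: integral_ge0].
- by apply/measurable_EFinP; exact: measurableT_comp.
- exact: integral_ge0.
Qed.

End fubini_helpers.

(** * The Poisson kernel *)

Section poisson.
Context {R : realType}.
Notation mu := (@lebesgue_measure R).

Lemma ge0_integral0y_FTC (f F : R -> R) (l : R) : (forall x, 0 <= f x) ->
  continuous f -> (forall x : R, is_derive x 1 F (f x)) -> F x @[x --> +oo%R] --> l ->
  (\int[mu]_(x in `[0%R, +oo[) (f x)%:E = l%:E - (F 0)%:E)%E.
Proof.
move=> f0 cf dF Fl.
have cF : continuous F.
  by move=> x; apply/differentiable_continuous/derivable1_diffP; exact: ex_derive.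
apply: ge0_continuous_FTC2y => //.
- exact: continuous_subspaceT.
- by apply: cvg_at_right_filter; exact: cF.
- by move=> x _; rewrite derive1E; have [] := dF x.
Qed.

Definition poisson (e s : R) : R := e / (pi * (e ^+ 2 + s ^+ 2)).

Lemma poisson_den_gt0 (e s : R) : 0 < e -> 0 < pi * (e ^+ 2 + s ^+ 2).
Proof. by move=> e0; rewrite mulr_gt0 ?pi_gt0// ltr_pwDl ?sqr_ge0// exprn_gt0. Qed.

Lemma poisson_ge0 (e s : R) : 0 < e -> 0 <= poisson e s.
Proof. by move=> e0; rewrite divr_ge0 ?ltW// poisson_den_gt0. Qed.

Lemma poissonN (e s : R) : poisson e (- s) = poisson e s.
Proof. by rewrite /poisson sqrrN. Qed.

Lemma poisson_le (e s : R) : 0 < e -> poisson e s <= (pi * e)^-1.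
Proof.
move=> e0; rewrite (_ : (pi * e)^-1 = e / (pi * e ^+ 2)); last first.
  by move: pi (pi_gt0 R) => p p0; field; rewrite !gt_eqF.
rewrite ler_pM2l// lef_pV2 ?posrE ?poisson_den_gt0//; last first.
  by rewrite mulr_gt0 ?pi_gt0// exprn_gt0.
by rewrite ler_pM2l ?pi_gt0// lerDl sqr_ge0.
Qed.

Lemma continuous_poisson (e : R) : 0 < e -> continuous (poisson e).
Proof.
move=> e0 s; rewrite /poisson; apply: cvgM; first exact: cvg_cst.
apply: cvgV; first by rewrite gt_eqF// poisson_den_gt0.
apply: cvgM; first exact: cvg_cst.
apply: cvgD; first exact: cvg_cst.
exact: exprn_continuous.
Qed.

Lemma measurable_poisson (e : R) : 0 < e -> measurable_fun setT (poisson e).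
Proof. by move=> e0; apply: continuous_measurable_fun; exact: continuous_poisson. Qed.

Lemma integral_poisson (e : R) : 0 < e -> (\int[mu]_s (poisson e s)%:E = 1%:E)%E.
Proof.
move=> e0.
rewrite ge0_symfun_integralT; last 3 first.
- by move=> x; exact: poisson_ge0.
- exact: continuous_poisson.
- by move=> x /=; rewrite poissonN.
have dF (x : R) : is_derive x 1 (fun s => pi^-1 * atan (e^-1 * s)) (poisson e x).
  have h1 : is_derive x 1 (fun s : R => e^-1 * s) e^-1.
    by apply: is_derive_eq; rewrite /GRing.scale/= mulr1.
  have h2 := is_derive1_comp (is_derive1_atan (e^-1 * x)) h1.
  have h3 := is_deriveZ pi^-1 h2.
  apply: is_derive_eq h3 _; rewrite /GRing.scale /= /poisson.
  have e2 := poisson_den_gt0 x e0.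
  have e1 : 0 < 1 + (e^-1 * x) ^+ 2 by rewrite ltr_pwDl ?sqr_ge0.
  move: pi (pi_gt0 R) e2 => p p0 e2; field.
  rewrite !gt_eqF//=; last by rewrite ltr_pwDl ?sqr_ge0// exprn_gt0.
have Fl : pi^-1 * atan (e^-1 * s) @[s --> +oo%R] --> pi^-1 * (pi / 2).
  apply: cvgM; first exact: cvg_cst.
  apply: (cvg_comp _ _ _ (@cvgy_atan R)).
  by apply: gt0_cvgMry; [rewrite invr_gt0|exact: cvg_id].
rewrite -set_itvcy (ge0_integral0y_FTC (fun x => poisson_ge0 x e0) (continuous_poisson e0) dF Fl).
rewrite mulr0 atan0 mulr0 sube0 -EFinM; congr (_%:E).
by move: pi (pi_gt0 R) => p p0; field; rewrite gt_eqF.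
Qed.

(** For [|s| >= de] one has [1 + s^2 <= (1 + de^-2) s^2]. Comparing with the fixed density
    [poisson 1] shows that the tail has mass O(e) with no further integration. *)
Lemma poisson_tail (e de s : R) : 0 < e -> 0 < de -> de <= `|s| ->
  poisson e s <= e * (1 + de^-2) * poisson 1 s.
Proof.
move=> e0 d0 ds.
have s2 : de ^+ 2 <= s ^+ 2.
  by rewrite -(real_normK (num_real s)) lerXn2r// nnegrE ltW.
have d2 : 0 < de ^+ 2 by rewrite exprn_gt0.
have s20 : 0 < s ^+ 2 by exact: lt_le_trans s2.
rewrite /poisson -mulrA ler_pM2l// expr1n mul1r.
rewrite -[leLHS]mul1r ler_pdivlMr ?mulr_gt0 ?pi_gt0 ?addr_gt0//.
rewrite mul1r mulrC ler_pdivrMr ?poisson_den_gt0//.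
rewrite mulrCA ler_pM2l ?pi_gt0//.
have : 1 <= de^-2 * s ^+ 2 by rewrite mulrC ler_pdivlMr// mul1r.
have : 0 <= de^-2 * e ^+ 2 by rewrite mulr_ge0 ?sqr_ge0// invr_ge0 ltW.
have := sqr_ge0 e.
move: (de^-2) => k; rewrite mulrDl mul1r mulrDr; lra.
Qed.

End poisson.

(** * Averages against the Poisson kernel *)

Section poisson_conv.
Context {R : realType}.
Notation mu := (@lebesgue_measure R).

Definition poisson_conv (e : R) (a : R -> R) (x : R) : R :=
  \int[mu]_l (poisson e (l - x) * a l).

Lemma measurable_poisson_sub (e x : R) : 0 < e ->
  measurable_fun setT (fun l : R => poisson e (l - x)).
Proof.
by move=> e0; apply: (measurableT_comp (measurable_poisson e0)); exact: measurable_funB.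
Qed.

Lemma integral_poisson_sub (e x : R) : 0 < e ->
  (\int[mu]_l (poisson e (l - x)%R)%:E = 1%:E)%E.
Proof.
move=> e0; rewrite (@ge0_integral_shift _ (- x) (fun s => (poisson e s)%:E)) ?integral_poisson//.
- by apply/measurable_EFinP; exact: measurable_poisson.
- by move=> s; rewrite lee_fin poisson_ge0.
Qed.

Lemma integrable_poisson_sub (e x : R) : 0 < e ->
  mu.-integrable setT (EFin \o (fun l : R => poisson e (l - x))).
Proof.
move=> e0; apply/integrable_ge0P.
- by move=> l; exact: poisson_ge0.
- exact: measurable_poisson_sub.
- by rewrite integral_poisson_sub// ltry.
Qed.

(* The Poisson kernel is a probability density, so this is Jensen's inequality for the square. *)
Lemma poisson_conv_sqr (e : R) (a : R -> R) (x : R) : 0 < e -> measurable_fun setT a ->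
  (\int[mu]_x (a x ^+ 2)%:E < +oo)%E ->
  (((poisson_conv e a x - a x) ^+ 2)%:E <=
    \int[mu]_l (poisson e (l - x)%R * (a l - a x) ^+ 2)%:E)%E.
Proof.
move=> e0 ma ia.
have mP := measurable_poisson_sub x e0.
have iP := integrable_poisson_sub x e0.
have P0 l : 0 <= poisson e (l - x) by exact: poisson_ge0.
have ia2 : mu.-integrable setT (EFin \o (fun x => a x ^+ 2)).
  by apply/integrable_ge0P => //; [move=> ?; rewrite sqr_ge0|exact: measurable_funX].
have iPa2 : mu.-integrable setT (EFin \o (fun l => poisson e (l - x) * a l ^+ 2)).
  apply: (@integrable_le _ _ _ mu _ (fun l : R => (pi * e)^-1 * a l ^+ 2)).
  - by apply: measurable_funM => //; exact: measurable_funX.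
  - exact: integrableZE.
  - move=> l; rewrite ger0_norm; last by rewrite mulr_ge0// sqr_ge0.
    by rewrite ler_wpM2r ?sqr_ge0// poisson_le.
have iPa : mu.-integrable setT (EFin \o (fun l => poisson e (l - x) * a l)).
  apply: (@integrable_le _ _ _ mu _ (fun l : R => poisson e (l - x) + poisson e (l - x) * a l ^+ 2)).
  - exact: measurable_funM.
  - exact: integrableDE.
  - move=> l; rewrite normrM (ger0_norm (P0 l)) -(real_normK (num_real (a l))).
    rewrite -{2}[poisson e _]mulr1 -mulrDr ler_wpM2l//.
    by move: (`|a l|) => p; have := sqr_ge0 (p - 1); nra.
set m := poisson_conv e a x.
have -> : (\int[mu]_l (poisson e (l - x)%R * (a l - a x) ^+ 2)%:E =
    (\int[mu]_l (poisson e (l - x) * (a l - a x) ^+ 2))%:E)%E.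
  rewrite EFin_Rintegral//.
  rewrite (_ : (fun _ => _) = fun l : R => (poisson e (l - x) * a l ^+ 2 - 2 * a x * (poisson e (l - x) * a l)
    + a x ^+ 2 * poisson e (l - x))); last by apply/funext => l; ring.
  by apply: integrableDE; [apply: integrableBE => //|]; exact: integrableZE.
rewrite lee_fin.
have I1 : \int[mu]_l poisson e (l - x) = 1 by rewrite /Rintegral integral_poisson_sub.
(* The second moment about [c]. It is nonnegative at [c = m], which bounds [m ^+ 2] by the integral
   of [poisson * a ^+ 2]; the case [c = a x] turns this into the claim. *)
have E1 (c : R) : \int[mu]_l (poisson e (l - x) * (a l - c) ^+ 2) =
    \int[mu]_l (poisson e (l - x) * a l ^+ 2) - 2 * c * m + c ^+ 2.
  rewrite -[c ^+ 2]mulr1 -{2}I1 /m /poisson_conv -RintegralZl// -RintegralZl//.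
  rewrite -RintegralB//; last exact: integrableZE.
  rewrite -RintegralD//; [|by apply: integrableBE => //; exact: integrableZE|exact: integrableZE].
  by congr fine; apply: eq_integral => l _; congr (_%:E); ring.
have : 0 <= \int[mu]_l (poisson e (l - x) * (a l - m) ^+ 2).
  by apply: Rintegral_ge0 => l _; rewrite mulr_ge0// sqr_ge0.
rewrite !E1; nra.
Qed.

(** With [w s] the squared L^2 distance between [a] and its translate by [s], [poisson_conv_sqr] and
    Tonelli bound the error by the average of [w] against the kernel. Near 0 [w] is small by
    [shift_L2]; elsewhere it is at most four times the squared norm of [a], against a tail of mass
    O(e). *)
Lemma poisson_conv_cvg (a : R -> R) : measurable_fun setT a ->
  (\int[mu]_x (a x ^+ 2)%:E < +oo)%E ->
  (\int[mu]_x ((poisson_conv n.+1%:R^-1 a x - a x) ^+ 2)%:E)%E @[n --> \oo] --> 0%E.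
Proof.
move=> ma ia.
have [N N0 aN] : exists2 N : R, 0 <= N & (\int[mu]_x (a x ^+ 2)%:E)%E = N%:E.
  have i0 : (0 <= \int[mu]_x (a x ^+ 2)%:E)%E by apply: integral_ge0E => x; exact: sqr_ge0.
  exists (fine (\int[mu]_x (a x ^+ 2)%:E)%E); first exact: fine_ge0.
  by rewrite fineK// ge0_fin_numE.
have mas (s : R) : measurable_fun setT (fun x : R => a (x + s)).
  by apply: (measurableT_comp ma); exact: measurable_funD.
have mas2 (s : R) : measurable_fun setT (fun x : R => (a (x + s) - a x) ^+ 2).
  by apply: measurable_funX; exact: measurable_funB.
pose w s := (\int[mu]_x ((a (x + s)%R - a x) ^+ 2)%:E)%E.
have w0 s : (0 <= w s)%E by apply: integral_ge0E => x; exact: sqr_ge0.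
have wN s : (w s <= (4 * N)%:E)%E.
  apply: (@le_trans _ _ (\int[mu]_x (2 * a (x + s)%R ^+ 2 + 2 * a x ^+ 2)%:E)%E).
    apply: ge0_le_integralE => //.
    - exact: mas2.
    - apply: measurable_funD; apply: measurable_funM => //; apply: measurable_funX.
        exact: mas.
      exact: ma.
    - move=> x; rewrite sqr_ge0/=; move: (a (x + s)) (a x) => p q.
      by have := sqr_ge0 (p + q); nra.
  rewrite (ge0_integralDE mu (f := fun x => 2 * a (x + s) ^+ 2) (g := fun x => 2 * a x ^+ 2)).
  - rewrite (@ge0_integralZE _ _ _ mu 2 (fun x => a (x + s) ^+ 2)); last 3 first.
    + by apply: measurable_funX; exact: mas.
    + by move=> x; exact: sqr_ge0.
    + by [].
    rewrite (@ge0_integralZE _ _ _ mu 2 (fun x => a x ^+ 2)); last 3 first.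
    + exact: measurable_funX.
    + by move=> x; exact: sqr_ge0.
    + by [].
    rewrite (@ge0_integral_shift _ s (fun x => (a x ^+ 2)%:E)).
    + by rewrite aN -!EFinM -EFinD lee_fin; lra.
    + by apply/measurable_EFinP; exact: measurable_funX.
    + by move=> x; rewrite lee_fin sqr_ge0.
  - by apply: measurable_funM => //; apply: measurable_funX; exact: mas.
  - by apply: measurable_funM => //; apply: measurable_funX; exact: ma.
  - by move=> x; rewrite mulr_ge0// sqr_ge0.
  - by move=> x; rewrite mulr_ge0// sqr_ge0.
have m2 : measurable_fun setT (fun p : R * R => (a (p.1 + p.2) - a p.1) ^+ 2).
  apply: measurable_funX; apply: measurable_funB; last exact: measurableT_comp.
  by apply: (measurableT_comp ma); exact: measurable_funD.
have mw : measurable_fun setT w.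
  apply: (@measurable_fun_fubini_tonelli_G _ _ _ _ _ mu
    (fun p : R * R => ((a (p.1 + p.2) - a p.1) ^+ 2)%:E)).
    exact/measurable_EFinP.
  by move=> p; rewrite lee_fin sqr_ge0.
have key e : 0 < e -> (\int[mu]_x ((poisson_conv e a x - a x) ^+ 2)%:E <=
    \int[mu]_s ((poisson e s)%:E * w s))%E.
  move=> e0.
  have mpc : measurable_fun setT (poisson_conv e a).
    apply: (@measurable_fun_integral2 _ _ _ _ _ mu (fun p : R * R => poisson e (p.2 - p.1) * a p.2)).
    apply: measurable_funM; last exact: measurableT_comp.
    by apply: (measurableT_comp (measurable_poisson e0)); exact: measurable_funB.
  have mF : measurable_fun setT (fun p : R * R => (poisson e p.2 * (a (p.1 + p.2) - a p.1) ^+ 2)%:E).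
    apply/measurable_EFinP; apply: measurable_funM => //.
    exact: (measurableT_comp (measurable_poisson e0)).
  have F0 (p : R * R) : (0 <= (poisson e p.2 * (a (p.1 + p.2) - a p.1) ^+ 2)%:E)%E.
    by rewrite lee_fin mulr_ge0 ?sqr_ge0// poisson_ge0.
  apply: (@le_trans _ _ (\int[mu]_x \int[mu]_s (poisson e s * (a (x + s)%R - a x) ^+ 2)%:E)%E).
    apply: ge0_le_integral => //.
    - by move=> x _; rewrite lee_fin sqr_ge0.
    - by apply/measurable_EFinP; apply: measurable_funX; exact: measurable_funB.
    - exact: (@measurable_fun_fubini_tonelli_F _ _ _ _ _ mu _ mF F0).
    - move=> x _; rewrite (le_trans (poisson_conv_sqr x e0 ma ia))//.
      rewrite -(@ge0_integral_shift _ x (fun l => (poisson e (l - x) * (a l - a x) ^+ 2)%:E)).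
      + rewrite le_eqVlt; apply/orP; left; apply/eqP; apply: eq_integral => s _.
        by rewrite addrK (addrC s x).
      + apply/measurable_EFinP; apply: measurable_funM; first exact: measurable_poisson_sub.
        by apply: measurable_funX; exact: measurable_funB.
      + by move=> l; rewrite lee_fin mulr_ge0 ?sqr_ge0// poisson_ge0.
  rewrite (@fubini_tonelli _ _ _ _ _ mu mu _ mF F0).
  rewrite le_eqVlt; apply/orP; left; apply/eqP; apply: eq_integral => s _.
  rewrite /= (@ge0_integralZE _ _ _ mu (poisson e s) (fun x => (a (x + s) - a x) ^+ 2))//.
  - exact: mas2.
  - by move=> x; exact: sqr_ge0.
  - exact: poisson_ge0.
apply/ge0_ecvg0P; first by move=> n; apply: integral_ge0E => x; exact: sqr_ge0.
move=> eps eps0.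
have eps2 : 0 < eps / 2 by rewrite divr_gt0.
have /nbhs_ballP[de /= d0 hd] := shift_L2 ma ia eps2.
(* [4 * N] is the global bound on [w] and [1 + de^-2] the constant of [poisson_tail], so that the
   tail contributes at most [e * K]. *)
pose K := 4 * N * (1 + de^-2).
have K0 : 0 <= K by rewrite mulr_ge0 ?mulr_ge0// addr_ge0// invr_ge0 sqr_ge0.
have Z (k e : R) : 0 <= k -> 0 < e -> (\int[mu]_s (k * poisson e s)%:E = k%:E)%E.
  move=> k0 e0; rewrite (@ge0_integralZE _ _ _ mu k (poisson e)) ?integral_poisson ?mule1//.
  - exact: measurable_poisson.
  - by move=> s; exact: poisson_ge0.
have k0 : 0 < eps / 2 / (K + 1) by rewrite divr_gt0// ltr_wpDl.
near=> n.
pose e : R := n.+1%:R^-1.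
have e0 : 0 < e by rewrite invr_gt0.
have eK0 : 0 <= e * K by apply: mulr_ge0 => //; exact: ltW.
have eK : e * K <= eps / 2.
  have : n.+1%:R^-1 < eps / 2 / (K + 1).
    by near: n; exact: (near_infty_natSinv_lt (PosNum k0)).
  rewrite ltr_pdivlMr ?ltr_wpDl// mulrDr mulr1 => /ltW; apply: le_trans.
  by rewrite lerDl ltW.
apply: (le_trans (key _ e0)).
apply: (@le_trans _ _ (\int[mu]_s (eps / 2 * poisson e s + e * K * poisson 1 s)%:E)%E).
  apply: ge0_le_integral => //.
  - by move=> s _; rewrite mule_ge0// lee_fin poisson_ge0.
  - apply: emeasurable_funM => //; apply/measurable_EFinP; exact: measurable_poisson.
  - apply/measurable_EFinP; apply: measurable_funD; apply: measurable_funM => //; exact: measurable_poisson.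
  - move=> s _.
    have p1 : 0 <= e * K * poisson 1 s by apply: mulr_ge0 => //; exact: poisson_ge0.
    have p2 : 0 <= eps / 2 * poisson e s.
      by apply: mulr_ge0; [exact: ltW|exact: poisson_ge0].
    have [sd|ds] := ltP `|s| de.
      have ws : (w s <= (eps / 2)%:E)%E by apply: hd; rewrite /ball/= sub0r normrN.
      rewrite (le_trans (lee_wpmul2l _ ws)) ?lee_fin ?poisson_ge0//.
      by rewrite mulrC lerDl.
    rewrite (le_trans (lee_wpmul2l _ (wN s))) ?lee_fin ?poisson_ge0//.
    rewrite (le_trans _ (_ : e * K * poisson 1 s <= _))//; last by rewrite lerDr.
    have := poisson_tail e0 d0 ds.
    have N4 : 0 <= 4 * N by rewrite mulr_ge0.
    move=> /(ler_wpM2r N4) /le_trans; apply; rewrite /K.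
    by rewrite le_eqVlt; apply/orP; left; apply/eqP; ring.
rewrite (ge0_integralDE mu (f := fun s => eps / 2 * poisson e s) (g := fun s => e * K * poisson 1 s)).
- by rewrite !Z// ?(ltW eps2)// -EFinD lee_fin; lra.
- by apply: measurable_funM => //; exact: measurable_poisson.
- by apply: measurable_funM => //; exact: measurable_poisson.
- by move=> s; apply: mulr_ge0; [exact: ltW|exact: poisson_ge0].
- by move=> s; apply: mulr_ge0 => //; exact: poisson_ge0.
Unshelve. all: by end_near. Qed.
End poisson_conv.

(** * Completeness of L^2 *)

Section riesz_fischer.
Context {R : realType}.
Notation mu := (@lebesgue_measure R).

Lemma ae_lebesgueS (P Q : R -> Prop) : {ae mu, forall x, P x} ->
  (forall x, P x -> Q x) -> {ae mu, forall x, Q x}.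
Proof.
move=> [A [mA A0 PA]] PQ; exists A; split => // x /= nQ.
by apply: PA => /= Px; apply: nQ; exact: PQ.
Qed.

Lemma ge0_fatou_le (f : nat -> R -> R) (g : R -> R) (c : \bar R) :
  (forall n, measurable_fun setT (f n)) -> measurable_fun setT g ->
  (forall n x, 0 <= f n x) -> (forall x, 0 <= g x) ->
  {ae mu, forall x, f n x @[n --> \oo] --> g x} ->
  (\forall n \near \oo, (\int[mu]_x (f n x)%:E <= c)%E) ->
  (\int[mu]_x (g x)%:E <= c)%E.
Proof.
move=> mf mg f0 g0 fg fc.
apply: (@le_trans _ _ (\int[mu]_x limn_einf (fun n => (f n x)%:E))%E).
  apply: ae_ge0_le_integral => //.
  - by move=> x _; rewrite lee_fin.
  - exact/measurable_EFinP.
  - move=> x _; rewrite limn_einf_lim; apply: lime_ge; first exact: is_cvg_einfs.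
    by near=> n; apply: le_ereal_inf_tmp => _ [k _ <-]; rewrite lee_fin.
  - under eq_fun do rewrite -[limn_einf _]oppeK -limn_esupN.
    apply: measurableT_comp => //; apply: measurable_fun_limn_esup => n.
    have h : measurable_fun setT (fun x => - f n x) by apply: measurableT_comp => //; exact: mf.
    by have /measurable_EFinP := h; exact.
  - apply: (ae_lebesgueS fg) => x fgx _.
    have h : (fun n => (f n x)%:E) @ \oo --> (g x)%:E by apply: cvg_EFin => //; exact: nearW.
    rewrite is_cvg_limn_einfE; last by apply/cvg_ex; exists (g x)%:E.
    by rewrite (cvg_lim _ h).
apply: le_trans (@fatou _ _ _ mu setT measurableT (fun n x => (f n x)%:E) _ _) _.
- by move=> n; have /measurable_EFinP := mf n; exact.
- by move=> n x _; rewrite lee_fin.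
rewrite limn_einf_lim; apply: lime_le; first exact: is_cvg_einfs.
apply: filterS fc => n; apply: le_trans.
by apply: ereal_inf_lbound; exists n => //=.
Unshelve. all: by end_near. Qed.

(** The factor [4 ^+ n] is spent on the weights of the series in [riesz_fischer]; the remaining
    [1 / 2 ^ n.+1] sum to 1. *)
Definition rf_rate (n : nat) : R := (4 ^+ n * (2 ^ n.+1)%:R)^-1.

(** The weighted series [S] of squared increments has integral at most 1, hence is finite almost
    everywhere, and there the sequence converges geometrically. Fatou's lemma carries the rate over
    to the limit. *)
Lemma riesz_fischer (a : nat -> R -> R) : (forall n, measurable_fun setT (a n)) ->
  (forall n m, (n <= m)%N ->
     (\int[mu]_x ((a m x - a n x) ^+ 2)%:E <= (rf_rate n)%:E)%E) ->
  exists A : R -> R, measurable_fun setT A /\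
    forall n, (\int[mu]_x ((a n x - A x) ^+ 2)%:E <= (rf_rate n)%:E)%E.
Proof.
move=> ma ha.
have md n m : measurable_fun setT (fun x => (a n x - a m x) ^+ 2).
  by apply: measurable_funX; apply: measurable_funB; exact: ma.
pose S x := (\sum_(0 <= n <oo) (4 ^+ n * (a n.+1 x - a n x) ^+ 2)%:E)%E.
have mterm n : measurable_fun setT (fun x => (4 ^+ n * (a n.+1 x - a n x) ^+ 2)%:E).
  apply/measurable_EFinP; apply: measurable_funM => //; exact: md.
have t0 n x : 0 <= 4 ^+ n * (a n.+1 x - a n x) ^+ 2.
  by rewrite mulr_ge0 ?sqr_ge0// exprn_ge0.
have S0 x : (0 <= S x)%E by apply: nneseries_ge0 => n _ _; rewrite lee_fin.
have intS : (\int[mu]_x S x <= 1%:E)%E.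
  rewrite /S integral_nneseries//; last by move=> n x _; rewrite lee_fin.
  apply: le_trans (epsilon_trick0 xpredT (ler01 : 0 <= 1 :> R)).
  apply: lee_nneseries => n _; first by move=> _; exact: integral_ge0E.
  rewrite (@ge0_integralZE _ _ _ mu (4 ^+ n) (fun x => (a n.+1 x - a n x) ^+ 2)).
  - have h4 : (0 <= (4 ^+ n)%:E :> \bar R)%E by rewrite lee_fin exprn_ge0.
    apply: le_trans (lee_wpmul2l h4 (ha n n.+1 (leqnSn n))) _; rewrite lee_fin.
    by rewrite /rf_rate invfM mulrA mulfV ?mul1r// gt_eqF// exprn_gt0.
  - exact: md.
  - by move=> x; exact: sqr_ge0.
  - by rewrite exprn_ge0.
have mS : measurable_fun setT S.
  rewrite (_ : S = fun x => (\sum_(0 <= n <oo | n \in xpredT)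
      (4 ^+ n * (a n.+1 x - a n x) ^+ 2)%:E)%E)//.
  apply: ge0_emeasurable_sum => [n x _ _|n _]; [by rewrite lee_fin|exact: mterm].
have aeS : {ae mu, forall x, S x \is a fin_num}.
  have iS : mu.-integrable setT S.
    apply/integrableP; split => //.
    under eq_integral do rewrite gee0_abs//.
    by rewrite (le_lt_trans intS)// ltry.
  by apply: (ae_lebesgueS (integrable_ae measurableT iS)) => x; exact.
have aecv : {ae mu, forall x, cvgn (fun n => a n x)}.
  apply: (ae_lebesgueS aeS) => x Sx.
  (* Each term of the series is at most [S x], and [z <= 1 + z ^+ 2] for [z] equal to [2 ^+ n] times
     the modulus of the increment. *)
  have bound n : `|telescope (a ^~ x) n| <= geometric (1 + fine (S x)) (2^-1) n.
    have h : 4 ^+ n * (a n.+1 x - a n x) ^+ 2 <= fine (S x).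
      rewrite -lee_fin fineK//.
      apply: le_trans (nneseries_lim_ge n.+1 _).
        rewrite big_nat_recr//= leeDr// sume_ge0// => i _; rewrite lee_fin; exact: t0.
      by move=> i _ _; rewrite lee_fin; exact: t0.
    rewrite /geometric/= (_ : telescope (a ^~ x) n = a n.+1 x - a n x)//.
    move: h; move: (a n.+1 x - a n x) => D.
    rewrite -(real_normK (num_real D)) => h.
    rewrite exprVn ler_pdivlMr ?exprn_gt0// mulrC.
    apply: le_trans (_ : 1 + (2 ^+ n * `|D|) ^+ 2 <= _).
      by move: (2 ^+ n * `|D|) => z; have := sqr_ge0 (z - 2^-1); lra.
    rewrite lerD2l exprMn -exprM mulnC exprM (_ : 2 ^+ 2 = 4 :> R)//; ring.
  have cv : cvgn (series (telescope (a ^~ x))).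
    apply: normed_cvg; apply: series_le_cvg bound _ => //.
    - by move=> n; rewrite /geometric/= mulr_ge0 ?exprn_ge0 ?invr_ge0// addr_ge0// fine_ge0.
    - apply: is_cvg_geometric_series; rewrite ger0_norm ?invr_ge0//.
      by rewrite invf_lt1// ltr1n.
  rewrite (_ : (fun n => a n x) = fun n => a 0%N x + series (telescope (a ^~ x)) n); last first.
    by apply/funext => n; exact: (eq_sum_telescope (a ^~ x)).
  by apply: is_cvgD; [exact: is_cvg_cst|exact: cv].
(* The upper limit exists at every point and is measurable; almost everywhere it is the limit. *)
pose A x := fine (limn_esup (fun n => (a n x)%:E)).
have mA : measurable_fun setT A.
  apply: (measurableT_comp (@fine_measurable R setT measurableT)).
  by apply: measurable_fun_limn_esup => n; exact/measurable_EFinP.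
have aeA : {ae mu, forall x, a n x @[n --> \oo] --> A x}.
  apply: (ae_lebesgueS aecv) => x cvx.
  suff -> : A x = limn (fun n => a n x) by exact: cvx.
  have h : (fun n => (a n x)%:E) @ \oo --> (limn (fun n => a n x))%:E.
    by apply: cvg_EFin; [exact: nearW|exact: cvx].
  rewrite /A is_cvg_limn_esupE; last by apply/cvg_ex; eexists; exact: h.
  by rewrite (cvg_lim _ h).
exists A; split => // n.
apply: (@ge0_fatou_le (fun m x => (a n x - a m x) ^+ 2)).
- by move=> m; exact: md.
- by apply: measurable_funX; exact: measurable_funB.
- by move=> m x; exact: sqr_ge0.
- by move=> x; exact: sqr_ge0.
- apply: (ae_lebesgueS aeA) => x ax.
  rewrite expr2; under eq_fun do rewrite expr2.
  by apply: cvgM; apply: cvgB => //; exact: cvg_cst.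
- exists n => // m /= nm; rewrite (le_trans _ (ha n m nm))//.
  by under eq_integral do rewrite -sqrrN opprB.
Qed.
End riesz_fischer.

(** * Complex-valued functions *)

Section complex_toolbox.
Context {R : realType}.
Implicit Types z w : R[i].
Local Notation re := complex.Re.
Local Notation im := complex.Im.
Local Notation normc := Normc.normc.

Lemma reD z w : re (z + w) = re z + re w. Proof. by case: z; case: w. Qed.
Lemma imD z w : im (z + w) = im z + im w. Proof. by case: z; case: w. Qed.
Lemma reN z : re (- z) = - re z. Proof. by case: z. Qed.
Lemma imN z : im (- z) = - im z. Proof. by case: z. Qed.
Lemma reM z w : re (z * w) = re z * re w - im z * im w.
Proof. by case: z; case: w. Qed.
Lemma imM z w : im (z * w) = re z * im w + im z * re w.
Proof. by case: z => a b; case: w. Qed.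

Lemma re_conj z : re (z^*%C) = re z. Proof. by case: z. Qed.
Lemma im_conj z : im (z^*%C) = - im z. Proof. by case: z. Qed.

Lemma complex_eq z w : re z = re w -> im z = im w -> z = w.
Proof. by case: z => a b; case: w => c d /= -> ->. Qed.

(** The squared modulus, kept as a polynomial in the components so that inequalities and
    measurability avoid square roots. *)
Definition nsq z : R := re z ^+ 2 + im z ^+ 2.

Lemma nsq_ge0 z : 0 <= nsq z. Proof. by rewrite addr_ge0// sqr_ge0. Qed.

Lemma normc_nsq z : normc z ^+ 2 = nsq z.
Proof. by case: z => a b /=; rewrite sqr_sqrtr// addr_ge0// sqr_ge0. Qed.

Lemma normc_ge0 z : 0 <= normc z. Proof. by case: z => a b /=; exact: sqrtr_ge0. Qed.

Lemma normc_le z (c : R) : 0 <= c -> (normc z <= c) = (nsq z <= c ^+ 2).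
Proof. by move=> c0; rewrite -normc_nsq ler_sqr// nnegrE normc_ge0. Qed.

Lemma re_le_normc z : `|re z| <= normc z.
Proof.
rewrite -ler_sqr ?nnegrE ?normc_ge0// real_normK ?num_real// normc_nsq /nsq.
by rewrite lerDl sqr_ge0.
Qed.

Lemma im_le_normc z : `|im z| <= normc z.
Proof.
rewrite -ler_sqr ?nnegrE ?normc_ge0// real_normK ?num_real// normc_nsq /nsq.
by rewrite lerDr sqr_ge0.
Qed.

Lemma normc_le_re_im z : normc z <= `|re z| + `|im z|.
Proof.
rewrite normc_le ?addr_ge0// /nsq -(real_normK (num_real (re z))) -(real_normK (num_real (im z))).
have := mulr_ge0 (normr_ge0 (re z)) (normr_ge0 (im z)); nra.
Qed.

Lemma nsqM z w : nsq (z * w) = nsq z * nsq w.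
Proof. by rewrite -!normc_nsq Normc.normcM exprMn. Qed.

Lemma nsqC (a : R) : nsq a%:C = a ^+ 2. Proof. by rewrite /nsq/= expr0n/= addr0. Qed.

Lemma normcC (a : R) : normc a%:C = `|a|.
Proof. by rewrite /= expr0n/= addr0 sqrtr_sqr. Qed.

Lemma nsqD_le z w : nsq (z + w) <= 2 * nsq z + 2 * nsq w.
Proof.
rewrite /nsq reD imD.
have := sqr_ge0 (re z - re w); have := sqr_ge0 (im z - im w); nra.
Qed.

Definition cis (s : R) : R[i] := cos s +i* sin s.

Lemma cexp_im s : cexp (0 +i* s) = cis s.
Proof. by rewrite /cexp /= expR0 mul1r. Qed.

Lemma cisD a b : cis (a + b) = cis a * cis b.
Proof. by apply: complex_eq; rewrite ?reM ?imM /= ?cosD ?sinD; ring. Qed.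

Lemma cis0 : cis 0 = 1. Proof. by rewrite /cis cos0 sin0. Qed.

Lemma nsq_cis s : nsq (cis s) = 1.
Proof. by rewrite /nsq /= cos2Dsin2. Qed.

Lemma normc_cis s : normc (cis s) = 1.
Proof. by rewrite /= cos2Dsin2 sqrtr1. Qed.

Lemma conj_cis s : (cis s)^*%C = cis (- s).
Proof. by rewrite /cis cosN sinN. Qed.

Lemma nsq_conj z : nsq (z^*%C) = nsq z.
Proof. by case: z => a b; rewrite /nsq /= sqrrN. Qed.

Lemma normc_conj z : normc (z^*%C) = normc z.
Proof. by case: z => a b; rewrite /= sqrrN. Qed.

Lemma mul_conj z : z * z^*%C = (nsq z)%:C.
Proof. by case: z => a b; apply: complex_eq; rewrite ?reM ?imM /nsq /=; ring. Qed.

Lemma normc_scale (r : R) z : 0 <= r -> normc (r%:C * z) = r * normc z.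
Proof. by move=> r0; rewrite Normc.normcM normcC ger0_norm. Qed.

Section measurable.
Context d (T : measurableType d).
Implicit Types f g : T -> R[i].

Lemma cmeasurableD f g : cmeasurable_fun setT f -> cmeasurable_fun setT g ->
  cmeasurable_fun setT (fun x => f x + g x).
Proof.
move=> [f1 f2] [g1 g2]; split.
- by under eq_fun do rewrite reD; exact: measurable_funD.
- by under eq_fun do rewrite imD; exact: measurable_funD.
Qed.

Lemma cmeasurableN f : cmeasurable_fun setT f -> cmeasurable_fun setT (fun x => - f x).
Proof.
move=> [f1 f2]; split.
- by under eq_fun do rewrite reN; exact: measurableT_comp.
- by under eq_fun do rewrite imN; exact: measurableT_comp.
Qed.

Lemma cmeasurableB f g : cmeasurable_fun setT f -> cmeasurable_fun setT g ->
  cmeasurable_fun setT (fun x => f x - g x).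
Proof. by move=> mf mg; apply: cmeasurableD => //; exact: cmeasurableN. Qed.

Lemma cmeasurableM f g : cmeasurable_fun setT f -> cmeasurable_fun setT g ->
  cmeasurable_fun setT (fun x => f x * g x).
Proof.
move=> [f1 f2] [g1 g2]; split.
- by under eq_fun do rewrite reM; apply: measurable_funB; exact: measurable_funM.
- by under eq_fun do rewrite imM; apply: measurable_funD; exact: measurable_funM.
Qed.

Lemma cmeasurable_cst (c : R[i]) : cmeasurable_fun [set: T] (fun=> c).
Proof. by split; exact: measurable_cst. Qed.

Lemma cmeasurable_real (a : T -> R) : measurable_fun setT a ->
  cmeasurable_fun setT (fun x => (a x)%:C).
Proof. by move=> ma; split => //=; exact: measurable_cst. Qed.

Lemma cmeasurable_conj f : cmeasurable_fun setT f ->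
  cmeasurable_fun setT (fun x => (f x)^*%C).
Proof.
move=> [f1 f2]; split.
- by under eq_fun do rewrite re_conj.
- by under eq_fun do rewrite im_conj; exact: measurableT_comp.
Qed.

Lemma cmeasurable_cis (a : T -> R) : measurable_fun setT a ->
  cmeasurable_fun setT (fun x => cis (a x)).
Proof.
move=> ma; split => /=.
- by apply: (measurableT_comp _ ma); apply: continuous_measurable_fun; exact: continuous_cos.
- by apply: (measurableT_comp _ ma); apply: continuous_measurable_fun; exact: continuous_sin.
Qed.

Lemma cmeasurable_comp d' (T' : measurableType d') (h : T' -> R[i]) (p : T -> T') :
  cmeasurable_fun setT h -> measurable_fun setT p -> cmeasurable_fun setT (fun x => h (p x)).
Proof.
move=> [h1 h2] mp; split; [exact: (measurableT_comp h1)|exact: (measurableT_comp h2)].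
Qed.

Lemma measurable_nsq f : cmeasurable_fun setT f -> measurable_fun setT (fun x => nsq (f x)).
Proof. by move=> [f1 f2]; apply: measurable_funD; exact: measurable_funX. Qed.

Lemma measurable_normc f : cmeasurable_fun setT f -> measurable_fun setT (fun x => normc (f x)).
Proof.
move=> mf; rewrite (_ : (fun _ => _) = (fun x => Num.sqrt (nsq (f x)))).
  apply: measurableT_comp (measurable_nsq mf).
  apply: continuous_measurable_fun; exact: sqrt_continuous.
by apply/funext => x; rewrite -normc_nsq sqrtr_sqr ger0_norm ?normc_ge0.
Qed.

End measurable.
End complex_toolbox.

(** * Fubini's theorem for real-valued integrals *)

Section Rintegral_fubini.
Context d1 d2 (T1 : measurableType d1) (T2 : measurableType d2) (R : realType).
Variables (m1 : {sigma_finite_measure set T1 -> \bar R}).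
Variables (m2 : {sigma_finite_measure set T2 -> \bar R}).
Variable f : T1 * T2 -> R.
Hypothesis fi : (m1 \x m2)%E.-integrable setT (EFin \o f).

Let aeF : {ae m1, forall x, ((\int[m2]_y f (x, y))%:E = \int[m2]_y (f (x, y))%:E)%E}.
Proof. by apply: filterS (ae_integrable1 fi) => x h; exact: EFin_Rintegral. Qed.

Let aeG : {ae m2, forall y, ((\int[m1]_x f (x, y))%:E = \int[m1]_x (f (x, y))%:E)%E}.
Proof. by apply: filterS (ae_integrable2 fi) => x h; exact: EFin_Rintegral. Qed.

Let mf : measurable_fun setT f := integrable_measurable fi.

Let mF : measurable_fun setT (fun x => (\int[m2]_y f (x, y))%:E).
Proof. by apply/measurable_EFinP; exact: measurable_fun_integral2. Qed.

Let mG : measurable_fun setT (fun y => (\int[m1]_x f (x, y))%:E).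
Proof.
apply/measurable_EFinP.
apply: (@measurable_fun_integral2 _ _ _ _ _ m1 (fun p : T2 * T1 => f (p.2, p.1))).
by apply: (measurableT_comp mf); exact: measurable_swap.
Qed.

Lemma integrable_Rintegral2 :
  m1.-integrable setT (fun x => (\int[m2]_y f (x, y))%:E).
Proof.
have iF := integrable_fubini_F fi.
have /integrableP[miF Fy] := iF.
apply/integrableP; split => //.
rewrite (@ae_eq_integral _ _ _ m1 setT (fun x => `|fubini_F m2 (EFin \o f) x|)%E)//.
- exact: measurableT_comp.
- exact: measurableT_comp.
- by apply: filterS aeF => x xE _; congr abse; exact: xE.
Qed.

(** Sections of [f] are integrable only almost everywhere. On the exceptional null sets the inner
    real integrals may take default values, which the outer integrals do not see. *)
Lemma Rintegral_fubini :
  \int[m1]_x (\int[m2]_y f (x, y)) = \int[m2]_y (\int[m1]_x f (x, y)).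
Proof.
congr fine.
transitivity (\int[m1]_x fubini_F m2 (EFin \o f) x)%E.
  apply: ae_eq_integral => //; first by case/integrableP: (integrable_fubini_F fi).
  by apply: filterS aeF => x xE _; exact: xE.
transitivity (\int[m2]_y fubini_G m1 (EFin \o f) y)%E; first exact: Fubini.
apply: ae_eq_integral => //.
  exact: measurable_fubini_G fi.
by apply: filterS aeG => x xE _; exact: esym.
Qed.

End Rintegral_fubini.

(** * Integrals of complex-valued functions *)

Section cintegral.
Context {R : realType}.
Notation mu := (@lebesgue_measure R).
Local Notation re := complex.Re.
Local Notation im := complex.Im.
Local Notation normc := Normc.normc.
Implicit Types f g h : R -> R[i].

Lemma cintegrable_measurable h : cintegrable setT h -> cmeasurable_fun setT h.
Proof. by move=> [h1 h2]; split; [exact: integrable_measurable h1|exact: integrable_measurable h2]. Qed.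

Lemma cintegrable_le h (g : R -> R) : cmeasurable_fun setT h ->
  mu.-integrable setT (EFin \o g) -> (forall x, normc (h x) <= g x) ->
  cintegrable setT h.
Proof.
move=> [m1 m2] ig hg; split.
- by apply: (@integrable_le _ _ _ mu (fun x => re (h x)) g) => // x; exact: le_trans (re_le_normc _) _.
- by apply: (@integrable_le _ _ _ mu (fun x => im (h x)) g) => // x; exact: le_trans (im_le_normc _) _.
Qed.

Lemma integrable_normc h : cintegrable setT h ->
  mu.-integrable setT (EFin \o (fun x => normc (h x))).
Proof.
move=> ih; have mh := cintegrable_measurable ih.
apply: (@integrable_le _ _ _ mu _ (fun x => `|re (h x)| + `|im (h x)|)).
- exact: measurable_normc.
- by case: ih => h1 h2; apply: integrableDE; exact: integrable_norm.
- by move=> x; rewrite ger0_norm ?normc_ge0// normc_le_re_im.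
Qed.

Lemma cintegrable_bounded h g (B : R) : cintegrable setT h -> cmeasurable_fun setT g ->
  (forall x, normc (g x) <= B) -> cintegrable setT (fun x => h x * g x).
Proof.
move=> ih mg gB; apply: (@cintegrable_le _ (fun x => B * normc (h x))).
- by apply: cmeasurableM => //; exact: cintegrable_measurable.
- by apply: integrableZE; exact: integrable_normc.
- by move=> x; rewrite Normc.normcM mulrC ler_wpM2r ?normc_ge0.
Qed.

Lemma cintegrableZ (c : R[i]) h : cintegrable setT h -> cintegrable setT (fun x => c * h x).
Proof.
move=> ih; under eq_fun do rewrite mulrC.
by apply: (@cintegrable_bounded _ (fun=> c) (normc c)) => //; exact: cmeasurable_cst.
Qed.

Lemma cintegrableD f g : cintegrable setT f -> cintegrable setT g ->
  cintegrable setT (fun x => f x + g x).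
Proof.
move=> [f1 f2] [g1 g2]; split.
- by under eq_fun do rewrite reD; exact: integrableDE.
- by under eq_fun do rewrite imD; exact: integrableDE.
Qed.

Lemma eq_cintegral (D : set R) f g : (forall x, f x = g x) -> cintegral D f = cintegral D g.
Proof. by move=> fg; congr cintegral; exact/funext. Qed.

Lemma cintegralD f g : cintegrable setT f -> cintegrable setT g ->
  cintegral setT (fun x => f x + g x) = cintegral setT f + cintegral setT g.
Proof.
move=> [f1 f2] [g1 g2]; apply: complex_eq; rewrite ?reD ?imD /=.
- by rewrite -RintegralD//; apply: eq_Rintegral => x _; rewrite reD.
- by rewrite -RintegralD//; apply: eq_Rintegral => x _; rewrite imD.
Qed.

Lemma cintegralZ (c : R[i]) f : cintegrable setT f ->
  cintegral setT (fun x => c * f x) = c * cintegral setT f.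
Proof.
move=> [f1 f2]; apply: complex_eq; rewrite ?reM ?imM /=.
- rewrite -!RintegralZl// -RintegralB//; try exact: integrableZE.
  by apply: eq_Rintegral => x _; rewrite reM.
- rewrite -!RintegralZl// -RintegralD//; try exact: integrableZE.
  by apply: eq_Rintegral => x _; rewrite imM.
Qed.

Lemma cintegralZr (c : R[i]) f : cintegrable setT f ->
  cintegral setT (fun x => f x * c) = cintegral setT f * c.
Proof. by move=> fi; rewrite mulrC -cintegralZ//; apply: eq_cintegral => x; rewrite mulrC. Qed.

Lemma cintegralB f g : cintegrable setT f -> cintegrable setT g ->
  cintegral setT (fun x => f x - g x) = cintegral setT f - cintegral setT g.
Proof.
move=> fi gi.
rewrite -[- cintegral _ g]mulN1r -cintegralZ// -cintegralD//; last exact: cintegrableZ.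
by apply: eq_cintegral => x; rewrite mulN1r.
Qed.

Lemma cintegral_conj f : cintegrable setT f ->
  cintegral setT (fun x => (f x)^*%C) = (cintegral setT f)^*%C.
Proof.
move=> [f1 f2]; apply: complex_eq => /=.
- by apply: eq_Rintegral => x _; rewrite re_conj.
- rewrite -mulN1r -RintegralZl//.
  by apply: eq_Rintegral => x _; rewrite im_conj mulN1r.
Qed.

Lemma cintegral_real (a : R -> R) : cintegral setT (fun x => (a x)%:C) = (\int[mu]_x a x)%:C.
Proof. by apply: complex_eq => //=; rewrite /Rintegral integral0. Qed.

(** The factor 2 comes from bounding the real and imaginary parts separately; every use asks only
    for some explicit finite bound. *)
Lemma normc_cintegral_le f (g : R -> R) : cintegrable setT f ->
  mu.-integrable setT (EFin \o g) -> (forall x, normc (f x) <= g x) ->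
  normc (cintegral setT f) <= 2 * \int[mu]_x g x.
Proof.
move=> [f1 f2] ig fg; rewrite (le_trans (normc_le_re_im _))//= mulr_natl mulr2n.
apply: lerD.
- rewrite (le_trans (le_normr_Rintegral _ _))//; apply: le_Rintegral => //.
    exact: integrable_norm.
  by move=> x _; exact: le_trans (re_le_normc _) _.
- rewrite (le_trans (le_normr_Rintegral _ _))//; apply: le_Rintegral => //.
    exact: integrable_norm.
  by move=> x _; exact: le_trans (im_le_normc _) _.
Qed.

Lemma cmeasurable_cintegral d (T : measurableType d) (K : T * R -> R[i]) :
  cmeasurable_fun setT K -> cmeasurable_fun setT (fun x => cintegral setT (fun y => K (x, y))).
Proof.
move=> [k1 k2]; split => /=.
- exact: (@measurable_fun_integral2 _ _ _ _ _ mu (fun p => re (K p))).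
- exact: (@measurable_fun_integral2 _ _ _ _ _ mu (fun p => im (K p))).
Qed.

Definition cintegrable2 (K : R * R -> R[i]) : Prop :=
  (mu \x mu)%E.-integrable setT (fun p : R * R => (re (K p))%:E) /\
  (mu \x mu)%E.-integrable setT (fun p : R * R => (im (K p))%:E).

Lemma cintegrable2_le (K : R * R -> R[i]) (g : R * R -> R) : cmeasurable_fun setT K ->
  (mu \x mu)%E.-integrable setT (EFin \o g) -> (forall p, normc (K p) <= g p) ->
  cintegrable2 K.
Proof.
move=> [m1 m2] ig hg; split.
- by apply: (@integrable_le _ _ _ (mu \x mu)%E (fun x => re (K x)) g) => // x; exact: le_trans (re_le_normc _) _.
- by apply: (@integrable_le _ _ _ (mu \x mu)%E (fun x => im (K x)) g) => // x; exact: le_trans (im_le_normc _) _.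
Qed.

Lemma cintegrable2_prod (K : R * R -> R[i]) (p q : R -> R) : cmeasurable_fun setT K ->
  mu.-integrable setT (EFin \o p) -> mu.-integrable setT (EFin \o q) ->
  (forall x y, normc (K (x, y)) <= p x * q y) -> cintegrable2 K.
Proof.
move=> mK ip iq Kpq.
apply: (@cintegrable2_le _ (fun z => p z.1 * q z.2)) => //; first exact: integrable_prod.
by move=> [x y]; exact: Kpq.
Qed.

Lemma cfubini (K : R * R -> R[i]) : cintegrable2 K ->
  cintegral setT (fun x => cintegral setT (fun y => K (x, y))) =
  cintegral setT (fun y => cintegral setT (fun x => K (x, y))).
Proof.
move=> [k1 k2]; apply: complex_eq => /=.
- exact: (@Rintegral_fubini _ _ _ _ _ mu mu (fun p => re (K p))).
- exact: (@Rintegral_fubini _ _ _ _ _ mu mu (fun p => im (K p))).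
Qed.

Lemma cintegrable_cintegral2 (K : R * R -> R[i]) : cintegrable2 K ->
  cintegrable setT (fun x => cintegral setT (fun y => K (x, y))).
Proof.
move=> [k1 k2]; split => /=.
- exact: (@integrable_Rintegral2 _ _ _ _ _ mu mu (fun p => re (K p))).
- exact: (@integrable_Rintegral2 _ _ _ _ _ mu mu (fun p => im (K p))).
Qed.

End cintegral.

(** * The squared L^2 norm and pairings of L^2 functions *)

Section squared_norm.
Context {R : realType}.
Notation mu := (@lebesgue_measure R).
Local Notation re := complex.Re.
Local Notation im := complex.Im.
Local Notation normc := Normc.normc.
Implicit Types f g h : R -> R[i].

Lemma near_eq_cvgn (u v : nat -> R) (l : R) : (\forall n \near \oo, u n = v n) ->
  u n @[n --> \oo] --> l -> v n @[n --> \oo] --> l.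
Proof. by move=> uv ul; apply: cvg_trans ul; exact: near_eq_cvg. Qed.

(* Working with the square of [L2norm] avoids powers of extended reals. *)
Definition N2 h : \bar R := (\int[mu]_x (nsq (h x))%:E)%E.

Lemma N2_ge0 h : (0 <= N2 h)%E.
Proof. by apply: integral_ge0E => x; exact: nsq_ge0. Qed.

Lemma L2normE h : L2norm h = (N2 h `^ 2^-1)%E.
Proof.
rewrite /L2norm unlock /N2; congr (_ `^ _)%E; apply: eq_integral => x _.
rewrite abse_EFin ger0_norm ?normc_ge0// poweR_EFin powR_mulrn ?normc_ge0//.
by rewrite normc_nsq.
Qed.

Lemma inL2P h : inL2 h <-> cmeasurable_fun setT h /\ (N2 h < +oo)%E.
Proof.
split=> -[mh hoo]; split=> //.
- move: hoo; rewrite L2normE; have := N2_ge0 h; case: (N2 h) => [r _ _| |//].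
    exact: ltry.
  by rewrite poweRyr ?invr_eq0.
- rewrite L2normE; apply: poweR_lty; first exact: hoo.
Qed.

Lemma L2norm_cvg0 (u : nat -> R -> R[i]) :
  N2 (u n) @[n --> \oo] --> 0%E -> L2norm (u n) @[n --> \oo] --> 0%E.
Proof.
move=> /(ge0_ecvg0P (fun n => N2_ge0 (u n))) H.
apply/ge0_ecvg0P; first by move=> n; rewrite L2normE poweR_ge0.
move=> e e0; have e20 : 0 < e ^+ 2 by rewrite exprn_gt0.
apply: filterS (H _ e20) => n un.
rewrite L2normE (_ : e%:E = ((e ^+ 2)%:E `^ 2^-1)%E); last first.
  by rewrite poweR_EFin powR12_sqrt ?sqr_ge0// sqrtr_sqr gtr0_norm.
by apply: gt0_ler_poweR => //; rewrite in_itv/= ?N2_ge0 ?leey// lee_fin sqr_ge0.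
Qed.

Lemma N2E h : cmeasurable_fun setT h ->
  N2 h = (\int[mu]_x (re (h x) ^+ 2)%:E + \int[mu]_x (im (h x) ^+ 2)%:E)%E.
Proof.
move=> [m1 m2]; rewrite /N2 /nsq.
by rewrite (@ge0_integralDE _ _ _ mu (fun x => re (h x) ^+ 2) (fun x => im (h x) ^+ 2))//;
  try (by move=> x; exact: sqr_ge0); exact: measurable_funX.
Qed.

Lemma re_le_N2 h : cmeasurable_fun setT h -> (\int[mu]_x (re (h x) ^+ 2)%:E <= N2 h)%E.
Proof.
by move=> mh; rewrite N2E// leeDl// integral_ge0E// => x; exact: sqr_ge0.
Qed.

Lemma im_le_N2 h : cmeasurable_fun setT h -> (\int[mu]_x (im (h x) ^+ 2)%:E <= N2 h)%E.
Proof.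
by move=> mh; rewrite N2E// leeDr// integral_ge0E// => x; exact: sqr_ge0.
Qed.

Lemma N2_le f g : cmeasurable_fun setT f -> cmeasurable_fun setT g ->
  (forall x, nsq (f x) <= nsq (g x)) -> (N2 f <= N2 g)%E.
Proof.
move=> mf mg fg; apply: ge0_le_integralE; [exact: measurable_nsq|exact: measurable_nsq|].
by move=> x; rewrite nsq_ge0 fg.
Qed.

Lemma eq_N2 f g : (forall x, nsq (f x) = nsq (g x)) -> N2 f = N2 g.
Proof. by move=> fg; apply: eq_integral => x _; rewrite fg. Qed.

Lemma N2Z (r : R) h : cmeasurable_fun setT h -> N2 (fun x => r%:C * h x) = ((r ^+ 2)%:E * N2 h)%E.
Proof.
move=> mh; rewrite /N2; under eq_integral do rewrite nsqM nsqC.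
rewrite (@ge0_integralZE _ _ _ mu (r ^+ 2) (fun x => nsq (h x)))//.
- exact: measurable_nsq.
- by move=> x; exact: nsq_ge0.
- exact: sqr_ge0.
Qed.

Lemma N2D_le f g : cmeasurable_fun setT f -> cmeasurable_fun setT g ->
  (N2 (fun x => (f x + g x)%R) <= 2%:E * N2 f + 2%:E * N2 g)%E.
Proof.
move=> mf mg; have m1 := measurable_nsq mf; have m2 := measurable_nsq mg.
rewrite /N2 -(@ge0_integralZE _ _ _ mu 2 (fun x => nsq (f x)))//; last by move=> x; exact: nsq_ge0.
rewrite -(@ge0_integralZE _ _ _ mu 2 (fun x => nsq (g x)))//; last by move=> x; exact: nsq_ge0.
rewrite -(@ge0_integralDE _ _ _ mu (fun x => 2 * nsq (f x)) (fun x => 2 * nsq (g x))).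
- apply: ge0_le_integralE.
  + by apply: measurable_nsq; exact: cmeasurableD.
  + by apply: measurable_funD; exact: measurable_funM.
  + by move=> x; rewrite nsq_ge0 nsqD_le.
- exact: measurable_funM.
- exact: measurable_funM.
- by move=> x; rewrite mulr_ge0 ?nsq_ge0.
- by move=> x; rewrite mulr_ge0 ?nsq_ge0.
Qed.

Lemma integrable_nsq h : cmeasurable_fun setT h -> (N2 h < +oo)%E ->
  mu.-integrable setT (EFin \o (fun x => nsq (h x))).
Proof.
move=> mh hoo; apply/integrable_ge0P => //; first by move=> x; exact: nsq_ge0.
exact: measurable_nsq.
Qed.

Lemma cintegrable_mulL2 f g : cmeasurable_fun setT f -> cmeasurable_fun setT g ->
  (N2 f < +oo)%E -> (N2 g < +oo)%E -> cintegrable setT (fun x => f x * g x).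
Proof.
move=> mf mg foo goo.
have := integrable_nsq mf foo; have := integrable_nsq mg goo => ig i_f.
apply: (@cintegrable_le _ _ (fun x => nsq (f x) + nsq (g x))).
- exact: cmeasurableM.
- exact: integrableDE.
- move=> x; rewrite Normc.normcM -!normc_nsq.
  move: (normc (f x)) (normc (g x)) (normc_ge0 (f x)) (normc_ge0 (g x)) => p q p0 q0.
  have := sqr_ge0 (p - q); nra.
Qed.

Lemma cintegral_mulL2_cvg0 f (g : nat -> R -> R[i]) : cmeasurable_fun setT f ->
  (forall n, cmeasurable_fun setT (g n)) -> (N2 f < +oo)%E ->
  N2 (g n) @[n --> \oo] --> 0%E ->
  re (cintegral setT (fun x => f x * g n x)) @[n --> \oo] --> (0 : R) /\
  im (cintegral setT (fun x => f x * g n x)) @[n --> \oo] --> (0 : R).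
Proof.
move=> mf mg foo gcv.
have [f1 f2] := mf.
have foo1 := le_lt_trans (re_le_N2 mf) foo.
have foo2 := le_lt_trans (im_le_N2 mf) foo.
have g1 n : measurable_fun setT (fun x => re (g n x)) by case: (mg n).
have g2 n : measurable_fun setT (fun x => im (g n x)) by case: (mg n).
have c1 : (\int[mu]_x (re (g n x) ^+ 2)%:E)%E @[n --> \oo] --> 0%E.
  apply: (squeeze_cvge _ (cvg_cst 0%E) gcv).
  apply: nearW => n; rewrite re_le_N2// andbT; apply: integral_ge0E => x; exact: sqr_ge0.
have c2 : (\int[mu]_x (im (g n x) ^+ 2)%:E)%E @[n --> \oo] --> 0%E.
  apply: (squeeze_cvge _ (cvg_cst 0%E) gcv).
  apply: nearW => n; rewrite im_le_N2// andbT; apply: integral_ge0E => x; exact: sqr_ge0.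
have a11 := @sqr_integrable_cvg0 _ _ _ mu _ _ f1 g1 foo1 c1.
have a12 := @sqr_integrable_cvg0 _ _ _ mu _ _ f1 g2 foo1 c2.
have a21 := @sqr_integrable_cvg0 _ _ _ mu _ _ f2 g1 foo2 c1.
have a22 := @sqr_integrable_cvg0 _ _ _ mu _ _ f2 g2 foo2 c2.
have one : (0 < 1 :> R) by [].
(* The first functions [g n] may have infinite norm; splitting the complex product into real
   integrals requires integrability, which holds eventually. *)
have near_fin (u : nat -> R -> R) : (forall n, (0 <= \int[mu]_x (u n x ^+ 2)%:E)%E) ->
    (\int[mu]_x (u n x ^+ 2)%:E)%E @[n --> \oo] --> 0%E ->
    \forall n \near \oo, (\int[mu]_x (u n x ^+ 2)%:E < +oo)%E.
  move=> u0 /(ge0_ecvg0P u0)/(_ 1 one); apply: filterS => n un.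
  by rewrite (le_lt_trans un)// ltry.
have n1 := near_fin _ (fun n => integral_ge0E mu (fun x => sqr_ge0 (re (g n x)))) c1.
have n2 := near_fin _ (fun n => integral_ge0E mu (fun x => sqr_ge0 (im (g n x)))) c2.
split.
- have h : (\int[mu]_x (re (f x) * re (g n x)) - \int[mu]_x (im (f x) * im (g n x)))
      @[n --> \oo] --> (0 : R).
    by rewrite -[0 in X in _ --> X]subr0; exact: cvgB.
  apply: (near_eq_cvgn _ h).
  near=> n => /=; have h1 : (\int[mu]_x (re (g n x) ^+ 2)%:E < +oo)%E by near: n.
  have h2 : (\int[mu]_x (im (g n x) ^+ 2)%:E < +oo)%E by near: n.
  rewrite -RintegralB//;
    [|exact: @sqr_integrable_mul _ _ _ mu _ _ f1 (g1 n) foo1 h1|exact: @sqr_integrable_mul _ _ _ mu _ _ f2 (g2 n) foo2 h2].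
  by apply: eq_Rintegral => x _; rewrite reM.
- have h : (\int[mu]_x (re (f x) * im (g n x)) + \int[mu]_x (im (f x) * re (g n x)))
      @[n --> \oo] --> (0 : R).
    by rewrite -[0 in X in _ --> X]addr0; exact: cvgD.
  apply: (near_eq_cvgn _ h).
  near=> n => /=; have h1 : (\int[mu]_x (re (g n x) ^+ 2)%:E < +oo)%E by near: n.
  have h2 : (\int[mu]_x (im (g n x) ^+ 2)%:E < +oo)%E by near: n.
  rewrite -RintegralD//;
    [|exact: @sqr_integrable_mul _ _ _ mu _ _ f1 (g2 n) foo1 h2|exact: @sqr_integrable_mul _ _ _ mu _ _ f2 (g1 n) foo2 h1].
  by apply: eq_Rintegral => x _; rewrite imM.
Unshelve. all: by end_near. Qed.

Lemma N2_damped_cvg0 (D : nat -> R -> R) h : cmeasurable_fun setT h -> (N2 h < +oo)%E ->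
  (forall n, measurable_fun setT (D n)) -> (forall n x, 0 <= D n x <= 1) ->
  (forall x, D n x @[n --> \oo] --> (1 : R)) ->
  N2 (fun x => h x * (D n x)%:C - h x) @[n --> \oo] --> 0%E.
Proof.
move=> mh hoo mD D01 D1.
have ig := integrable_nsq mh hoo.
have E n x : nsq (h x * (D n x)%:C - h x) = nsq (h x) * (D n x - 1) ^+ 2.
  rewrite (_ : h x * (D n x)%:C - h x = h x * (D n x - 1)%:C); first by rewrite nsqM nsqC.
  by rewrite rmorphB/= rmorph1 mulrBr mulr1.
have mE n : measurable_fun setT (fun x => nsq (h x) * (D n x - 1) ^+ 2).
  apply: measurable_funM; first exact: measurable_nsq.
  by apply: measurable_funX; apply: measurable_funB => //; exact: mD.
rewrite /N2; under eq_fun do under eq_integral do rewrite E.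
have [||||_ _] := @dominated_convergence _ _ _ mu setT measurableT
  (fun n x => (nsq (h x) * (D n x - 1) ^+ 2)%:E) (cst 0%E) (fun x => (nsq (h x))%:E) _ _ _ ig.
- by move=> n; have /measurable_EFinP := mE n; exact.
- exact: measurable_cst.
- apply: aeW => x _; apply: cvg_EFin; first exact: nearW.
  have : (nsq (h x) * (D n x - 1) ^+ 2) @[n --> \oo] --> nsq (h x) * (1 - 1) ^+ 2.
    apply: cvgM; first exact: cvg_cst.
    rewrite expr2; under eq_fun do rewrite expr2.
    by apply: cvgM; apply: cvgB (D1 x) _; exact: cvg_cst.
  by rewrite subrr expr0n mulr0.
- apply: aeW => x n _.
  rewrite abse_EFin lee_fin ger0_norm; last by apply: mulr_ge0; [exact: nsq_ge0|exact: sqr_ge0].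
  rewrite ler_piMr ?nsq_ge0//; have := D01 n x; move: (D n x) => p; nra.
by rewrite integral0.
Qed.

End squared_norm.

(** * Plancherel's identity *)

Section two_sided_exponential.
Context {R : realType}.
Notation mu := (@lebesgue_measure R).

Definition dexp (e k : R) : R := expR (- (e * `|k|)).

Lemma dexp_ge0 e k : 0 <= dexp e k. Proof. exact: expR_ge0. Qed.

Lemma dexp_le1 e k : 0 <= e -> dexp e k <= 1.
Proof. by move=> e0; rewrite -expR0 ler_expR oppr_le0 mulr_ge0. Qed.

Lemma dexpN e k : dexp e (- k) = dexp e k. Proof. by rewrite /dexp normrN. Qed.

Lemma continuous_dexp e : continuous (dexp e).
Proof.
move=> k; apply: (@continuous_comp _ _ _ (fun k : R => - (e * `|k|)) expR).
  apply: cvgN; apply: cvgM; [exact: cvg_cst|exact: norm_continuous].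
exact: continuous_expR.
Qed.

Lemma measurable_dexp e : measurable_fun setT (dexp e).
Proof. by apply: continuous_measurable_fun; exact: continuous_dexp. Qed.

(** Antiderivative, for [k >= 0], of the transform's real integrand with 1 added to the cosine. The
    added 1 makes the integrand nonnegative, so the fundamental theorem on a half-line applies; it
    accounts for the term [- e^-1]. *)
Let dexp_cos_primitive (e s k : R) : R :=
  expR (- (e * k)) * ((s * sin (k * s) - e * cos (k * s)) / (e ^+ 2 + s ^+ 2) - e^-1).

Let is_derive_primitive (e s x : R) : 0 < e ->
  is_derive x 1 (dexp_cos_primitive e s) (expR (- (e * x)) * (1 + cos (x * s))).
Proof.
move=> e0; rewrite /dexp_cos_primitive.
have D0 : 0 < e ^+ 2 + s ^+ 2 by rewrite ltr_pwDl ?sqr_ge0// exprn_gt0.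
have h1 : is_derive x 1 (fun k : R => - (e * k)) (- e).
  by apply: is_derive_eq; rewrite /GRing.scale/= mulr1.
have h2 : is_derive x 1 (fun k : R => k * s) s.
  by apply: is_derive_eq; rewrite /GRing.scale/= mulr0 mulr1 add0r.
have dE := @is_derive1_comp R expR (fun k : R => - (e * k)) x _ _ (is_derive_expR _) h1.
have dS := @is_derive1_comp R sin (fun k : R => k * s) x _ _ (is_derive_sin _) h2.
have dC := @is_derive1_comp R cos (fun k : R => k * s) x _ _ (is_derive_cos _) h2.
have dl : is_derive x 1 (fun k : R => (s * sin (k * s) - e * cos (k * s)) / (e ^+ 2 + s ^+ 2) - e^-1)
    ((s * (cos (x * s) * s) - e * (- sin (x * s) * s)) / (e ^+ 2 + s ^+ 2)).
  have -> : (fun k : R => (s * sin (k * s) - e * cos (k * s)) / (e ^+ 2 + s ^+ 2) - e^-1)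
     = (e ^+ 2 + s ^+ 2)^-1 *: (s *: (sin \o (fun k => k * s)) - e *: (cos \o (fun k => k * s))) - cst e^-1.
    by apply/funext => k; rewrite !fctE /= /GRing.scale /= mulrC.
  apply: is_derive_eq; rewrite /GRing.scale /= subr0 mulrC//.
apply: (is_derive_eq (is_deriveM dE dl)); rewrite /GRing.scale /=.
field; rewrite !gt_eqF//.
Qed.

Lemma integral_dexp_1cos (e s : R) : 0 < e ->
  (\int[mu]_k (dexp e k * (1 + cos (k * s)))%:E = (2 * (e^-1 + e / (e ^+ 2 + s ^+ 2)))%:E)%E.
Proof.
move=> e0.
have D0 : 0 < e ^+ 2 + s ^+ 2 by rewrite ltr_pwDl ?sqr_ge0// exprn_gt0.
have ccos : continuous (fun k : R => 1 + cos (k * s)).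
  move=> k; apply: cvgD; first exact: cvg_cst.
  apply: (@continuous_comp _ _ _ (fun k : R => k * s) cos); last exact: continuous_cos.
  by apply: cvgM; [exact: cvg_id|exact: cvg_cst].
have cosP k : 0 <= 1 + cos (k * s) by rewrite -lerBlDl sub0r; exact: cos_geN1.
rewrite ge0_symfun_integralT; last 3 first.
- by move=> k; rewrite mulr_ge0// dexp_ge0.
- by move=> k; apply: cvgM; [exact: continuous_dexp|exact: ccos].
- by move=> k /=; rewrite dexpN mulNr cosN.
rewrite -set_itvcy.
have -> : (\int[mu]_(x in `[0%R, +oo[) (dexp e x * (1 + cos (x * s)))%:E =
   \int[mu]_(x in `[0%R, +oo[) (expR (- (e * x)) * (1 + cos (x * s)))%:E)%E.
  by apply: eq_integral => x; rewrite inE/= in_itv/= andbT => x0; rewrite /dexp ger0_norm.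
have dF x := is_derive_primitive s x e0.
have Ecv : expR (- (e * k)) @[k --> +oo%R] --> (0 : R).
  apply: (cvg_comp _ _ _ (@cvgr_expR R)).
  by apply: gt0_cvgMry => //; exact: cvg_id.
have Fl : dexp_cos_primitive e s k @[k --> +oo%R] --> (0 : R).
  pose C := (`|s| + e) / (e ^+ 2 + s ^+ 2) + e^-1.
  have ECcv : expR (- (e * k)) * C @[k --> +oo%R] --> (0 : R).
    by rewrite -[0 in X in _ --> X](mul0r C); apply: cvgM => //; exact: cvg_cst.
  apply/cvgr0Pnorm_le => ep ep0.
  have /cvgr0Pnorm_le/(_ _ ep0) := ECcv; apply: filterS => k.
  apply: le_trans; rewrite !normrM ler_wpM2l//.
  have C0 : 0 <= C.
    apply: addr_ge0; last by rewrite invr_ge0 ltW.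
    by apply: divr_ge0; [apply: addr_ge0 => //; exact: ltW|exact: ltW].
  rewrite [leRHS]ger0_norm//.
  rewrite (le_trans (ler_normB _ _))// lerD//; last by rewrite gtr0_norm ?invr_gt0.
  rewrite normrM [`|_^-1|]gtr0_norm ?invr_gt0// ler_pM2r ?invr_gt0//.
  rewrite (le_trans (ler_normB _ _))// lerD// normrM.
    by rewrite ler_piMr// ler_norml sin_geN1 sin_le1.
  rewrite gtr0_norm// ler_piMr//; first exact: ltW.
  by rewrite ler_norml cos_geN1 cos_le1.
rewrite (ge0_integral0y_FTC _ _ dF Fl).
- rewrite -EFinB -EFinM /dexp_cos_primitive mulr0 mul0r oppr0 expR0 sin0 cos0.
  congr (_%:E); field; rewrite !gt_eqF//.
- by move=> x; rewrite mulr_ge0// expR_ge0.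
- move=> x; apply: cvgM; last exact: ccos.
  apply: (@continuous_comp _ _ _ (fun k : R => - (e * k)) expR); last exact: continuous_expR.
  by apply: cvgN; apply: cvgM; [exact: cvg_cst|exact: cvg_id].
Qed.

(** The case [s = 0] of [integral_dexp_1cos], where the cosine factor is 2. *)
Lemma integral_dexp (e : R) : 0 < e -> (\int[mu]_k (dexp e k)%:E = (2 / e)%:E)%E.
Proof.
move=> e0; have := integral_dexp_1cos 0 e0.
have -> : (\int[mu]_k (dexp e k * (1 + cos (k * 0)))%:E = 2%:E * \int[mu]_k (dexp e k)%:E)%E.
  rewrite -(@ge0_integralZE _ _ _ mu 2 (dexp e))//.
  - by apply: eq_integral => k _; rewrite mulr0 cos0 mulrC.
  - exact: measurable_dexp.
  - by move=> k; exact: dexp_ge0.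
have i0 : (0 <= \int[mu]_k (dexp e k)%:E)%E by apply: integral_ge0E => k; exact: dexp_ge0.
case: (\int[mu]_k _)%E i0 => [r _| |//]; last by rewrite mulry gtr0_sg// mul1e.
rewrite -EFinM => -[h]; congr (_%:E); apply: (@mulfI _ 2) => //.
rewrite h expr0n/= addr0; field; rewrite gt_eqF//.
Qed.

Lemma integrable_dexp (e : R) : 0 < e -> mu.-integrable setT (EFin \o dexp e).
Proof.
move=> e0; apply/integrable_ge0P.
- by move=> k; exact: dexp_ge0.
- exact: measurable_dexp.
- by rewrite integral_dexp// ltry.
Qed.

(** The real part is [integral_dexp_1cos] minus [integral_dexp]; the imaginary part has an odd
    integrand. *)
Lemma cintegral_dexp_cis (e s : R) : 0 < e ->
  cintegral setT (fun k => (dexp e k)%:C * cis (k * s)) = (2 * pi * poisson e s)%:C.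
Proof.
move=> e0; have ie := integrable_dexp e0.
have ms : measurable_fun setT (fun k : R => k * s) by exact: measurable_funM.
have [c1 c2] := cmeasurable_cis ms.
have icos : mu.-integrable setT (EFin \o (fun k => dexp e k * cos (k * s))).
  apply: (@integrable_le _ _ _ mu _ (dexp e)) => //.
  - apply: measurable_funM; first exact: measurable_dexp.
    exact: c1.
  - by move=> k; rewrite normrM ger0_norm ?dexp_ge0// ler_piMr ?dexp_ge0// ler_norml cos_geN1 cos_le1.
have isin : mu.-integrable setT (EFin \o (fun k => dexp e k * sin (k * s))).
  apply: (@integrable_le _ _ _ mu _ (dexp e)) => //.
  - apply: measurable_funM; first exact: measurable_dexp.
    exact: c2.
  - by move=> k; rewrite normrM ger0_norm ?dexp_ge0// ler_piMr ?dexp_ge0// ler_norml sin_geN1 sin_le1.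
have D0 : 0 < e ^+ 2 + s ^+ 2 by rewrite ltr_pwDl ?sqr_ge0// exprn_gt0.
apply: complex_eq => /=.
- rewrite (@eq_Rintegral _ _ _ mu setT (fun k => dexp e k * cos (k * s))); last first.
    by move=> k _; rewrite mul0r subr0.
  have : \int[mu]_k (dexp e k * (1 + cos (k * s))) = 2 * (e^-1 + e / (e ^+ 2 + s ^+ 2)).
    by rewrite /Rintegral integral_dexp_1cos.
  rewrite (@eq_Rintegral _ _ _ mu setT (fun k => dexp e k + dexp e k * cos (k * s))); last first.
    by move=> k _; rewrite mulrDr mulr1.
  rewrite RintegralD// (_ : \int[mu]_k dexp e k = 2 / e); last by rewrite /Rintegral integral_dexp.
  move: (\int[mu]_k (dexp e k * cos (k * s))) => I h.
  have -> : I = 2 * (e^-1 + e / (e ^+ 2 + s ^+ 2)) - 2 / e by rewrite -h; ring.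
  rewrite /poisson; move: pi (pi_gt0 R) => p p0; field; rewrite !gt_eqF//.
- rewrite (@eq_Rintegral _ _ _ mu setT (fun k => dexp e k * sin (k * s))); last first.
    by move=> k _; rewrite mul0r addr0.
  have := integral_opp isin.
  rewrite (@eq_Rintegral _ _ _ mu setT (fun k => -1 * (dexp e k * sin (k * s)))); last first.
    by move=> k _; rewrite dexpN (mulNr k s) sinN; ring.
  by rewrite RintegralZl// => h; lra.
Qed.
End two_sided_exponential.

(** * The transform of integrable functions and its damped inversion *)

Section plancherel.
Context {R : realType}.
Notation mu := (@lebesgue_measure R).
Local Notation re := complex.Re.
Local Notation im := complex.Im.
Local Notation normc := Normc.normc.
Implicit Types f g h : R -> R[i].

(* [ft 1] is the Fourier transform and [ft (-1)] is [2 pi] times its inverse. *)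
Definition ft (s : R) h (k : R) : R[i] := cintegral setT (fun y => h y * cis (s * (k * y))).

Lemma fourierL1E h k : fourierL1 h k = ft 1 h k.
Proof. by rewrite /fourierL1 /ft; apply: eq_cintegral => y; rewrite cexp_im mul1r. Qed.

Lemma cmeasurable_cisM (s k : R) : cmeasurable_fun [set: R] (fun y : R => cis (s * (k * y))).
Proof. by apply: cmeasurable_cis; apply: measurable_funM => //; exact: measurable_funM. Qed.

Lemma cintegrable_ft s h k : cintegrable setT h ->
  cintegrable setT (fun y => h y * cis (s * (k * y))).
Proof.
move=> ih; apply: (@cintegrable_bounded _ _ _ 1) => //; first exact: cmeasurable_cisM.
by move=> x; rewrite normc_cis.
Qed.

Lemma cmeasurable_ft s h : cmeasurable_fun setT h -> cmeasurable_fun setT (ft s h).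
Proof.
move=> mh; apply: (@cmeasurable_cintegral _ _ _ (fun p : R * R => h p.2 * cis (s * (p.1 * p.2)))).
apply: cmeasurableM.
- exact: (cmeasurable_comp mh).
- by apply: cmeasurable_cis; apply: measurable_funM => //; exact: measurable_funM.
Qed.

Lemma ft_bounded s h : cintegrable setT h -> exists2 B : R, 0 <= B &
  forall k, normc (ft s h k) <= B.
Proof.
move=> ih; exists (2 * \int[mu]_x normc (h x)).
  by rewrite mulr_ge0//; apply: Rintegral_ge0 => x _; exact: normc_ge0.
move=> k; apply: normc_cintegral_le; [exact: cintegrable_ft|exact: integrable_normc|].
by move=> x; rewrite Normc.normcM normc_cis mulr1.
Qed.

Lemma ftB s f g k : cintegrable setT f -> cintegrable setT g ->
  ft s (fun x => f x - g x) k = ft s f k - ft s g k.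
Proof.
move=> fi gi; rewrite /ft -cintegralB; [|exact: cintegrable_ft|exact: cintegrable_ft].
by apply: eq_cintegral => y; rewrite mulrBl.
Qed.

(** Componentwise, so that the real convergence result applies to each part. *)
Definition poisson_convC (e : R) h (x : R) : R[i] :=
  poisson_conv e (fun y => re (h y)) x +i* poisson_conv e (fun y => im (h y)) x.

Lemma poisson_convCE (e : R) h x : cintegral setT (fun l => (poisson e (l - x))%:C * h l) =
  poisson_convC e h x.
Proof.
apply: complex_eq => /=; apply: eq_Rintegral => l _; rewrite ?reM ?imM /=.
- by rewrite mul0r subr0.
- by rewrite mul0r addr0.
Qed.

Lemma cmeasurable_poisson_convC e h : 0 < e -> cmeasurable_fun setT h ->
  cmeasurable_fun setT (poisson_convC e h).
Proof.
move=> e0 mh.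
rewrite (_ : poisson_convC e h = fun x => cintegral setT (fun l => (poisson e (l - x))%:C * h l));
  last by apply/funext => x; rewrite poisson_convCE.
apply: (@cmeasurable_cintegral _ _ _ (fun p : R * R => (poisson e (p.2 - p.1))%:C * h p.2)).
apply: cmeasurableM; last exact: (cmeasurable_comp mh).
apply: cmeasurable_real; apply: (measurableT_comp (measurable_poisson e0)).
exact: measurable_funB.
Qed.

Lemma poisson_convC_cvg h : cmeasurable_fun setT h -> (N2 h < +oo)%E ->
  N2 (fun x => poisson_convC n.+1%:R^-1 h x - h x) @[n --> \oo] --> 0%E.
Proof.
move=> mh hoo; have [m1 m2] := mh.
have c1 := poisson_conv_cvg m1 (le_lt_trans (re_le_N2 mh) hoo).
have c2 := poisson_conv_cvg m2 (le_lt_trans (im_le_N2 mh) hoo).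
rewrite (_ : (fun _ => _) = fun n =>
  (\int[mu]_x ((poisson_conv n.+1%:R^-1 (fun y => re (h y)) x - re (h x)) ^+ 2)%:E +
   \int[mu]_x ((poisson_conv n.+1%:R^-1 (fun y => im (h y)) x - im (h x)) ^+ 2)%:E)%E).
  by rewrite -[0%E in X in _ --> X]adde0; apply: cvgeD.
apply/funext => n; rewrite N2E; last by apply: cmeasurableB => //; exact: cmeasurable_poisson_convC.
by congr (_ + _)%E; apply: eq_integral => x _; rewrite ?reD ?imD ?reN ?imN.
Qed.

Lemma normc_dexp (e k : R) : normc (dexp e k)%:C = dexp e k.
Proof. by rewrite normcC ger0_norm// dexp_ge0. Qed.

(* Damping the frequencies by [dexp e] amounts to averaging against the Poisson kernel. *)
Lemma ft_damped (s e : R) h x : s ^+ 2 = 1 -> 0 < e -> cintegrable setT h ->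
  cintegral setT (fun k => ft s h k * (dexp e k)%:C * cis (- (s * (k * x)))) =
  (2 * pi)%:C * poisson_convC e h x.
Proof.
move=> s2 e0 ih; have mh := cintegrable_measurable ih.
(* The two characters merged into one: integrating [K] over the frequency first produces the Poisson
   kernel at [s * (y - x)], which depends on [s] only through [s ^+ 2 = 1]. *)
pose K (p : R * R) := h p.2 * ((dexp e p.1)%:C * cis (p.1 * (s * (p.2 - x)))).
have K2 : cintegrable2 K.
  apply: (@cintegrable2_prod _ _ (dexp e) (fun y => normc (h y))).
  - apply: cmeasurableM; first exact: (cmeasurable_comp mh).
    apply: cmeasurableM.
      by apply: cmeasurable_real; apply: (measurableT_comp (measurable_dexp e)).
    apply: cmeasurable_cis; apply: measurable_funM => //; apply: measurable_funM => //.
    exact: measurable_funB.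
  - exact: integrable_dexp.
  - exact: integrable_normc.
  - by move=> k y; rewrite /K/= !Normc.normcM normc_dexp normc_cis mulr1 mulrC.
transitivity (cintegral setT (fun k => cintegral setT (fun y => K (k, y)))).
  apply: eq_cintegral => k; rewrite -mulrA /ft -cintegralZr//; last exact: cintegrable_ft.
  apply: eq_cintegral => y; rewrite /K /= -mulrA; congr (_ * _).
  by rewrite mulrCA -cisD; congr (_ * cis _); ring.
rewrite cfubini// -poisson_convCE -cintegralZ; last first.
  apply: (@cintegrable_le _ _ (fun l => (pi * e)^-1 * normc (h l))).
  - by apply: cmeasurableM => //; apply: cmeasurable_real; exact: measurable_poisson_sub.
  - by apply: integrableZE; exact: integrable_normc.
  - move=> l; rewrite normc_scale ?poisson_ge0// ler_wpM2r ?normc_ge0//.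
    exact: poisson_le.
apply: eq_cintegral => y; rewrite /K /= cintegralZ; last first.
  apply: (@cintegrable_le _ _ (dexp e)) => //.
  - apply: cmeasurableM; first by apply: cmeasurable_real; exact: measurable_dexp.
    by apply: cmeasurable_cis; exact: measurable_funM.
  - exact: integrable_dexp.
  - by move=> k; rewrite Normc.normcM normc_dexp normc_cis mulr1.
rewrite cintegral_dexp_cis// mulrC mulrA -rmorphM/=; congr (_%:C * _).
by rewrite /poisson exprMn s2 mul1r.
Qed.

End plancherel.

Section plancherel_theorem.
Context {R : realType}.
Notation mu := (@lebesgue_measure R).
Local Notation re := complex.Re.
Local Notation im := complex.Im.
Local Notation normc := Normc.normc.
Implicit Types f g h : R -> R[i].

Lemma conjcM (z w : R[i]) : (z * w)^*%C = z^*%C * w^*%C.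
Proof. by apply: complex_eq; rewrite ?reM ?imM !(re_conj, im_conj) ?reM ?imM; ring. Qed.

Lemma conj_ft s h k : cintegrable setT h ->
  (ft s h k)^*%C = cintegral setT (fun x => (h x)^*%C * cis (- (s * (k * x)))).
Proof.
move=> ih; rewrite /ft -cintegral_conj; last exact: cintegrable_ft.
by apply: eq_cintegral => y; rewrite conjcM conj_cis.
Qed.

(** Write the squared modulus as the transform times the conjugate of its defining integral and
    exchange the integrals; the inner one is then [ft_damped]. The damping is what makes the double
    integral absolutely convergent. *)
Lemma plancherel_damped (s e : R) h : s ^+ 2 = 1 -> 0 < e -> cintegrable setT h ->
  \int[mu]_k (nsq (ft s h k) * dexp e k) =
  2 * pi * re (cintegral setT (fun x => (h x)^*%C * poisson_convC e h x)).
Proof.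
move=> s2 e0 ih; have mh := cintegrable_measurable ih.
have mft := cmeasurable_ft s mh.
have [B B0 hB] := ft_bounded s ih.
pose K (p : R * R) := ft s h p.1 * (dexp e p.1)%:C * ((h p.2)^*%C * cis (- (s * (p.1 * p.2)))).
have K2 : cintegrable2 K.
  apply: (@cintegrable2_prod _ _ (fun k => B * dexp e k) (fun y => normc (h y))).
  - apply: cmeasurableM.
      apply: cmeasurableM; first exact: (cmeasurable_comp mft).
      by apply: cmeasurable_real; apply: (measurableT_comp (measurable_dexp e)).
    apply: cmeasurableM; first exact: (cmeasurable_comp (cmeasurable_conj mh)).
    apply: cmeasurable_cis; apply: measurableT_comp => //; apply: measurable_funM => //.
    exact: measurable_funM.
  - by apply: integrableZE; exact: integrable_dexp.
  - exact: integrable_normc.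
  - move=> k y; rewrite /K/= !Normc.normcM normc_dexp normc_cis mulr1 normc_conj.
    by rewrite ler_wpM2r ?normc_ge0// ler_wpM2r ?dexp_ge0.
have E1 : cintegral setT (fun k => cintegral setT (fun y => K (k, y))) =
    (\int[mu]_k (nsq (ft s h k) * dexp e k))%:C.
  rewrite -cintegral_real; apply: eq_cintegral => k; rewrite /K/= cintegralZ.
    by rewrite -conj_ft// mulrAC mul_conj -rmorphM.
  apply: (@cintegrable_le _ _ (fun y => normc (h y))).
  - apply: cmeasurableM; first exact: cmeasurable_conj.
    by apply: cmeasurable_cis; apply: measurableT_comp => //; apply: measurable_funM => //; exact: measurable_funM.
  - exact: integrable_normc.
  - by move=> y; rewrite Normc.normcM normc_cis mulr1 normc_conj.
have E2 : cintegral setT (fun y => cintegral setT (fun k => K (k, y))) =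
    cintegral setT (fun x => (2 * pi)%:C * ((h x)^*%C * poisson_convC e h x)).
  apply: eq_cintegral => x; rewrite mulrCA -(@ft_damped _ s)// -cintegralZ.
    by apply: eq_cintegral => k; rewrite /K /= [RHS]mulrCA.
  apply: (@cintegrable_le _ _ (fun k => B * dexp e k)).
  - apply: cmeasurableM; first apply: cmeasurableM => //.
      by apply: cmeasurable_real; exact: measurable_dexp.
    by apply: cmeasurable_cis; apply: measurableT_comp => //; apply: measurable_funM => //; exact: measurable_funM.
  - by apply: integrableZE; exact: integrable_dexp.
  - by move=> k; rewrite !Normc.normcM normc_dexp normc_cis mulr1 ler_wpM2r ?dexp_ge0.
have := E1; rewrite cfubini// E2 => E3.
rewrite -[LHS]/(re ((_)%:C)) -E3.
rewrite cintegralZ; first by rewrite reM /= mul0r subr0.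
apply: (@cintegrable_le _ _ (fun x => (2 * (pi * e)^-1 * \int[mu]_y normc (h y)) * normc (h x))).
- by apply: cmeasurableM; [exact: cmeasurable_conj|exact: cmeasurable_poisson_convC].
- by apply: integrableZE; exact: integrable_normc.
- move=> x; rewrite Normc.normcM normc_conj mulrC ler_wpM2r ?normc_ge0//.
  rewrite -poisson_convCE -mulrA -RintegralZl//; last exact: integrable_normc.
  apply: normc_cintegral_le.
  + apply: (@cintegrable_le _ _ (fun l => (pi * e)^-1 * normc (h l))).
    * by apply: cmeasurableM => //; apply: cmeasurable_real; exact: measurable_poisson_sub.
    * by apply: integrableZE; exact: integrable_normc.
    * by move=> l; rewrite normc_scale ?poisson_ge0// ler_wpM2r ?normc_ge0// poisson_le.
  + by apply: integrableZE; exact: integrable_normc.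
  + by move=> l; rewrite normc_scale ?poisson_ge0// ler_wpM2r ?normc_ge0// poisson_le.
Qed.

Lemma dexp_cvg1 (k : R) : dexp n.+1%:R^-1 k @[n --> \oo] --> (1 : R).
Proof.
have h : (- (n.+1%:R^-1 * `|k|)) @[n --> \oo] --> (0 : R).
  rewrite -oppr0; apply: cvgN; rewrite -[0 in X in _ --> X](mul0r `|k|).
  by apply: cvgM; [exact: cvg_harmonic|exact: cvg_cst].
rewrite /dexp -[X in _ --> X]expR0; exact: (cvg_comp _ _ h (@continuous_expR R 0)).
Qed.

(** Let the damping tend to 1 in [plancherel_damped]. The left side converges by monotone
    convergence, which presupposes no finiteness of [N2 (ft s h)]; the right side converges because
    Poisson averages tend to [h] in L^2. *)
Theorem plancherel (s : R) h : s ^+ 2 = 1 -> cintegrable setT h -> (N2 h < +oo)%E ->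
  N2 (ft s h) = ((2 * pi)%:E * N2 h)%E.
Proof.
move=> s2 ih hoo; have mh := cintegrable_measurable ih.
have mft := cmeasurable_ft s mh.
pose e (n : nat) : R := n.+1%:R^-1.
have e0 n : 0 < e n by rewrite invr_gt0.
have [B B0 hB] := ft_bounded s ih.
have c1 : (\int[mu]_k (nsq (ft s h k) * dexp (e n) k)%:E)%E @[n --> \oo] --> N2 (ft s h).
  have mg n : measurable_fun setT (fun k => (nsq (ft s h k) * dexp (e n) k)%:E).
    apply/measurable_EFinP; apply: measurable_funM; first exact: measurable_nsq.
    exact: measurable_dexp.
  have g0 n (x : R) : setT x -> (0 <= (nsq (ft s h x) * dexp (e n) x)%:E)%E.
    by move=> _; rewrite lee_fin mulr_ge0 ?nsq_ge0 ?dexp_ge0.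
  have nd (x : R) : setT x -> nondecreasing_seq (fun n => (nsq (ft s h x) * dexp (e n) x)%:E).
    move=> _ n m nm; rewrite lee_fin ler_wpM2l ?nsq_ge0// ler_expR lerN2 ler_wpM2r//.
    by rewrite lef_pV2 ?posrE// ler_nat.
  have := @cvg_monotone_convergence _ _ _ mu setT measurableT _ mg g0 nd.
  rewrite (_ : (\int[mu]_x limn _ = N2 (ft s h))%E)//.
  apply: eq_integral => x _; apply/cvg_lim => //; apply: cvg_EFin; first exact: nearW.
  rewrite -[X in _ --> X]mulr1; apply: cvgM; first exact: cvg_cst.
  exact: dexp_cvg1.
have c2 : (2 * pi * re (cintegral setT (fun x => (h x)^*%C * poisson_convC (e n) h x)))
    @[n --> \oo] --> 2 * pi * \int[mu]_x nsq (h x).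
  apply: cvgM; first exact: cvg_cst.
  have mc := cmeasurable_conj mh.
  have coo : (N2 (fun x => (h x)^*%C) < +oo)%E by rewrite (eq_N2 (g := h))// => x; rewrite nsq_conj.
  have mpc n : cmeasurable_fun setT (poisson_convC (e n) h) by exact: cmeasurable_poisson_convC.
  have mg n : cmeasurable_fun setT (fun x => poisson_convC (e n) h x - h x) by exact: cmeasurableB.
  have cv := poisson_convC_cvg mh hoo.
  have [r0 _] := cintegral_mulL2_cvg0 mc mg coo cv.
  have r1 : (\int[mu]_x nsq (h x) + re (cintegral setT (fun x => (h x)^*%C * (poisson_convC (e n) h x - h x))))
      @[n --> \oo] --> \int[mu]_x nsq (h x).
    by rewrite -[X in _ --> X]addr0; apply: cvgD => //; exact: cvg_cst.
  apply: (near_eq_cvgn _ r1).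
  have /(ge0_ecvg0P (fun n => N2_ge0 _))/(_ 1 ltr01) := cv.
  apply: filterS => n un1.
  have un : (N2 (fun x => (poisson_convC (e n) h x - h x)%R) < +oo)%E by rewrite (le_lt_trans un1)// ltry.
  have -> : \int[mu]_x nsq (h x) = re (cintegral setT (fun x => (h x)^*%C * h x)).
    by rewrite /=; apply: eq_Rintegral => x _; rewrite mulrC mul_conj.
  rewrite -reD -cintegralD; [|exact: cintegrable_mulL2|exact: cintegrable_mulL2].
  by congr re; apply: eq_cintegral => x; rewrite -mulrDr addrC subrK.
have E n : (\int[mu]_k (nsq (ft s h k) * dexp (e n) k)%:E)%E =
    (2 * pi * re (cintegral setT (fun x => (h x)^*%C * poisson_convC (e n) h x)))%:E.
  rewrite -(plancherel_damped s2)// EFin_Rintegral//.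
  apply: (@integrable_le _ _ _ mu _ (fun k => B ^+ 2 * dexp (e n) k)).
  - apply: measurable_funM; first exact: measurable_nsq.
    exact: measurable_dexp.
  - by apply: integrableZE; exact: integrable_dexp.
  - move=> k; rewrite ger0_norm; last by rewrite mulr_ge0 ?nsq_ge0 ?dexp_ge0.
    by rewrite ler_wpM2r ?dexp_ge0// -normc_le.
have : N2 (ft s h) = (2 * pi * \int[mu]_x nsq (h x))%:E.
  have c3 : (\int[mu]_k (nsq (ft s h k) * dexp (e n) k)%:E)%E @[n --> \oo] -->
      (2 * pi * \int[mu]_x nsq (h x))%:E.
    under eq_fun do rewrite E.
    by apply: cvg_EFin => //; exact: nearW.
  exact: (cvg_unique _ c1 c3).
by rewrite EFinM EFin_Rintegral//; exact: integrable_nsq.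
Qed.

End plancherel_theorem.

(** * The Fourier transform on L^2 *)

Section fourier_L2.
Context {R : realType}.
Notation mu := (@lebesgue_measure R).
Local Notation re := complex.Re.
Local Notation im := complex.Im.
Local Notation normc := Normc.normc.
Implicit Types f g h : R -> R[i].

(* [is_fourierL2] with [L2norm] replaced by its square. *)
Definition fourierN2 h (H : R -> R[i]) : Prop :=
  [/\ cmeasurable_fun setT h, (N2 h < +oo)%E, cmeasurable_fun setT H, (N2 H < +oo)%E &
    exists hn : nat -> R -> R[i],
      [/\ forall n, cintegrable setT (hn n) /\ (N2 (hn n) < +oo)%E,
          N2 (fun x => hn n x - h x) @[n --> \oo] --> 0%E &
          N2 (fun k => ft 1 (hn n) k - H k) @[n --> \oo] --> 0%E]].

Lemma fourierN2_is_fourierL2 h H : fourierN2 h H -> is_fourierL2 h H.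
Proof.
move=> [mh hoo mH Hoo [hn [ihn c1 c2]]]; split; [exact/inL2P|exact/inL2P|].
exists hn; split.
- move=> n; have [i1 i2] := ihn n; split => //; apply/inL2P; split => //.
  exact: cintegrable_measurable.
- exact: L2norm_cvg0.
- apply: (@L2norm_cvg0 _ (fun n k => fourierL1 (hn n) k - H k)).
  have E : (fun n => N2 (fun k => fourierL1 (hn n) k - H k)) =
      (fun n => N2 (fun k => ft 1 (hn n) k - H k)).
    by apply/funext => n; apply: eq_N2 => k; rewrite fourierL1E.
  by rewrite E.
Qed.

Definition inv_ft (H : R -> R[i]) (x : R) : R[i] := ((2 * pi)^-1)%:C * ft (-1) H x.

Lemma pi2_gt0 : 0 < 2 * pi :> R. Proof. by rewrite mulr_gt0// pi_gt0. Qed.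

Lemma cmeasurable_inv_ft H : cmeasurable_fun setT H -> cmeasurable_fun setT (inv_ft H).
Proof.
by move=> mH; apply: cmeasurableM; [exact: cmeasurable_cst|exact: cmeasurable_ft].
Qed.

Lemma N2_inv_ft H : cintegrable setT H -> (N2 H < +oo)%E -> (N2 (inv_ft H) < +oo)%E.
Proof.
move=> iH Hoo; rewrite N2Z; last by apply: cmeasurable_ft; exact: cintegrable_measurable.
rewrite plancherel ?sqrrN ?expr1n// muleA -EFinM.
by rewrite lte_mul_pinfty// lee_fin mulr_ge0 ?sqr_ge0// ltW// pi2_gt0.
Qed.

(** [inv_ft H] is bounded and in L^2 but perhaps not integrable; times [dexp] it becomes integrable.
    By [ft_damped] with [s = -1] the transform of this product is the Poisson average of [H], which
    tends to [H]. *)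
Theorem fourier_inv_ft H : cintegrable setT H -> (N2 H < +oo)%E -> fourierN2 (inv_ft H) H.
Proof.
move=> iH Hoo; have mH := cintegrable_measurable iH.
have mi := cmeasurable_inv_ft mH; have ioo := N2_inv_ft iH Hoo.
split => //.
pose e (n : nat) : R := n.+1%:R^-1.
have e0 n : 0 < e n by rewrite invr_gt0.
have [B B0 hB] := ft_bounded (-1) iH.
have iftd n k : cintegrable setT (fun x => ft (-1) H x * (dexp (e n) x)%:C * cis (- (-1 * (x * k)))).
  apply: (@cintegrable_le _ _ (fun k => B * dexp (e n) k)).
  - apply: cmeasurableM; first apply: cmeasurableM.
    + exact: cmeasurable_ft.
    + by apply: cmeasurable_real; exact: measurable_dexp.
    + by apply: cmeasurable_cis; apply: measurableT_comp => //; apply: measurable_funM => //; exact: measurable_funM.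
  - by apply: integrableZE; exact: integrable_dexp.
  - by move=> x; rewrite !Normc.normcM normc_dexp normc_cis mulr1 ler_wpM2r ?dexp_ge0.
exists (fun n x => inv_ft H x * (dexp (e n) x)%:C); split.
- move=> n; split.
    (* At [k = 0] the character in [iftd] is 1. *)
    have := cintegrableZ ((2 * pi)^-1)%:C (iftd n 0).
    congr cintegrable; apply/funext => x.
    by rewrite mulr0 mulr0 oppr0 cis0 mulr1 mulrA.
  apply: le_lt_trans ioo; apply: N2_le => //.
    by apply: cmeasurableM => //; apply: cmeasurable_real; exact: measurable_dexp.
  move=> x; rewrite nsqM nsqC ler_piMr ?nsq_ge0// expr_le1// ?dexp_ge0//.
  by apply: dexp_le1; exact: ltW.
- apply: N2_damped_cvg0 => //.
  + by move=> n; exact: measurable_dexp.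
  + by move=> n x; rewrite dexp_ge0 dexp_le1// ltW.
  + exact: dexp_cvg1.
- suff E : (fun n => N2 (fun k => ft 1 (fun x => inv_ft H x * (dexp (e n) x)%:C) k - H k)) =
      (fun n => N2 (fun k => poisson_convC (e n) H k - H k)).
    by rewrite E; exact: poisson_convC_cvg.
  apply/funext => n; apply: eq_N2 => k; congr (nsq (_ - _)).
  have s2 : (-1) ^+ 2 = 1 :> R by rewrite sqrrN expr1n.
  rewrite -[RHS]mul1r -[X in _ = X * _](_ : ((2 * pi)^-1)%:C * (2 * pi)%:C = 1 :> R[i]); last first.
    by rewrite -rmorphM/= mulVf// gt_eqF// pi2_gt0.
  rewrite -mulrA -(ft_damped k s2 (e0 n) iH) -cintegralZ//.
  apply: eq_cintegral => x; rewrite /inv_ft -!mulrA; congr (_ * (_ * (_ * cis _))).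
  by ring.
Qed.

(** For the integrable approximants [hn] of [h] this is Fubini. Both sides pass to the limit as L^2
    pairings, since [ft 1 P] is in L^2 by Plancherel's identity. *)
Theorem ft_multiplication (P h H : R -> R[i]) : cintegrable setT P -> (N2 P < +oo)%E ->
  fourierN2 h H ->
  cintegral setT (fun y => ft 1 P y * h y) = cintegral setT (fun k => P k * H k).
Proof.
move=> iP Poo [mh hoo mH Hoo [hn [ihn c1 c2]]].
have mP := cintegrable_measurable iP; have mfP := cmeasurable_ft 1 mP.
have fPoo : (N2 (ft 1 P) < +oo)%E.
  by rewrite plancherel ?expr1n// lte_mul_pinfty// lee_fin ltW// pi2_gt0.
have mhn n : cmeasurable_fun setT (hn n) by apply: cintegrable_measurable; case: (ihn n).
have mfhn n : cmeasurable_fun setT (ft 1 (hn n)) by exact: cmeasurable_ft.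
have hnoo n : (N2 (hn n) < +oo)%E by case: (ihn n).
have fhnoo n : (N2 (ft 1 (hn n)) < +oo)%E.
  rewrite plancherel ?expr1n//; last by case: (ihn n).
  by rewrite lte_mul_pinfty// lee_fin ltW// pi2_gt0.
have En n : cintegral setT (fun y => ft 1 P y * hn n y) = cintegral setT (fun k => P k * ft 1 (hn n) k).
  have [ih _] := ihn n.
  pose K (p : R * R) := P p.2 * cis (1 * (p.1 * p.2)) * hn n p.1.
  have K2 : cintegrable2 K.
    apply: (@cintegrable2_prod _ _ (fun y => normc (hn n y)) (fun y => normc (P y))).
    - apply: cmeasurableM; first apply: cmeasurableM.
      + exact: (cmeasurable_comp mP).
      + by apply: cmeasurable_cis; apply: measurable_funM => //; exact: measurable_funM.
      + exact: (cmeasurable_comp (mhn n)).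
    - exact: integrable_normc.
    - exact: integrable_normc.
    - by move=> y k; rewrite /K /= !Normc.normcM normc_cis mulr1 mulrC.
  transitivity (cintegral setT (fun y => cintegral setT (fun k => K (y, k)))).
    by apply: eq_cintegral => y; rewrite /ft -cintegralZr//; exact: cintegrable_ft.
  rewrite cfubini//; apply: eq_cintegral => k.
  rewrite /ft -cintegralZ; last exact: cintegrable_ft.
  by apply: eq_cintegral => y; rewrite /K /= -mulrA mulrA [P k * _]mulrC [X in cis (1 * X)]mulrC; ring.
(* The left side does not depend on [n], while the right side consists of two pairings that tend to
   0. *)
have diff n : cintegral setT (fun y => ft 1 P y * h y) - cintegral setT (fun k => P k * H k) =
   cintegral setT (fun k => P k * (ft 1 (hn n) k - H k)) - cintegral setT (fun y => ft 1 P y * (hn n y - h y)).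
  under [X in _ = X - _]eq_cintegral do rewrite mulrBr.
  under [X in _ = _ - X]eq_cintegral do rewrite mulrBr.
  have i1 := cintegrable_mulL2 mP (mfhn n) Poo (fhnoo n).
  have i2 := cintegrable_mulL2 mP mH Poo Hoo.
  have i3 := cintegrable_mulL2 mfP (mhn n) fPoo (hnoo n).
  have i4 := cintegrable_mulL2 mfP mh fPoo hoo.
  rewrite (cintegralB i1 i2) (cintegralB i3 i4) -En; ring.
have [r1 i1] := cintegral_mulL2_cvg0 mfP (fun n => cmeasurableB (mhn n) mh) fPoo c1.
have [r2 i2] := cintegral_mulL2_cvg0 mP (fun n => cmeasurableB (mfhn n) mH) Poo c2.
apply/eqP; rewrite -subr_eq0; apply/eqP; apply: complex_eq => /=.
- have h0 : (re (cintegral setT (fun k => P k * (ft 1 (hn n) k - H k))) -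
    re (cintegral setT (fun y => ft 1 P y * (hn n y - h y)))) @[n --> \oo] --> (0 : R).
    by rewrite -[0 in X in _ --> X]subr0; exact: cvgB.
  have hc : (fun n : nat => re (cintegral setT (fun y => ft 1 P y * h y) - cintegral setT (fun k => P k * H k)))
     @ \oo --> (0 : R).
    by apply: (near_eq_cvgn _ h0); apply: nearW => n; rewrite (diff n) reD reN.
  exact: (cvg_unique _ (cvg_cst _) hc).
- have h0 : (im (cintegral setT (fun k => P k * (ft 1 (hn n) k - H k))) -
    im (cintegral setT (fun y => ft 1 P y * (hn n y - h y)))) @[n --> \oo] --> (0 : R).
    by rewrite -[0 in X in _ --> X]subr0; exact: cvgB.
  have hc : (fun n : nat => im (cintegral setT (fun y => ft 1 P y * h y) - cintegral setT (fun k => P k * H k)))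
     @ \oo --> (0 : R).
    by apply: (near_eq_cvgn _ h0); apply: nearW => n; rewrite (diff n) imD imN.
  exact: (cvg_unique _ (cvg_cst _) hc).
Qed.

(** The reflection [- y] turns the inverse transform into a forward one and the shift by [x] becomes
    a modulation of [P]: this is the form that [ft_multiplication] accepts. *)
Lemma inv_ft_sub (P : R -> R[i]) (x y : R) :
  inv_ft P (x - y) = ((2 * pi)^-1)%:C * ft 1 (fun k => P k * cis (-1 * (x * k))) y.
Proof.
rewrite /inv_ft; congr (_ * _); apply: eq_cintegral => k.
by rewrite -mulrA -cisD; congr (_ * cis _); ring.
Qed.

(** Valid at every [x], not just almost everywhere: modulating [P] changes neither its integrability
    nor its norm, and both pairings are between L^2 functions. *)
Theorem inv_ft_conv (P h H : R -> R[i]) (x : R) : cintegrable setT P -> (N2 P < +oo)%E ->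
  fourierN2 h H ->
  cintegrable setT (fun y => inv_ft P (x - y) * h y) /\
  cintegral setT (fun y => inv_ft P (x - y) * h y) = inv_ft (fun k => P k * H k) x.
Proof.
move=> iP Poo hH; pose Q k := P k * cis (-1 * (x * k)).
have iQ : cintegrable setT Q by exact: cintegrable_ft.
have Qoo : (N2 Q < +oo)%E.
  by rewrite (eq_N2 (g := P))// => k; rewrite nsqM nsq_cis mulr1.
have mQ := cintegrable_measurable iQ.
have [mh hoo _ _ _] := hH.
have i1 : cintegrable setT (fun y => ft 1 Q y * h y).
  apply: (cintegrable_mulL2 (cmeasurable_ft 1 mQ) mh _ hoo).
  by rewrite plancherel ?expr1n// lte_mul_pinfty// lee_fin ltW// pi2_gt0.
have E : (fun y => inv_ft P (x - y) * h y) = (fun y => ((2 * pi)^-1)%:C * (ft 1 Q y * h y)).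
  by apply/funext => y; rewrite inv_ft_sub mulrA.
rewrite E; split; first exact: cintegrableZ.
rewrite cintegralZ// (ft_multiplication iQ Qoo hH) /inv_ft; congr (_ * _).
by apply: eq_cintegral => k; rewrite /Q mulrAC.
Qed.

End fourier_L2.

(** * Existence of the transform of a real L^2 function *)

Section fourier_existence.
Context {R : realType}.
Notation mu := (@lebesgue_measure R).
Local Notation re := complex.Re.
Local Notation im := complex.Im.

Lemma rf_rate_gt0 n : 0 < rf_rate n :> R.
Proof. by rewrite invr_gt0 mulr_gt0 ?exprn_gt0// ltr0n expn_gt0. Qed.

Lemma rf_rate_le n m : (n <= m)%N -> rf_rate m <= rf_rate n :> R.
Proof.
move=> nm; rewrite lef_pV2 ?posrE ?mulr_gt0 ?exprn_gt0 ?ltr0n ?expn_gt0//.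
apply: ler_pM; rewrite ?exprn_ge0 ?ler0n//.
- by rewrite ler_eXn2l// ltr1n.
- by rewrite ler_nat leq_exp2l.
Qed.

Lemma rf_rate_cvg0 : rf_rate n @[n --> \oo] --> (0 : R).
Proof.
apply/cvgr0Pnorm_le => e e0.
have := near_infty_natSinv_lt (PosNum e0).
apply: filterS => n /= /ltW; apply: le_trans.
rewrite (ger0_norm (ltW (rf_rate_gt0 n))) lef_pV2 ?posrE ?mulr_gt0 ?exprn_gt0 ?ltr0n ?expn_gt0//.
rewrite -[leLHS]mul1r; apply: ler_pM => //.
- by rewrite exprn_ege1// ler1n.
- by rewrite ler_nat ltnW// ltn_expl.
Qed.

(** Truncations of [f] to segments are in L^1 /\ L^2. Along a fast subsequence Plancherel's identity
    gives their transforms the rate that [riesz_fischer] requires, applied to real and imaginary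
    parts. *)
Theorem fourierN2_exists (f : R -> R) : measurable_fun setT f ->
  (\int[mu]_x (f x ^+ 2)%:E < +oo)%E -> exists H, fourierN2 (fun x => (f x)%:C) H.
Proof.
move=> mf foo.
pose D (n : nat) : set R := `[- n%:R, n%:R]%classic.
have mD n : measurable (D n) by exact: measurable_itv.
have Dx x : \forall n \near \oo, D n x.
  near=> n; rewrite /D /= in_itv/= -ler_norml; near: n; exact: nbhs_infty_ger.
have trunc := truncation_L2 mf foo mD Dx.
pose err n := (\int[mu]_x ((f x - f x * \1_(D n) x) ^+ 2)%:E)%E.
have err0 n : (0 <= err n)%E by apply: integral_ge0E => x; exact: sqr_ge0.
(* Two approximants are within [4 * del n] in squared norm, and Plancherel's identity multiplies
   this by [2 * pi]. *)
pose del n : R := rf_rate n / (8 * pi).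
have del0 n : 0 < del n by rewrite divr_gt0 ?rf_rate_gt0// mulr_gt0// pi_gt0.
have /choice[r hr] : forall n, exists m, (err m <= (del n)%:E)%E.
  move=> n; by have /(ge0_ecvg0P err0)/(_ _ (del0 n))[m _ /(_ m (leqnn _))] := trunc; exists m.
pose g n x := f x * \1_(D (r n)) x.
have mg n : measurable_fun setT (g n) by exact: measurable_funM.
have mgC n : cmeasurable_fun setT (fun x => (g n x)%:C) by exact: cmeasurable_real.
have mfC : cmeasurable_fun setT (fun x => (f x)%:C) by exact: cmeasurable_real.
have N2f : N2 (fun x => (f x)%:C) = (\int[mu]_x (f x ^+ 2)%:E)%E.
  by apply: eq_integral => x _; rewrite nsqC.
have fCoo : (N2 (fun x => (f x)%:C) < +oo)%E by rewrite N2f.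
have g_le n x : nsq ((g n x)%:C) <= nsq ((f x)%:C).
  rewrite !nsqC /g indicE; case: (_ \in _); rewrite ?mulr1 ?mulr0//.
  by rewrite expr0n/= sqr_ge0.
have gCoo n : (N2 (fun x => (g n x)%:C) < +oo)%E.
  by rewrite (le_lt_trans _ fCoo)//; exact: N2_le.
have N2gf n : (N2 (fun x => (g n x)%:C - (f x)%:C)%R <= (del n)%:E)%E.
  apply: le_trans (hr n); rewrite le_eqVlt; apply/orP; left; apply/eqP.
  by apply: eq_integral => x _; rewrite -rmorphB nsqC -sqrrN opprB.
have ig n : cintegrable setT (fun x => (g n x)%:C).
  apply: (@cintegrable_le _ _ (fun x => \1_(D (r n)) x + f x ^+ 2)) => //.
  - apply: integrableDE.
      by apply: (@integrable_indic_itv R).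
    by apply/integrable_ge0P => //; [move=> x; exact: sqr_ge0|exact: measurable_funX].
  - move=> x; rewrite normcC /g indicE; case: (_ \in _); rewrite ?mulr1 ?mulr0 ?normr0 ?add0r ?sqr_ge0//.
    rewrite -(real_normK (num_real (f x))); move: (`|f x|) => p.
    by have := sqr_ge0 (p - 2^-1); rewrite /=; lra.
pose F n := ft 1 (fun x => (g n x)%:C).
have mF n : cmeasurable_fun setT (F n) by exact: cmeasurable_ft.
have Fdiff n m : (n <= m)%N -> (N2 (fun k => (F m k - F n k)%R) <= (rf_rate n)%:E)%E.
  move=> nm.
  have -> : N2 (fun k => F m k - F n k) = N2 (ft 1 (fun x => (g m x)%:C - (g n x)%:C)).
    by apply: eq_N2 => k; rewrite ftB.
  have idiff : cintegrable setT (fun x => (g m x)%:C - (g n x)%:C).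
    by under eq_fun do rewrite -mulN1r; apply: cintegrableD => //; exact: cintegrableZ.
  have bound : (N2 (fun x => ((g m x)%:C - (g n x)%:C)%R) <= (4 * del n)%:E)%E.
    have -> : N2 (fun x => (g m x)%:C - (g n x)%:C) =
        N2 (fun x => ((g m x)%:C - (f x)%:C) + (-1) * ((g n x)%:C - (f x)%:C)).
      by apply: eq_N2 => x; congr nsq; ring.
    have m1 := cmeasurableB (mgC m) mfC; have m2 := cmeasurableB (mgC n) mfC.
    have m3 : cmeasurable_fun setT (fun x => -1 * ((g n x)%:C - (f x)%:C)).
      by apply: cmeasurableM => //; exact: cmeasurable_cst.
    apply: (le_trans (N2D_le m1 m3)).
    have -> : N2 (fun x => -1 * ((g n x)%:C - (f x)%:C)) = N2 (fun x => ((g n x)%:C - (f x)%:C)).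
      by apply: eq_N2 => x; rewrite mulN1r /nsq reN imN !sqrrN.
    have two : (0 <= 2%:E :> \bar R)%E by rewrite lee_fin.
    apply: (le_trans (leeD (lee_wpmul2l two (N2gf m)) (lee_wpmul2l two (N2gf n)))).
    rewrite -!EFinM -EFinD lee_fin.
    have : del m <= del n by rewrite ler_pM2r ?rf_rate_le// invr_gt0 mulr_gt0// pi_gt0.
    lra.
  rewrite plancherel ?expr1n//; last by rewrite (le_lt_trans bound)// ltry.
  have pi2 : (0 <= (2 * pi)%:E :> \bar R)%E by rewrite lee_fin ltW// pi2_gt0.
  apply: (le_trans (lee_wpmul2l pi2 bound)); rewrite -EFinM lee_fin /del.
  by move: pi (pi_gt0 R) => p p0; rewrite le_eqVlt; apply/orP; left; apply/eqP; field; rewrite gt_eqF.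
have [A [mA hA]] : exists A : R -> R, measurable_fun setT A /\
    forall n, (\int[mu]_x ((re (F n x) - A x) ^+ 2)%:E <= (rf_rate n)%:E)%E.
  apply: riesz_fischer => [n|n m nm]; first by case: (mF n).
  apply: le_trans (Fdiff n m nm).
  have := re_le_N2 (cmeasurableB (mF m) (mF n)); apply: le_trans.
  by rewrite le_eqVlt; apply/orP; left; apply/eqP; apply: eq_integral => x _; rewrite reD reN.
have [B [mB hB]] : exists A : R -> R, measurable_fun setT A /\
    forall n, (\int[mu]_x ((im (F n x) - A x) ^+ 2)%:E <= (rf_rate n)%:E)%E.
  apply: riesz_fischer => [n|n m nm]; first by case: (mF n).
  apply: le_trans (Fdiff n m nm).
  have := im_le_N2 (cmeasurableB (mF m) (mF n)); apply: le_trans.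
  by rewrite le_eqVlt; apply/orP; left; apply/eqP; apply: eq_integral => x _; rewrite imD imN.
pose H k := A k +i* B k.
have mH : cmeasurable_fun setT H by split.
have FH n : (N2 (fun k => (F n k - H k)%R) <= (2 * rf_rate n)%:E)%E.
  rewrite N2E; last exact: cmeasurableB.
  rewrite mulr_natl mulr2n EFinD; apply: leeD.
  - by apply: le_trans (hA n); rewrite le_eqVlt; apply/orP; left; apply/eqP; apply: eq_integral => x _; rewrite reD reN.
  - by apply: le_trans (hB n); rewrite le_eqVlt; apply/orP; left; apply/eqP; apply: eq_integral => x _; rewrite imD imN.
have FHoo : (N2 (fun k => (F 0%N k - H k)%R) < +oo)%E by rewrite (le_lt_trans (FH 0%N))// ltry.
have Foo n : (N2 (F n) < +oo)%E.
  by rewrite plancherel ?expr1n// lte_mul_pinfty// lee_fin ltW// pi2_gt0.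
exists H; split => //.
- have -> : N2 H = N2 (fun k => F 0%N k + (-1) * (F 0%N k - H k)).
    by apply: eq_N2 => k; congr nsq; ring.
  have m3 : cmeasurable_fun setT (fun k => -1 * (F 0%N k - H k)).
    by apply: cmeasurableM; [exact: cmeasurable_cst|exact: cmeasurableB].
  apply: (le_lt_trans (N2D_le (mF 0%N) m3)).
  have -> : N2 (fun k => -1 * (F 0%N k - H k)) = N2 (fun k => (F 0%N k - H k)).
    by apply: eq_N2 => x; rewrite mulN1r /nsq reN imN !sqrrN.
  by apply: lte_add_pinfty; apply: lte_mul_pinfty => //; rewrite lee_fin.
- exists (fun n x => (g n x)%:C); split => //.
  + apply/(ge0_ecvg0P (fun n => N2_ge0 _)) => e e0.
    have e1 : 0 < e * (8 * pi) by rewrite !mulr_gt0// pi_gt0.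
    have /cvgr0Pnorm_le/(_ _ e1) := rf_rate_cvg0; apply: filterS => n hn.
    apply: (le_trans (N2gf n)); rewrite lee_fin /del ler_pdivrMr ?mulr_gt0 ?pi_gt0//.
    by rewrite (le_trans (ler_norm _)).
  + apply/(ge0_ecvg0P (fun n => N2_ge0 _)) => e e0.
    have e1 : 0 < e / 2 by rewrite divr_gt0.
    have /cvgr0Pnorm_le/(_ _ e1) := rf_rate_cvg0; apply: filterS => n hn.
    apply: (le_trans (FH n)); rewrite lee_fin; have := le_trans (ler_norm _) hn; lra.
Unshelve. all: by end_near. Qed.

End fourier_existence.

(** * The fundamental solution *)

Section evolution_symbol.
Context {R : realType}.
Notation mu := (@lebesgue_measure R).
Local Notation re := complex.Re.
Local Notation im := complex.Im.
Local Notation normc := Normc.normc.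

Lemma cmeasurable_cexp d (T : measurableType d) (h : T -> R[i]) :
  cmeasurable_fun setT h -> cmeasurable_fun setT (fun x => cexp (h x)).
Proof.
move=> [h1 h2]; apply: (@cmeasurableM _ _ _ (fun x => (expR (re (h x)))%:C) (fun x => cis (im (h x)))).
- by apply: cmeasurable_real; exact: (measurableT_comp (@measurable_expR R)).
- exact: cmeasurable_cis.
Qed.

(** The inverse is the conjugate divided by the squared modulus, also at 0, where the inverse is 0
    by convention. *)
Lemma cmeasurableV d (T : measurableType d) (h : T -> R[i]) :
  cmeasurable_fun setT h -> cmeasurable_fun setT (fun x => (h x)^-1).
Proof.
move=> mh.
have E (z : R[i]) : z^-1 = (nsq z `^ (-1))%:C * z^*%C.
  rewrite powR_inv1 ?nsq_ge0//; have [->|z0] := eqVneq z 0.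
    rewrite invr0; apply: complex_eq; rewrite ?reM ?imM /= ?oppr0; ring.
  apply: (mulfI z0); rewrite mulfV// mulrCA mul_conj -rmorphM/= mulVf ?rmorph1//.
  apply: contra_neq z0 => h0; apply: complex_eq => /=.
  - by apply/eqP; move/eqP: h0; rewrite /nsq paddr_eq0 ?sqr_ge0// !sqrf_eq0 => /andP[].
  - by apply/eqP; move/eqP: h0; rewrite /nsq paddr_eq0 ?sqr_ge0// !sqrf_eq0 => /andP[].
under eq_fun do rewrite E.
apply: cmeasurableM; last exact: cmeasurable_conj.
apply: cmeasurable_real; apply: (measurableT_comp (measurable_powR (-1))).
exact: measurable_nsq.
Qed.

(* [cdecay alpha k = (1 + |k|)^(- alpha)] dominates every transform below. *)
Definition cdecay (alpha k : R) : R := (1 + `|k|) `^ (- alpha).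

Lemma cdecay_ge0 alpha k : 0 <= cdecay alpha k. Proof. exact: powR_ge0. Qed.

Lemma measurable_cdecay alpha : measurable_fun setT (cdecay alpha).
Proof.
apply: (measurableT_comp (measurable_powR (- alpha))).
by apply: measurable_funD => //; exact: measurableT_comp.
Qed.

Lemma integrable_cdecay alpha : 1 < alpha -> mu.-integrable setT (EFin \o cdecay alpha).
Proof.
move=> a1.
have c1 : continuous (cdecay alpha).
  move=> k; have k1 : 0 < 1 + `|k| by rewrite ltr_pwDl.
  apply: (@continuous_comp _ _ _ (fun k : R => 1 + `|k|) (fun x : R => x `^ (- alpha))).
    by apply: cvgD; [exact: cvg_cst|exact: norm_continuous].
  by apply/differentiable_continuous/derivable1_diffP; have [] := is_derive1_powR (- alpha) k1.
apply/integrable_ge0P; [exact: cdecay_ge0|exact: measurable_cdecay|].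
rewrite ge0_symfun_integralT//; last 2 first.
- by move=> k; exact: cdecay_ge0.
- by move=> k; rewrite /cdecay /= normrN.
rewrite -set_itvcy.
pose F (x : R) := (1 + x) `^ (1 - alpha) / (1 - alpha).
pose g (x : R) := (1 + x) `^ (- alpha).
have dF (x : R) : 0 <= x -> is_derive x 1 F (g x).
  move=> x0; have x1 : 0 < 1 + x by rewrite ltr_pwDl.
  have h1 : is_derive x 1 (fun x : R => 1 + x) 1.
    have h := is_deriveD (is_derive_cst (1 : R) x 1) (is_derive_id x (1 : R)).
    by apply: (is_derive_eq h); rewrite add0r.
  have h2 := @is_derive1_comp R (fun y : R => y `^ (1 - alpha)) (fun x : R => 1 + x) x _ _
    (is_derive1_powR (1 - alpha) x1) h1.
  have h3 := is_deriveZ (1 - alpha)^-1 h2.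
  rewrite (_ : F = (1 - alpha)^-1 *: ((fun y : R => y `^ (1 - alpha)) \o (fun x : R => 1 + x))).
    apply: (is_derive_eq h3); rewrite /GRing.scale /= mulr1 mulrA mulVf ?mul1r.
      by rewrite /g; congr (_ `^ _); ring.
    by rewrite subr_eq0 lt_eqF.
  by apply/funext => y; rewrite /F /= mulrC.
rewrite (@ge0_continuous_FTC2y _ (cdecay alpha) F 0 0).
- by rewrite -EFinB lte_mul_pinfty// ltry.
- by move=> x _; exact: cdecay_ge0.
- exact: continuous_subspaceT.
- apply/cvgr0Pnorm_le => e e0.
  have b0 : 0 < alpha - 1 by rewrite subr_gt0.
  have eb0 : 0 < e * (alpha - 1) by rewrite mulr_gt0.
  near=> x.
  have x1 : ((e * (alpha - 1))^-1) `^ (alpha - 1)^-1 <= x by near: x; apply: nbhs_pinfty_ge; exact: num_real.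
  have x0 : 0 <= x by apply: le_trans x1; exact: powR_ge0.
  have x10 : 0 < 1 + x by rewrite ltr_pwDl.
  rewrite /F normrM (ger0_norm (powR_ge0 _ _)) normfV -(opprB alpha 1) normrN (gtr0_norm b0).
  rewrite ler_pdivrMr// powRN -[leRHS]invrK lef_pV2 ?posrE ?invr_gt0 ?powR_gt0//.
  rewrite -[leLHS]powRr1 ?invr_ge0 ?(ltW eb0)// -[X in _ `^ X <= _](mulVf (lt0r_neq0 b0)) powRrM.
  apply: ge0_ler_powR; rewrite ?nnegrE ?powR_ge0//; [exact: ltW|exact: ltW|].
  by rewrite (le_trans x1)// lerDr.
- by move=> x x0; have [] := dF x (ltW x0).
- apply: cvg_at_right_filter.
  by apply/differentiable_continuous/derivable1_diffP; have [] := dF 0 (lexx _).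
- move=> x; rewrite in_itv/= andbT => x0; rewrite derive1E.
  have -> : cdecay alpha x = g x by rewrite /cdecay /g gtr0_norm.
  by have [_ ->] := dF x (ltW x0).
Unshelve. all: by end_near. Qed.

Lemma cdecay_bound (alpha k : R) : 1 < alpha <= 2 -> (1 + `|k|) `^ alpha <= 4 * (1 + `|k| `^ alpha).
Proof.
move=> /andP[a1 a2]; have a0 : 0 <= alpha by rewrite ltW// (lt_trans _ a1).
have two : 2 `^ alpha <= 4 :> R.
  apply: (@le_trans _ _ (2 `^ 2)); first by rewrite ler_powR// ler1n.
  by rewrite (@powR_mulrn _ 2 2)// expr2 -natrM.
move: (`|k|) (normr_ge0 k) => x x0.
have [x1|x1] := leP x 1.
  apply: (@le_trans _ _ (2 `^ alpha)).
    by apply: ge0_ler_powR => //; rewrite ?nnegrE ?addr_ge0//; lra.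
  by rewrite (le_trans two)// ler_peMr// lerDl powR_ge0.
apply: (@le_trans _ _ ((2 * x) `^ alpha)).
  by apply: ge0_ler_powR => //; rewrite ?nnegrE ?addr_ge0 ?mulr_ge0//; lra.
rewrite powRM//; apply: ler_pM; rewrite ?powR_ge0//.
by rewrite lerDr.
Qed.

(** Merges a bound for low frequencies with one of order [|k|^(- alpha)] for high frequencies into a
    single integrable majorant, free of the singularity at 0. *)
Lemma cdecay_min (alpha k a b : R) : 1 < alpha <= 2 -> 0 <= a -> 0 <= b ->
  forall y, 0 <= y -> y <= a -> y * `|k| `^ alpha <= b ->
  y <= 4 * (a + b) * cdecay alpha k.
Proof.
move=> al a0 b0 y y0 ya yb.
have p0 : 0 < (1 + `|k|) `^ alpha by rewrite powR_gt0// ltr_pwDl.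
rewrite /cdecay powRN ler_pdivlMr//.
apply: (@le_trans _ _ (y * (4 * (1 + `|k| `^ alpha)))).
  by rewrite ler_wpM2l// cdecay_bound.
by rewrite mulrCA ler_pM2l// mulrDr mulr1 lerD.
Qed.

End evolution_symbol.

(** * Integrals over a time interval *)

Section time_integrals.
Context {R : realType}.
Notation mu := (@lebesgue_measure R).
Local Notation re := complex.Re.
Local Notation im := complex.Im.
Local Notation normc := Normc.normc.

Lemma is_derive_continuous (F f : R -> R) : (forall x : R, is_derive x 1 F (f x)) -> continuous F.
Proof. by move=> dF x; apply/differentiable_continuous/derivable1_diffP; have [] := dF x. Qed.

Lemma integral_indic_oo (f : R -> R) (a b : R) :
  (\int[mu]_x (\1_(`]a, b[%classic) x * f x)%:E = \int[mu]_(x in `]a, b[) (f x)%:E)%E.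
Proof.
rewrite [RHS]integral_mkcond; apply: eq_integral => x _.
by rewrite patchE indicE; case: ifPn => _; rewrite ?mul1r ?mul0r.
Qed.

(** Time integrals are written on the whole line with an indicator, so that the Fubini lemmas on the
    plane apply to them. *)
Lemma integral_indic_FTC (f F : R -> R) (t : R) : 0 < t -> continuous f ->
  (forall x : R, is_derive x 1 F (f x)) ->
  (\int[mu]_x (\1_(`]0, t[%classic) x * f x)%:E = (F t - F 0)%:E)%E.
Proof.
move=> t0 cf dF; have cF := is_derive_continuous dF.
have mf : measurable_fun setT f by exact: continuous_measurable_fun.
rewrite integral_indic_oo integral_itv_bndo_bndc; last first.
  by apply/measurable_EFinP; exact: measurable_funTS.
rewrite integral_itv_obnd_cbnd; last by apply/measurable_EFinP; exact: measurable_funTS.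
rewrite (@continuous_FTC2 _ f F 0 t)//.
- exact: continuous_subspaceT.
- split.
  + by move=> x _; have [] := dF x.
  + by apply: cvg_at_right_filter; exact: cF.
  + by apply: cvg_at_left_filter; exact: cF.
- by move=> x _; rewrite derive1E; have [_ ->] := dF x.
Qed.

Lemma bounded_N2_lty (h : R -> R[i]) (B : R) : cintegrable setT h -> 0 <= B ->
  (forall k, normc (h k) <= B) -> (N2 h < +oo)%E.
Proof.
move=> ih B0 hB; have mh := cintegrable_measurable ih.
have i1 : mu.-integrable setT (EFin \o (fun x => nsq (h x))).
  apply: (@integrable_le _ _ _ mu _ (fun x => B * normc (h x))).
  - exact: measurable_nsq.
  - by apply: integrableZE; exact: integrable_normc.
  - by move=> x; rewrite ger0_norm ?nsq_ge0// -normc_nsq expr2 ler_wpM2r ?normc_ge0.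
by have := integrable_lty measurableT i1.
Qed.

(** The function is the real part of exp((a + i b) s) (u + i v). The imaginary part is the same
    formula with [(v, - u)] in place of [(u, v)]. *)
Lemma is_derive_expR_cis (a b u v s : R) :
  is_derive s 1 (fun s => expR (a * s) * (u * cos (b * s) - v * sin (b * s)))
    (expR (a * s) * ((a * u - b * v) * cos (b * s) - (a * v + b * u) * sin (b * s))).
Proof.
have ha c : is_derive s 1 (fun s : R => c * s) c.
  by apply: is_derive_eq; rewrite /GRing.scale/= mulr1.
have dE := @is_derive1_comp R expR (fun s : R => a * s) s _ _ (is_derive_expR _) (ha a).
have dS := @is_derive1_comp R sin (fun s : R => b * s) s _ _ (is_derive_sin _) (ha b).
have dC := @is_derive1_comp R cos (fun s : R => b * s) s _ _ (is_derive_cos _) (ha b).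
have h := is_deriveM dE (is_deriveB (is_deriveZ u dC) (is_deriveZ v dS)).
apply: (is_derive_eq h); rewrite /= !fctE /= /GRing.scale /=; ring.
Qed.

End time_integrals.

(** * The symbol, its exponential and the Duhamel term *)

Section evolution.
Context {R : realType}.
Notation mu := (@lebesgue_measure R).
Local Notation re := complex.Re.
Local Notation im := complex.Im.
Local Notation normc := Normc.normc.
Variables alpha theta nu d : R.
Hypothesis halpha : 1 < alpha <= 2.
Hypothesis htheta : `|theta| <= Num.min alpha (2 - alpha).
Hypothesis hd : 0 < d.

Local Notation sym := (symbol alpha theta nu d).
Local Notation Gh := (Ghat alpha theta nu d).
Let beta : R := theta * pi / 2.
Let kap : R := d * cos beta.

Let cos_beta_gt0 : 0 < cos beta.
Proof.
apply: cos_gt0_pihalf; rewrite -ltr_norml /beta.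
have th1 : `|theta| < 1.
  move: htheta; rewrite le_min => /andP[_ h2]; case/andP: halpha => h1 _; lra.
rewrite -mulrA normrM (ger0_norm (_ : 0 <= pi / 2)); last by rewrite divr_ge0// pi_ge0.
by rewrite -[ltRHS]mul1r ltr_pM2r// divr_gt0// pi_gt0.
Qed.

Let kap_gt0 : 0 < kap. Proof. exact: mulr_gt0. Qed.

Let alpha_gt0 : 0 < alpha. Proof. by case/andP: halpha => h _; exact: lt_trans h. Qed.

Let powalpha (k : R) : R := `|k| `^ alpha.

Let powalpha_ge0 k : 0 <= powalpha k. Proof. exact: powR_ge0. Qed.

Lemma symbolE k : sym k = (- (d * (powalpha k * cos (Num.sg k * theta * pi / 2)))) +i*
  (nu * k - d * (powalpha k * sin (Num.sg k * theta * pi / 2))).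
Proof.
rewrite /symbol /psi cexp_im -/(powalpha k).
by apply: complex_eq; rewrite !(reD, imD, reN, imN, reM, imM) /=; ring.
Qed.

(** Evenness of the cosine removes the sign of [k]; at [k = 0], where that sign is 0, the power of
    [|k|] vanishes. *)
Lemma re_symbol k : re (sym k) = - (kap * powalpha k).
Proof.
rewrite symbolE /= (_ : kap * powalpha k = d * (powalpha k * cos beta)); last by rewrite /kap; ring.
congr (- (_ * _)); rewrite /powalpha /beta; have [k0|k0|<-] := ltgtP 0 k.
- by rewrite gtr0_sg// mul1r.
- by rewrite ltr0_sg// mulN1r !mulNr cosN.
- by rewrite normr0 powR0 ?mulr0 ?mul0r// gt_eqF.
Qed.

Lemma im_symbol k : im (sym k) = nu * k - d * powalpha k * (if 0 < k then sin beta else - sin beta).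
Proof.
rewrite symbolE /= -[d * powalpha k * _]mulrA; congr (_ - (_ * _)).
rewrite /powalpha /beta; have [k0|k0|<-] := ltgtP 0 k.
- by rewrite gtr0_sg// mul1r.
- by rewrite ltr0_sg// mulN1r !mulNr sinN.
- by rewrite normr0 powR0 ?mul0r// gt_eqF.
Qed.

Lemma measurable_powalpha : measurable_fun setT powalpha.
Proof.
apply: (measurableT_comp (measurable_powR alpha)).
by apply: continuous_measurable_fun; exact: norm_continuous.
Qed.

Lemma cmeasurable_symbol : cmeasurable_fun setT sym.
Proof.
split.
- under eq_fun do rewrite re_symbol; apply: measurableT_comp => //.
  by apply: measurable_funM => //; exact: measurable_powalpha.
- under eq_fun do rewrite im_symbol; apply: measurable_funB; first exact: measurable_funM.
  apply: measurable_funM; first by apply: measurable_funM => //; exact: measurable_powalpha.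
  by apply: measurable_fun_ifT => //; exact: measurable_fun_ltr.
Qed.

Lemma symbol0 : sym 0 = 0.
Proof.
by apply: complex_eq; rewrite ?re_symbol ?im_symbol /powalpha normr0 powR0 ?gt_eqF// !mulr0 ?oppr0// mul0r subr0.
Qed.

Lemma symbol_neq0 k : k != 0 -> sym k != 0.
Proof.
move=> k0; apply/eqP => h; have := re_symbol k; rewrite h /= => /eqP.
rewrite eq_sym oppr_eq0 mulf_eq0 (gt_eqF kap_gt0)/= gt_eqF//.
by rewrite powR_gt0// normr_gt0.
Qed.

Lemma GhatE k t : Gh k t = (expR (re (sym k) * t))%:C * cis (im (sym k) * t).
Proof.
rewrite /Ghat; have -> : sym k * t%:C = (re (sym k) * t) +i* (im (sym k) * t).
  by apply: complex_eq; rewrite ?reM ?imM /= !mulr0 ?subr0 ?add0r.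
by [].
Qed.

Lemma Ghat0 k : Gh k 0 = 1.
Proof. by rewrite GhatE !mulr0 expR0 cis0 mulr1. Qed.

Lemma Ghat_at0 t : Gh 0 t = 1.
Proof. by rewrite GhatE symbol0 /= !mul0r expR0 cis0 mulr1. Qed.

Lemma normc_Ghat k t : normc (Gh k t) = expR (- (kap * powalpha k * t)).
Proof.
by rewrite GhatE Normc.normcM normcC normc_cis mulr1 ger0_norm ?expR_ge0// re_symbol mulNr.
Qed.

Lemma normc_Ghat_le1 k t : 0 <= t -> normc (Gh k t) <= 1.
Proof.
by move=> t0; rewrite normc_Ghat -expR0 ler_expR oppr_le0 !mulr_ge0// ltW.
Qed.

Lemma Ghat_derive k (w : R[i]) (s : R) :
  is_derive s 1 (fun s => re (Gh k s * w)) (re (sym k * Gh k s * w)) /\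
  is_derive s 1 (fun s => im (Gh k s * w)) (im (sym k * Gh k s * w)).
Proof.
set a := re (sym k); set b := im (sym k).
have E s' : Gh k s' = (expR (a * s') * cos (b * s')) +i* (expR (a * s') * sin (b * s')).
  by rewrite GhatE -/a -/b; apply: complex_eq; rewrite ?reM ?imM /cis /=; ring.
split.
- have h := @is_derive_expR_cis _ a b (re w) (im w) s.
  have Ew : (fun s => re (Gh k s * w)) =
      (fun s => expR (a * s) * (re w * cos (b * s) - im w * sin (b * s))).
    by apply/funext => s'; rewrite E reM; cbn [complex.Re complex.Im]; ring.
  rewrite Ew; apply: (is_derive_eq h); rewrite E !reM !imM -/a -/b; cbn [complex.Re complex.Im]; ring.
- have h := @is_derive_expR_cis _ a b (im w) (- re w) s.
  have Ew : (fun s => im (Gh k s * w)) =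
      (fun s => expR (a * s) * (im w * cos (b * s) - - re w * sin (b * s))).
    by apply/funext => s'; rewrite E imM; cbn [complex.Re complex.Im]; ring.
  rewrite Ew; apply: (is_derive_eq h); rewrite E imM (reM (sym k)) (imM (sym k)) -/a -/b; cbn [complex.Re complex.Im]; ring.
Qed.

Lemma cmeasurable_Ghat2 : cmeasurable_fun [set: R * R] (fun p => Gh p.1 p.2).
Proof.
apply: cmeasurable_cexp; apply: cmeasurableM.
- exact: (cmeasurable_comp cmeasurable_symbol).
- exact: cmeasurable_real.
Qed.

(** From [1 + x <= expR x] at [x = kap * |k|^alpha * t]. The constant blows up like [1 / t], so this
    bound settles a fixed time but cannot be integrated over time down to 0. *)
Lemma Ghat_bound k t : 0 < t -> normc (Gh k t) <= 4 * (1 + (kap * t)^-1) * cdecay alpha k.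
Proof.
move=> t0; apply: cdecay_min => //.
- by rewrite invr_ge0 mulr_ge0// ltW.
- exact: normc_ge0.
- by apply: normc_Ghat_le1; exact: ltW.
- rewrite normc_Ghat expRN -/(powalpha k).
  have kt : 0 < kap * t by rewrite mulr_gt0.
  rewrite mulrC ler_pdivrMr ?expR_gt0// ler_pdivlMl//.
  rewrite (le_trans _ (expR_ge1Dx _))// (_ : kap * t * powalpha k = kap * powalpha k * t); last by ring.
  by rewrite lerDr.
Qed.

Lemma cintegrable_Ghat t : 0 < t -> cintegrable setT (Gh ^~ t).
Proof.
move=> t0; apply: (@cintegrable_le _ _ (fun k => 4 * (1 + (kap * t)^-1) * cdecay alpha k)).
- exact: (cmeasurable_comp cmeasurable_Ghat2 (p := fun k => (k, t))).
- by apply: integrableZE; apply: integrable_cdecay; case/andP: halpha.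
- by move=> k; exact: Ghat_bound.
Qed.

Lemma N2_Ghat t : 0 < t -> (N2 (Gh ^~ t) < +oo)%E.
Proof.
move=> t0; apply: (@bounded_N2_lty _ _ 1) => //; first exact: cintegrable_Ghat.
by move=> k; apply: normc_Ghat_le1; exact: ltW.
Qed.

Lemma reZ (x : R) (z : R[i]) : re (x%:C * z) = x * re z.
Proof. by rewrite reM /= mul0r subr0. Qed.

Lemma imZ (x : R) (z : R[i]) : im (x%:C * z) = x * im z.
Proof. by rewrite imM /= mul0r addr0. Qed.

Lemma cintegrable_oo (a b : R) (h : R -> R[i]) :
  cintegrable setT (fun x => (\1_(`]a, b[%classic) x)%:C * h x) -> cintegrable `]a, b[ h.
Proof.
have H (f : R -> R) : mu.-integrable setT (EFin \o (fun x => \1_(`]a, b[%classic) x * f x)) ->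
    mu.-integrable `]a, b[ (EFin \o f).
  move=> fi; apply/integrable_mkcond => //; apply: eq_integrable fi => // x _.
  by rewrite patchE /= indicE; case: ifPn => _; rewrite ?mul1r ?mul0r.
move=> [h1 h2]; split; apply: H.
- by move: h1; under eq_fun do rewrite reZ.
- by move: h2; under eq_fun do rewrite imZ.
Qed.

Lemma cintegral_oo (a b : R) (h : R -> R[i]) :
  cintegral `]a, b[ h = cintegral setT (fun x => (\1_(`]a, b[%classic) x)%:C * h x).
Proof.
by apply: complex_eq => /=; rewrite /Rintegral -integral_indic_oo; congr fine;
  apply: eq_integral => x _; rewrite ?reZ ?imZ.
Qed.

Lemma Ghat_shift_derive k (w : R[i]) (t s : R) :
  is_derive s 1 (fun s => re (Gh k (t - s) * w)) (- re (sym k * Gh k (t - s) * w)) /\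
  is_derive s 1 (fun s => im (Gh k (t - s) * w)) (- im (sym k * Gh k (t - s) * w)).
Proof.
have dr : is_derive s 1 (fun s : R => t - s) (-1).
  by apply: (is_derive_eq (is_deriveB (is_derive_cst t s 1) (is_derive_id s 1))); rewrite sub0r.
have [h1 h2] := Ghat_derive k w (t - s).
split.
- by have := @is_derive1_comp R (fun s => re (Gh k s * w)) (fun s => t - s) s _ _ h1 dr; rewrite mulrN1.
- by have := @is_derive1_comp R (fun s => im (Gh k s * w)) (fun s => t - s) s _ _ h2 dr; rewrite mulrN1.
Qed.

(* The transform of [G_time_integral _ t], in closed form; the symbol vanishes only at
   [k = 0]. *)
Definition duhamel (t k : R) : R[i] := if k == 0 then t%:C else (Gh k t - 1) / sym k.

(** The Duhamel integrand on the plane, frequency first and time second. *)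
Let kernel (t : R) (p : R * R) : R[i] := (\1_(`]0, t[%classic) p.2)%:C * Gh p.1 (t - p.2).

Lemma cintegral_duhamel t k : 0 < t -> cintegral setT (fun s => kernel t (k, s)) = duhamel t k.
Proof.
move=> t0; rewrite /kernel /duhamel /=; have [->|k0] := eqVneq k 0.
  under eq_cintegral => s do rewrite Ghat_at0 mulr1.
  rewrite cintegral_real; congr _%:C; rewrite /Rintegral.
  under eq_integral => s _ do rewrite -[\1_ _ s]mulr1.
  rewrite (@integral_indic_FTC _ (fun=> 1) (fun s => s))//= ?subr0//.
  by move=> x; exact: cvg_cst.
(* With this factor [Gh k (t - s) * w] is an antiderivative of [Gh k (t - s)] in [s]. *)
have s0 := symbol_neq0 k0; pose w : R[i] := - (sym k)^-1.
have E (s : R) : sym k * Gh k (t - s) * w = - Gh k (t - s).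
  by rewrite /w mulrN mulrAC divff// mul1r.
have d1 (s : R) : is_derive s 1 (fun s => re (Gh k (t - s) * w)) (re (Gh k (t - s))).
  by have [h _] := Ghat_shift_derive k w t s; rewrite E reN opprK in h.
have d2 (s : R) : is_derive s 1 (fun s => im (Gh k (t - s) * w)) (im (Gh k (t - s))).
  by have [_ h] := Ghat_shift_derive k w t s; rewrite E imN opprK in h.
have c1 : continuous (fun s : R => re (Gh k (t - s))).
  apply: (@is_derive_continuous _ _ (fun s => - re (sym k * Gh k (t - s) * 1))) => s.
  by have [h _] := Ghat_shift_derive k 1 t s; under eq_fun do rewrite -[Gh _ _]mulr1.
have c2 : continuous (fun s : R => im (Gh k (t - s))).
  apply: (@is_derive_continuous _ _ (fun s => - im (sym k * Gh k (t - s) * 1))) => s.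
  by have [_ h] := Ghat_shift_derive k 1 t s; under eq_fun do rewrite -[Gh _ _]mulr1.
have F : (Gh k t - 1) / sym k = Gh k (t - t) * w - Gh k (t - 0) * w.
  by rewrite subrr Ghat0 subr0 /w; ring.
rewrite F; apply: complex_eq; cbn [complex.Re complex.Im cintegral]; rewrite /Rintegral.
- under eq_integral => s _ do rewrite reZ.
  by rewrite (integral_indic_FTC t0 c1 d1).
- under eq_integral => s _ do rewrite imZ.
  by rewrite (integral_indic_FTC t0 c2 d2).
Qed.

Lemma cmeasurable_kernel t : cmeasurable_fun setT (kernel t).
Proof.
apply: cmeasurableM.
- apply: cmeasurable_real; apply: (measurableT_comp (f := \1_(`]0, t[%classic) : R -> R) _ measurable_snd); exact: measurable_indic.
- apply: (cmeasurable_comp cmeasurable_Ghat2 (p := fun p : R * R => (p.1, t - p.2))).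
  apply/measurable_fun_pairP; split => /=; first exact: measurable_fst.
  by apply: measurable_funB => //; exact: measurable_snd.
Qed.

Let rkernel (t : R) (p : R * R) : R :=
  \1_(`]0, t[%classic) p.2 * expR (- (kap * powalpha p.1 * (t - p.2))).

Lemma normc_kernel t p : normc (kernel t p) = rkernel t p.
Proof.
by rewrite /kernel Normc.normcM normcC normc_Ghat ger0_norm.
Qed.

Lemma rkernel_le t p : 0 <= rkernel t p <= \1_(`]0, t[%classic) p.2.
Proof.
rewrite /rkernel mulr_ge0 ?expR_ge0//= indicE; case: (boolP (_ \in _)); rewrite ?mul0r// inE /= in_itv/= mul1r.
move=> /andP[_ st]; rewrite -expR0 ler_expR oppr_le0 !mulr_ge0 ?subr_ge0//; exact: ltW.
Qed.

Lemma cintegrable2_swap (K : R * R -> R[i]) : cintegrable2 K ->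
  cintegrable2 (fun p => K (p.2, p.1)).
Proof.
have H (f : R * R -> R) : (mu \x mu)%E.-integrable setT (fun p => (f p)%:E) ->
    (mu \x mu)%E.-integrable setT (fun p : R * R => (f (p.2, p.1))%:E).
  move=> fi; have /integrableP[mf _] := fi.
  have /(@integrable12ltyP _ _ _ _ _ mu mu) := fi => foo; apply/integrable21ltyP; last exact: foo.
  apply: (measurableT_comp mf); apply/measurable_fun_pairP; split => /=; first exact: measurable_snd.
  exact: measurable_fst.
by move=> [k1 k2]; split; [exact: (H (fun p => re (K p)))|exact: (H (fun p => im (K p)))].
Qed.

(** The integrand is at most 1, which gives the bound [t]. With [c = kap * |k|^alpha] positive the
    integral is [(1 - expR (- (c * t))) / c], at most [1 / c]. These are the two bounds that
    [cdecay_min] merges. *)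
Lemma integral_rkernel t k : 0 < t ->
  (\int[mu]_s (rkernel t (k, s))%:E <= (4 * (t + kap^-1) * cdecay alpha k)%:E)%E.
Proof.
move=> t0; pose c := kap * powalpha k.
have c0 : 0 <= c by rewrite mulr_ge0// ltW.
have dr c' (s : R) : is_derive s 1 (fun s : R => - (c' * (t - s))) c'.
  have h := is_deriveN (is_deriveZ c' (is_deriveB (is_derive_cst t s 1) (is_derive_id s 1))).
  by apply: (is_derive_eq h); rewrite /GRing.scale/= sub0r mulrN1 opprK.
have de c' (s : R) : is_derive s 1 (fun s : R => expR (- (c' * (t - s)))) (c' * expR (- (c' * (t - s)))).
  have h := @is_derive1_comp R expR (fun s : R => - (c' * (t - s))) s _ _ (is_derive_expR _) (dr c' s).
  by apply: (is_derive_eq h); rewrite mulrC.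
have ce : continuous (fun s : R => expR (- (c * (t - s)))).
  exact: (is_derive_continuous (de c)).
have mk : measurable_fun setT (fun s => rkernel t (k, s)).
  rewrite /rkernel /=; apply: measurable_funM; first exact: measurable_indic.
  exact: (continuous_measurable_fun ce).
have I1 : (\int[mu]_s (\1_(`]0, t[%classic) s)%:E)%E = t%:E.
  under eq_integral => s _ do rewrite -[\1_ _ s]mulr1.
  rewrite (@integral_indic_FTC _ (fun=> 1) (fun s => s))//= ?subr0//.
  by move=> x; exact: cvg_cst.
have le1 : (\int[mu]_s (rkernel t (k, s))%:E <= t%:E)%E.
  rewrite -I1; apply: (@ge0_le_integralE _ _ _ mu (fun s => rkernel t (k, s)) (\1_(`]0, t[%classic))) => // s.
  exact: (rkernel_le t (k, s)).
have ge0 : (0 <= \int[mu]_s (rkernel t (k, s))%:E)%E.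
  by apply: integral_ge0 => s _; rewrite lee_fin; case/andP: (rkernel_le t (k, s)).
have fin : (\int[mu]_s (rkernel t (k, s))%:E)%E \is a fin_num.
  by rewrite ge0_fin_numE//; exact: le_lt_trans le1 (ltry _).
rewrite -(fineK fin) lee_fin; apply: cdecay_min => //; [exact: ltW|by rewrite invr_ge0 ltW|exact: fine_ge0| |].
  by rewrite -lee_fin fineK.
rewrite -/(powalpha k); have [p0|p0] := eqVneq (powalpha k) 0.
  by rewrite p0 mulr0 invr_ge0 ltW.
have cp : 0 < c by rewrite mulr_gt0// lt_def p0/=.
have dF (s : R) : is_derive s 1 (fun s : R => c^-1 * expR (- (c * (t - s)))) (expR (- (c * (t - s)))).
  by apply: (is_derive_eq (is_deriveZ c^-1 (de c s))); rewrite /GRing.scale/= mulrA mulVf ?mul1r// gt_eqF.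
rewrite (integral_indic_FTC t0 ce dF)/= subrr mulr0 oppr0 expR0 -mulrBr.
rewrite mulrAC /c invfM mulfVK// ler_piMr ?invr_ge0 ?(ltW kap_gt0)//.
Qed.

(** Tonelli with time integrated first: in the other order [Ghat_bound] would leave a majorant of
    order [1 / (t - s)], not integrable at [s = t]. *)
Lemma integrable_rkernel t : 0 < t -> (mu \x mu)%E.-integrable setT (EFin \o rkernel t).
Proof.
move=> t0; have mr : measurable_fun setT (rkernel t).
  rewrite (_ : rkernel t = fun p => normc (kernel t p)); last by apply/funext => p; rewrite normc_kernel.
  apply: measurable_normc; exact: cmeasurable_kernel.
apply/integrable12ltyP; first exact/measurable_EFinP.
apply: (@le_lt_trans _ _ (\int[mu]_k (4 * (t + kap^-1) * cdecay alpha k)%:E)%E).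
  apply: ge0_le_integral => //.
  - by move=> k _; exact: integral_ge0.
  - apply: (@measurable_fun_fubini_tonelli_F _ _ _ _ _ mu (fun p => `|rkernel t p|%:E)) => //.
    by apply/measurable_EFinP; exact: measurableT_comp.
  - by apply/measurable_EFinP; apply: measurable_funM => //; exact: measurable_cdecay.
  - move=> k _; apply: le_trans (integral_rkernel k t0); rewrite le_eqVlt; apply/orP; left; apply/eqP.
    by apply: eq_integral => s _ /=; rewrite ger0_norm//; case/andP: (rkernel_le t (k, s)).
have h : mu.-integrable setT (EFin \o (fun k => 4 * (t + kap^-1) * cdecay alpha k)).
  by apply: integrableZE; apply: integrable_cdecay; case/andP: halpha.
exact: (integrable_lty measurableT h).
Qed.

Lemma cintegrable2_kernel t : 0 < t -> cintegrable2 (kernel t).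
Proof.
move=> t0; apply: (@cintegrable2_le _ _ (rkernel t)).
- exact: cmeasurable_kernel.
- exact: integrable_rkernel.
- by move=> p; rewrite normc_kernel.
Qed.

Lemma cintegrable_kernel1 t k : cintegrable setT (fun s => kernel t (k, s)).
Proof.
apply: (@cintegrable_le _ _ (\1_(`]0, t[%classic))).
- apply: (cmeasurable_comp (cmeasurable_kernel t) (p := fun s => (k, s))).
  exact: pair1_measurable.
- exact: integrable_indic_itv.
- by move=> s; rewrite normc_kernel; case/andP: (rkernel_le t (k, s)).
Qed.

Lemma cintegrable_duhamel t : 0 < t -> cintegrable setT (duhamel t).
Proof.
move=> t0; rewrite (_ : duhamel t = fun k => cintegral setT (fun s => kernel t (k, s))).
  exact: cintegrable_cintegral2 (cintegrable2_kernel t0).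
by apply/funext => k; rewrite cintegral_duhamel.
Qed.

Lemma duhamel_bounded t k : 0 < t -> normc (duhamel t k) <= 2 * t.
Proof.
move=> t0; rewrite -cintegral_duhamel//.
have It : t = \int[mu]_s (\1_(`]0, t[%classic) s).
  rewrite /Rintegral; under eq_integral => s _ do rewrite -[\1_ _ s]mulr1.
  rewrite (@integral_indic_FTC _ (fun=> 1) (fun s => s))//= ?subr0//.
  by move=> x; exact: cvg_cst.
rewrite [in leRHS]It; apply: normc_cintegral_le; [exact: cintegrable_kernel1|exact: integrable_indic_itv|].
by move=> s; rewrite normc_kernel; case/andP: (rkernel_le t (k, s)).
Qed.

Lemma N2_duhamel t : 0 < t -> (N2 (duhamel t) < +oo)%E.
Proof.
move=> t0; apply: (@bounded_N2_lty _ _ (2 * t)); [exact: cintegrable_duhamel|rewrite mulr_ge0// ltW//|].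
by move=> k; exact: duhamel_bounded.
Qed.

Lemma G_integrandE x t k : G_integrand alpha theta nu d x t k = Gh k t * cis (-1 * (x * k)).
Proof. by rewrite /G_integrand cexp_im mulrC mulN1r [x * k]mulrC. Qed.

Lemma cintegrable_G_integrand x t : 0 < t ->
  cintegrable setT (G_integrand alpha theta nu d x t).
Proof.
move=> t0; rewrite (_ : G_integrand _ _ _ _ x t = fun k => Gh k t * cis (-1 * (x * k))).
  exact/cintegrable_ft/cintegrable_Ghat.
by apply/funext => k; rewrite G_integrandE.
Qed.

Lemma G_inv_ft x t : G alpha theta nu d x t = inv_ft (Gh ^~ t) x.
Proof.
by rewrite /G /inv_ft; congr (_ * _); apply: eq_cintegral => k; rewrite G_integrandE.
Qed.

(** A character has modulus 1, so [integrable_rkernel] still dominates; Fubini then gives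
    integrability in time and moves the time integral inside the inverse transform. *)
Lemma G_time_integralE z t : 0 < t ->
  cintegrable `]0, t[ (fun s => G alpha theta nu d z (t - s)) /\
  G_time_integral alpha theta nu d z t = inv_ft (duhamel t) z.
Proof.
move=> t0; pose K (p : R * R) : R[i] := kernel t p * cis (-1 * (z * p.1)).
have iK : cintegrable2 K.
  apply: (@cintegrable2_le _ _ (rkernel t)).
  - apply: cmeasurableM; first exact: cmeasurable_kernel.
    apply: cmeasurable_cis; apply: measurable_funM => //; exact: measurable_funM.
  - exact: integrable_rkernel.
  - by move=> p; rewrite Normc.normcM normc_cis mulr1 normc_kernel.
have E s : (\1_(`]0, t[%classic) s)%:C * G alpha theta nu d z (t - s) =
    ((2 * pi)^-1)%:C * cintegral setT (fun k => K (k, s)).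
  rewrite G_inv_ft /inv_ft mulrCA; congr (_ * _); rewrite /ft /K /kernel /= indicE.
  (* Outside the interval the indicator erases [G z (t - s)], whatever value it has at times that
     are not positive. *)
  case: (s \in _).
    by rewrite mul1r; apply: eq_cintegral => k; rewrite mul1r.
  rewrite mul0r (eq_cintegral _ (g := fun=> 0%:C)); last by move=> k; rewrite !mul0r.
  by rewrite cintegral_real Rintegral_cst// mul0r.
have iK' := cintegrable_cintegral2 (cintegrable2_swap iK).
split.
  by apply: cintegrable_oo; under eq_fun do rewrite E; exact: cintegrableZ.
rewrite /G_time_integral cintegral_oo; under eq_cintegral do rewrite E.
rewrite cintegralZ// -cfubini// /inv_ft; congr (_ * _); apply: eq_cintegral => k.
by rewrite /K /= cintegralZr ?cintegral_duhamel//; exact: cintegrable_kernel1.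
Qed.

Lemma cmeasurable_duhamel2 : cmeasurable_fun [set: R * R] (fun p => duhamel p.2 p.1).
Proof.
have m0 : measurable_fun [set: R * R] (fun p => p.1 == 0).
  apply: (measurable_fun_eqr (f := fun p : R * R => p.1) (g := fun=> 0)) => //; exact: measurable_fst.
have [a1 a2] : cmeasurable_fun [set: R * R] (fun p => (p.2)%:C).
  exact: cmeasurable_real.
have [b1 b2] : cmeasurable_fun [set: R * R] (fun p => (Gh p.1 p.2 - 1) / sym p.1).
  apply: cmeasurableM.
    by apply: cmeasurableB; [exact: cmeasurable_Ghat2|exact: cmeasurable_cst].
  by apply: cmeasurableV; exact: (cmeasurable_comp cmeasurable_symbol).
by split; under eq_fun do rewrite /duhamel fun_if; exact: measurable_fun_ifT.
Qed.

Section transform.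
Variables fhat ghat : R -> R[i].

Definition uhat (k t : R) : R[i] := Gh k t * ghat k + duhamel t k * fhat k.

Lemma uhat0 k : uhat k 0 = ghat k.
Proof.
by rewrite /uhat Ghat0 mul1r /duhamel Ghat0 subrr mul0r if_same mul0r addr0.
Qed.

(** [- fhat k / sym k] is the stationary solution of the equation at frequency [k]; subtracting it
    leaves a single exponential to differentiate. *)
Lemma uhatE k t : k != 0 -> uhat k t = Gh k t * (ghat k + fhat k / sym k) - fhat k / sym k.
Proof. by move=> /negPf k0; rewrite /uhat /duhamel k0; ring. Qed.

Lemma uhat_derive k t : k != 0 ->
  is_cderive (uhat k) t (sym k * uhat k t + fhat k).
Proof.
move=> k0; pose w := ghat k + fhat k / sym k; pose c := fhat k / sym k.
have -> : sym k * uhat k t + fhat k = sym k * Gh k t * w.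
  have Ec : sym k * c = fhat k by rewrite /c mulrCA divff ?mulr1// symbol_neq0.
  by rewrite uhatE// -/w -/c mulrBr Ec subrK mulrA.
have -> : uhat k = fun s => Gh k s * w - c by apply/funext => s; rewrite uhatE.
have [h1 h2] := Ghat_derive k w t; split.
- rewrite (_ : (fun s => _) = (fun s => re (Gh k s * w)) - cst (re c)); last first.
    by apply/funext => s; rewrite reD reN.
  by apply: (is_derive_eq (is_deriveB h1 (is_derive_cst (re c) t 1))); rewrite subr0.
- rewrite (_ : (fun s => _) = (fun s => im (Gh k s * w)) - cst (im c)); last first.
    by apply/funext => s; rewrite imD imN.
  by apply: (is_derive_eq (is_deriveB h2 (is_derive_cst (im c) t 1))); rewrite subr0.
Qed.

Lemma uhat_continuous k : k != 0 -> ccontinuous_within `[0, +oo[ (uhat k).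
Proof.
move=> k0; split; apply: continuous_subspaceT.
- by apply: (@is_derive_continuous _ _ (fun t => re (sym k * uhat k t + fhat k))) => t; have [] := uhat_derive t k0.
- by apply: (@is_derive_continuous _ _ (fun t => im (sym k * uhat k t + fhat k))) => t; have [] := uhat_derive t k0.
Qed.

Hypothesis mf : cmeasurable_fun setT fhat.
Hypothesis mg : cmeasurable_fun setT ghat.
Hypothesis foo : (N2 fhat < +oo)%E.
Hypothesis goo : (N2 ghat < +oo)%E.

Lemma cmeasurable_uhat2 : cmeasurable_fun [set: R * R] (fun p => uhat p.1 p.2).
Proof.
apply: cmeasurableD; apply: cmeasurableM.
- exact: cmeasurable_Ghat2.
- exact: (cmeasurable_comp mg).
- exact: cmeasurable_duhamel2.
- exact: (cmeasurable_comp mf).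
Qed.

(** For positive times both multipliers are in L^2, hence integrable against L^2 data; at [t = 0]
    the multiplier [Gh] is 1 and this gain is lost. *)
Lemma cintegrable_uhat t : 0 < t ->
  cintegrable setT (fun k => Gh k t * ghat k) /\ cintegrable setT (fun k => duhamel t k * fhat k).
Proof.
move=> t0; split; apply: cintegrable_mulL2 => //.
- exact/cintegrable_measurable/cintegrable_Ghat.
- exact: N2_Ghat.
- exact/cintegrable_measurable/cintegrable_duhamel.
- exact: N2_duhamel.
Qed.

Lemma N2_uhat t : 0 < t -> (N2 (uhat ^~ t) < +oo)%E.
Proof.
move=> t0; have [i1 i2] := cintegrable_uhat t0.
apply: le_lt_trans (N2D_le (cintegrable_measurable i1) (cintegrable_measurable i2)) _.
(* Square integrability uses the other property of the multipliers, boundedness. *)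
have H (P h : R -> R[i]) (B : R) : cintegrable setT P -> cmeasurable_fun setT h ->
    (N2 h < +oo)%E -> 0 <= B -> (forall k, normc (P k) <= B) -> (N2 (fun k => P k * h k)%R < +oo)%E.
  move=> iP mh hoo B0 PB; have mP := cintegrable_measurable iP.
  apply: (@le_lt_trans _ _ (N2 (fun k => B%:C * h k))).
    apply: N2_le; [exact: cmeasurableM|apply: cmeasurableM => //; exact: cmeasurable_cst|].
    move=> k; rewrite !nsqM nsqC ler_wpM2r ?nsq_ge0//.
    by rewrite -normc_nsq lerXn2r// nnegrE ?normc_ge0.
  by rewrite N2Z// lte_mul_pinfty// lee_fin sqr_ge0.
apply: lte_add_pinfty; apply: lte_mul_pinfty => //.
- by apply: (H _ _ 1) => //; [exact: cintegrable_Ghat|move=> k; apply: normc_Ghat_le1; exact: ltW].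
- by apply: (H _ _ (2 * t)) => //; [exact: cintegrable_duhamel|rewrite mulr_ge0// ltW|move=> k; exact: duhamel_bounded].
Qed.

End transform.

End evolution.

(** * Assembly of the solution and its convolution formula *)

Lemma Lfun2P (R : realType) (f : R -> R) : f \in Lfun (@lebesgue_measure R) 2%:E ->
  measurable_fun setT f /\ (\int[@lebesgue_measure R]_x (f x ^+ 2)%:E < +oo)%E.
Proof.
move=> hf; have mf : measurable_fun setT f.
  by move: hf; rewrite inE => /andP[+ _]; rewrite inE.
split => //; have := Lfun2_integrable_sqr hf => h.
exact: (integrable_lty measurableT h).
Qed.

Lemma inv_ftD (R : realType) (P Q : R -> R[i]) (x : R) :
  cintegrable setT P -> cintegrable setT Q ->
  inv_ft (fun k => P k + Q k) x = inv_ft P x + inv_ft Q x.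
Proof.
move=> iP iQ; rewrite /inv_ft -mulrDr; congr (_ * _).
rewrite /ft -cintegralD; [|exact: cintegrable_ft|exact: cintegrable_ft].
by apply: eq_cintegral => k; rewrite mulrDl.
Qed.

Theorem theorem3p1p1 (R : realType) (alpha theta nu d : R) (f g0 : R -> R)
  (halpha : 1 < alpha <= 2)
  (htheta : `|theta| <= Num.min alpha (2 - alpha))
  (hd : 0 < d)
  (hf : f \in Lfun (@lebesgue_measure R) 2%:E)
  (hg0 : g0 \in Lfun (@lebesgue_measure R) 2%:E) :
  (forall x t : R, 0 < t ->
     cintegrable [set: R] (G_integrand alpha theta nu d x t)) /\
  exists u : R -> R -> R[i],
    fourier_solution alpha theta nu d
      (fun x => (f x)%:C) (fun x => (g0 x)%:C) u /\
    forall x t : R, 0 < t ->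
      [/\ forall y : R,
            cintegrable `]0, t[
              (fun tau => G alpha theta nu d (x - y) (t - tau)),
          cintegrable [set: R]
            (fun y => G_time_integral alpha theta nu d (x - y) t * (f y)%:C),
          cintegrable [set: R]
            (fun y => G alpha theta nu d (x - y) t * (g0 y)%:C) &
          u x t =
            cintegral [set: R]
              (fun y => G_time_integral alpha theta nu d (x - y) t * (f y)%:C)
            + cintegral [set: R]
              (fun y => G alpha theta nu d (x - y) t * (g0 y)%:C)].
Proof.
have [mf foo] := Lfun2P hf; have [mg goo] := Lfun2P hg0.
have [fhat Ff] := fourierN2_exists mf foo; have [ghat Fg] := fourierN2_exists mg goo.
have [_ _ mfh fhoo _] := Ff; have [_ _ mgh ghoo _] := Fg.
have iG (x t : R) (t0 : 0 < t) := cintegrable_G_integrand nu halpha htheta hd x t0.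
split; first exact: iG.
pose U := uhat alpha theta nu d fhat ghat.
(* At [t = 0] the function [U] is [ghat], which need not be integrable, so [inv_ft] would not
   recover [g0]. *)
pose u (x t : R) : R[i] := if t == 0 then (g0 x)%:C else inv_ft (U^~ t) x.
have iU t : 0 < t -> cintegrable setT (U^~ t).
  move=> t0; have [] := cintegrable_uhat nu halpha htheta hd mfh mgh fhoo ghoo t0.
  by move=> *; exact: cintegrableD.
have FU t : 0 <= t -> is_fourierL2 (u^~ t) (U^~ t).
  rewrite le_eqVlt => /predU1P[<-|t0]; apply: fourierN2_is_fourierL2.
    rewrite (_ : u^~ 0 = fun x => (g0 x)%:C); last by apply/funext => x; rewrite /u eqxx.
    by rewrite (_ : U^~ 0 = ghat)//; apply/funext => k; exact: uhat0.
  rewrite (_ : u^~ t = inv_ft (U^~ t)); last by apply/funext => x; rewrite /u gt_eqF.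
  by apply: fourier_inv_ft; [exact: iU|exact: N2_uhat].
exists u; split.
  split.
  - by move=> t /FU[].
  - by move=> x; rewrite /u eqxx.
  - exists fhat, ghat, U; split => //; [exact: fourierN2_is_fourierL2|exact: fourierN2_is_fourierL2| |].
    + have [m1 m2] := cmeasurable_uhat2 theta nu d halpha mfh mgh.
      by split; exact: measurable_funTS.
    (* The derivative of [uhat] is computed from [uhatE], which divides by the symbol; frequency 0
       is a null set. *)
    + have h : {ae @lebesgue_measure R, forall k, k != 0}.
        exists [set 0]; split => //; first exact: lebesgue_measure_set1.
        by move=> k /= /negP; rewrite negbK => /eqP.
      apply: (ae_lebesgueS h) => k k0; split.
      * exact: uhat_continuous.
      * by move=> t _; exact: uhat_derive.
      * exact: uhat0.
move=> x t t0.
have iGh := cintegrable_Ghat nu halpha htheta hd t0.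
have iD := cintegrable_duhamel nu halpha htheta hd t0.
have GT z := G_time_integralE nu halpha htheta hd z t0.
have [c1 e1] := inv_ft_conv x iD (N2_duhamel nu halpha htheta hd t0) Ff.
have [c2 e2] := inv_ft_conv x iGh (N2_Ghat nu halpha htheta hd t0) Fg.
have E1 : (fun y => G_time_integral alpha theta nu d (x - y) t * (f y)%:C) =
    (fun y => inv_ft (duhamel alpha theta nu d t) (x - y) * (f y)%:C).
  by apply/funext => y; have [_ ->] := GT (x - y).
have E2 : (fun y => G alpha theta nu d (x - y) t * (g0 y)%:C) =
    (fun y => inv_ft (Ghat alpha theta nu d ^~ t) (x - y) * (g0 y)%:C).
  by apply/funext => y; rewrite G_inv_ft.
split.
- by move=> y; have [] := GT (x - y).
- by rewrite E1.
- by rewrite E2.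
(* Both convolutions are now inverse transforms of the two terms of [uhat], and [inv_ft] is additive
   on integrable functions. *)
- rewrite E1 E2 e1 e2 /u gt_eqF//.
  have [i1 i2] := cintegrable_uhat nu halpha htheta hd mfh mgh fhoo ghoo t0.
  by rewrite addrC -inv_ftD.
Qed.
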